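(* Let $(X,\mathsf{c})$ be a network with transition operator $P$ on $\ell^2(X^0,\mathsf{m}^0)$ and averaging operator $A$ on $L^2(X^1,\mathsf{m}^1)$, and let $\rho=\rho(P)$ be the spectral radius of $P$. Then the spectral radius of $A$ is $$ \rho(A)=\begin{cases}1, & \text{if } \rho=1,\\[4pt] \dfrac{\sqrt{1-\rho^2}}{\arccos(\rho)}, & \text{if } \rho<1.\end{cases} $$
   Context: Network: $X$ is a countable (finite or infinite) connected graph with symmetric neighbourhood relation $\sim$, without loops or multiple edges, and with at least one edge; $X^0$ is its vertex set. Each edge $[x,y]=[y,x]$ is viewed as a copy of the unit interval, edges being glued together at common endpoints, and $X^1$ is the resulting one-skeleton: its points are $(xy,t)$ with $x\sim y$, $0\le t\le 1$, the point at distance $t$ from $x$ on $[x,y]$, so that $(xy,0)=x$ and $(xy,t)=(yx,1-t)$. Each edge has a conductance $\mathsf{c}(xy)=\mathsf{c}(yx)>0$, and $\mathsf{m}^0(x)=\sum_{y:y\sim x}\mathsf{c}(xy)$ is assumed finite for every $x\in X^0$; $\mathsf{m}^0$ is regarded as a discrete measure on $X^0$. The measure $\mathsf{m}^1$ on $X^1$ is $\mathsf{c}(xy)\,dt$ on the interior of each edge $[x,y]$, and the vertex set has $\mathsf{m}^1$-measure $0$. Hilbert spaces (complex): $\ell^2(X^0,\mathsf{m}^0)$ has inner product $\langle g_1,g_2\rangle=\sum_{x\in X^0}g_1(x)\overline{g_2(x)}\,\mathsf{m}^0(x)$; $L^2(X^1,\mathsf{m}^1)$ has inner product $\langle F_1,F_2\rangle=\frac12\sum_{x\in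 X^0}\sum_{y\sim x}\mathsf{c}(xy)\int_0^1F_1(xy,t)\overline{F_2(xy,t)}\,dt$. Operators: $Pg(x)=\frac{1}{\mathsf{m}^0(x)}\sum_{y\sim x}\mathsf{c}(xy)g(y)$ and $$AF(xy,t)=\frac{1}{\mathsf{m}^0(x)}\sum_{u\sim x}\mathsf{c}(xu)\int_0^{1-t}F(xu,s)\,ds+\frac{1}{\mathsf{m}^0(y)}\sum_{v\sim y}\mathsf{c}(yv)\int_0^{t}F(yv,s)\,ds .$$ $P$ and $A$ are self-adjoint with norm at most $1$ on these spaces. *)

(* Defs.v *)
From mathcomp Require Import all_boot all_order all_algebra.
From mathcomp Require Import all_classical all_reals all_analysis.
From mathcomp Require Import complex.
Set Implicit Arguments.
Unset Strict Implicit.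
Unset Printing Implicit Defensive.
Import Order.TTheory GRing.Theory Num.Theory.
Import numFieldNormedType.Exports.
Local Open Scope classical_set_scope.
Local Open Scope ring_scope.

(* The library norm on R[i] takes its values in R[i]. *)
Definition cabs (R : realType) (z : R[i]) : R :=
  Num.sqrt (complex.Re z ^+ 2 + complex.Im z ^+ 2).

(* Sum of an absolutely summable family over an arbitrary index set,
   positive part minus negative part, then componentwise for complex values. *)
Definition rsum (R : realType) (I : choiceType) (D : set I) (f : I -> R) : R :=
  fine (esum D (EFin \o f)^\+ - esum D (EFin \o f)^\-)%E.

Definition csum (R : realType) (I : choiceType) (D : set I) (f : I -> R[i]) :
  R[i] :=
  Complex (rsum D (fun i => complex.Re (f i)))
          (rsum D (fun i => complex.Im (f i))).

Definition cintegral (R : realType) (a b : R) (f : R -> R[i]) : R[i] :=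
  Complex (\int[lebesgue_measure]_(s in `[a, b]) complex.Re (f s))
          (\int[lebesgue_measure]_(s in `[a, b]) complex.Im (f s)).

(* A Hilbert space whose elements are classes of functions is given by its
   representatives: [H] is the set of representatives inside the vector space
   [E], [nrm] the (semi)norm, and f, g in H represent the same vector when
   [is_null H nrm (f - g)]. *)
Section Spectrum.
Variables (R : realType) (E : lmodType R[i]) (H : set E) (nrm : E -> R).

Definition is_null (f : E) : Prop := H f /\ nrm f = 0.

Definition bounded_operator (S : E -> E) : Prop :=
  [/\ forall f, H f -> H (S f),
      forall (a : R[i]) f g, H f -> H g ->
        is_null (S (a *: f + g) - (a *: S f + S g)) &
      exists M : R, forall f, H f -> nrm (S f) <= M * nrm f].

Definition resolvent_set (T : E -> E) : set R[i] :=
  [set lambda | exists S : E -> E,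
    [/\ bounded_operator S,
        forall f, H f -> is_null (lambda *: S f - T (S f) - f) &
        forall f, H f -> is_null (S (lambda *: f - T f) - f)]].

Definition spectrum (T : E -> E) : set R[i] := ~` resolvent_set T.

Definition spectral_radius (T : E -> E) : R := sup (@cabs R @` spectrum T).

End Spectrum.

(* The values of [cond] matter only at pairs of neighbours. *)
Record network (R : realType) (V : countType) := Network {
  nbr : rel V;
  cond : V -> V -> R;
  nbr_sym : symmetric nbr;
  nbr_irr : irreflexive nbr;
  nbr_connected : forall x y, exists2 p, path nbr x p & last x p = y;
  nbr_edge : exists x y, nbr x y;
  cond_sym : forall x y, nbr x y -> cond x y = cond y x;
  cond_gt0 : forall x y, nbr x y -> 0 < cond x y;
  cond_fin : forall x,
    (\esum_(y in [set y | nbr x y]) (cond x y)%:E < +oo)%E }.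

Section Operators.
Variables (R : realType) (V : countType) (N : network R V).

Local Notation nbrs x := [set y | nbr N x y].
Local Notation c := (cond N).

Definition m0 (x : V) : R := fine (\esum_(y in nbrs x) (c x y)%:E)%E.

Definition vertex_fun : lmodType R[i] := V -> R[i]^o.

Definition normsq0 (g : vertex_fun) : \bar R :=
  (\esum_(x in [set: V]) (cabs (g x) ^+ 2 * m0 x)%:E)%E.

Definition ell2 : set vertex_fun := [set g | (normsq0 g < +oo)%E].

Definition norm0 (g : vertex_fun) : R := Num.sqrt (fine (normsq0 g)).

Definition transition (g : vertex_fun) : vertex_fun :=
  fun x => ((m0 x)^-1)%:C%C * csum (nbrs x) (fun y => (c x y)%:C%C * g y).

(* A function F on the one-skeleton is written in the coordinates (xy,t):
   F x y t is meaningful only for x ~ y and 0 <= t <= 1. *)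
Definition skel_fun : lmodType R[i] := V -> V -> R -> R[i]^o.

(* Compatibility with (xy,t) = (yx,1-t) and with the gluing of the edges at
   a common vertex (xy,0) = (xz,0) = x. *)
Definition on_skeleton (F : skel_fun) : Prop :=
  (forall x y t, nbr N x y -> 0 <= t <= 1 -> F x y t = F y x (1 - t)) /\
  (forall x y z, nbr N x y -> nbr N x z -> F x y 0 = F x z 0).

Definition measurable_skeleton (F : skel_fun) : Prop :=
  forall x y, nbr N x y ->
    measurable_fun (`[0, 1] : set R) (fun t : R => complex.Re (F x y t)) /\
    measurable_fun (`[0, 1] : set R) (fun t : R => complex.Im (F x y t)).

(* The factor 1/2 compensates for the two orientations of each edge. *)
Definition normsq1 (F : skel_fun) : \bar R :=
  ((2^-1)%:E * \esum_(x in [set: V]) \esum_(y in nbrs x)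
     ((c x y)%:E *
      \int[lebesgue_measure]_(t in `[0%R, 1%R]) (cabs (F x y t) ^+ 2)%:E))%E.

Definition L2 : set skel_fun :=
  [set F | [/\ on_skeleton F, measurable_skeleton F & (normsq1 F < +oo)%E]].

Definition norm1 (F : skel_fun) : R := Num.sqrt (fine (normsq1 F)).

Definition averaging (F : skel_fun) : skel_fun := fun x y t =>
  ((m0 x)^-1)%:C%C *
    csum (nbrs x) (fun u => (c x u)%:C%C * cintegral 0 (1 - t) (F x u)) +
  ((m0 y)^-1)%:C%C *
    csum (nbrs y) (fun v => (c y v)%:C%C * cintegral 0 t (F y v)).

Definition rhoP : R := spectral_radius ell2 norm0 transition.

Definition rhoA : R := spectral_radius L2 norm1 averaging.

End Operators.

(* Main.v *)
Require Import Defs.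
From mathcomp Require Import all_boot all_order all_algebra.
From mathcomp Require Import all_classical all_reals all_analysis.
From mathcomp Require Import measurable_realfun complex ring lra.

(** Put r = cos w and l = sin w / w, and let phi t = sin (w t).  Then
    l phi'(t) = phi (1 - t) + r phi t, and this equation links P with A.  For g
    on the vertices, interpolate along each edge,
      F (xy,t) = g x * phi (1 - t) + g y * phi t.
    Integrating F over the initial segments of the edges at x, the values g x
    average to g x and the values at the other ends average to P g x, so that
      A F - l F = the interpolation of P g - r g by the primitive of phi
    ([star_interpolate], [act_interpolate]).  Solutions, subsolutions and
    approximate solutions of P g = r g thus become those of A F = l F.  Take
    r = rho(P), w = acos r, so that sin w = sqrt (1 - r^2).

    rho(A) >= l.  A positive symmetric operator T of norm L has approximate
    eigenvectors for L: if f >= 0 nearly attains the norm then T^2 f is close to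
    L^2 f, and T f + L f, which is at least L f, is nearly an eigenvector
    ([approximate_eigenvector]).  In particular rho(P) is the norm of P
    ([rhoP_op_norm]), and interpolating these approximate eigenvectors puts l in
    the spectrum of A ([approximate_interpolate]).

    rho(A) <= l.  Let 0 < v < w.  As cos v exceeds the norm of P, the resolvent
    of P at cos v, applied to a point mass, is a function h with
    P h <= cos v * h; it is positive because the network is connected
    ([superharmonic_exists]).  Its interpolation F with frequency v is positive
    and A F <= (sin v / v) F, so the Schur test bounds the norm of A by
    sin v / v ([superharmonic_op_bound]).  The spectrum lies in the disc of that
    radius by Neumann series ([neumann]), and v tends to w ([sinc_bound]).

    If rho(P) = 1, the same argument works with phi t = t, l = 1 and h = 1.

    The spectral arguments are common to P and A.  Both are positive symmetric
    operators on square-integrable functions on a union of unit intervals with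
    identifications (a vertex being an interval collapsed to a point), given by
    an operator on functions with values in [0, +oo], for which every sum and
    integral exists ([frame], [markov]). *)

Set Implicit Arguments.
Unset Strict Implicit.
Unset Printing Implicit Defensive.
Import Order.TTheory GRing.Theory Num.Theory.
Import numFieldNormedType.Exports.
Local Open Scope classical_set_scope.
Local Open Scope ring_scope.

Local Notation leb := lebesgue_measure.

(** * Countable sums, and integrals over the unit interval *)

Section Sums.
Context {R : realType}.
Local Open Scope ereal_scope.

Lemma esumZl {T : choiceType} (D : set T) (a : T -> \bar R) (r : R) :
  (0 <= r)%R -> (forall i, D i -> 0 <= a i) ->
  \esum_(i in D) (r%:E * a i) = r%:E * \esum_(i in D) a i.
Proof.
rewrite le_eqVlt => /predU1P[<-|r0] a0.
  by rewrite mul0e esum1// => i _; rewrite mul0e.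
rewrite /esum -ereal_sup_pZl//; congr ereal_sup; apply/seteqP.
have E X : fsets D X ->
    \sum_(i \in X) (r%:E * a i) = r%:E * \sum_(i \in X) a i.
  move=> [finX XD]; rewrite !fsbig_finite//= [LHS]big_seq [in RHS]big_seq.
  by rewrite ge0_sume_distrr// => i; rewrite in_fset_set// => /set_mem /XD /a0.
by split=> [_ [X DX <-]|_ [_ [X DX <-] <-]] /=; [exists (\sum_(i \in X) a i);
  [exists X|rewrite E]|exists X; rewrite ?E].
Qed.

Lemma ge0_esumZl {T : choiceType} (D : set T) (a : T -> \bar R) (r : \bar R) :
  0 <= r -> (forall i, D i -> 0 <= a i) ->
  \esum_(i in D) (r * a i) = r * \esum_(i in D) a i.
Proof.
case: r => [r| |] // r0 a0; first by rewrite lee_fin in r0; exact: esumZl.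
have [[i [Di ai]]|noi] := pselect (exists i, D i /\ 0 < a i).
  have le (b : T -> \bar R) : (forall j, D j -> 0 <= b j) -> b i <= \esum_(j in D) b j.
    move=> b0; apply: esum_ge; exists [set i]; last by rewrite fsbig_set1.
    by split=> // j ->.
  rewrite gt0_mulye; last exact: lt_le_trans ai (le _ a0).
  apply/eqP; rewrite -leye_eq; apply: (le_trans _ (le (fun i => +oo * a i) _)).
    by rewrite gt0_mulye.
  by move=> j Dj; rewrite mule_ge0 ?a0.
have a00 i : D i -> a i = 0.
  move=> Di; apply/eqP; rewrite eq_le a0// andbT leNgt; apply/negP => ai.
  by apply: noi; exists i.
by rewrite !esum1 ?mule0// => i Di; rewrite a00 ?mule0.
Qed.

Lemma swap_esum {T1 T2 : choiceType} (A : set T1) (B : T1 -> set T2)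
   (B' : set T2) (A' : T2 -> set T1) (a : T1 -> T2 -> \bar R) :
  (forall x y, (A x /\ B x y) <-> (B' y /\ A' y x)) ->
  (forall x y, A x -> B x y -> 0 <= a x y) ->
  \esum_(x in A) \esum_(y in B x) a x y = \esum_(y in B') \esum_(x in A' y) a x y.
Proof.
move=> AB a0; rewrite !esum_esum//; last first.
  by move=> y x yB xA; have [] := (AB x y).2 (conj yB xA); exact: a0.
rewrite (reindex_esum (B' `*`` A') _ (fun p => (p.2, p.1)))//; split => /=.
- by move=> [y x] /= h; exact/AB.
- by move=> [y x] [y' x'] _ _ /= [-> ->].
- by move=> [x y] /= h; exists (y, x) => //; exact/AB.
Qed.

(** The exchange theorems for integrals concern series; enumerating the index
    type transfers them to sums over countable sets. *)
Lemma esum_nneseries {T : countType} (D : set T) (a : T -> \bar R) :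
  (forall i, D i -> 0 <= a i) ->
  \esum_(i in D) a i =
  \sum_(n <oo) (if pickle_inv n is Some i then if i \in D then a i else 0
                else 0).
Proof.
move=> a0; rewrite nneseries_esumT; last first.
  by move=> n; case: pickle_inv => // i; case: ifPn => // /set_mem /a0.
set g : nat -> \bar R := fun n => _.
rewrite esum_mkcond; transitivity (\esum_(n in range (@pickle T)) g n).
  rewrite esum_image; last by move=> x y _ _; exact: (pcan_inj pickleK).
  by apply: eq_esum => i _; rewrite /g pickleK_inv.
rewrite esum_mkcond; apply: eq_esum => n _; case: ifPn => //.
rewrite notin_setE /= => h; rewrite /g.
have := @pickle_invK T n; case: pickle_inv => //= i ni.
by exfalso; apply: h; exists i.
Qed.

Section exchange.
Context d (T : measurableType d) (mu : {measure set T -> \bar R}).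
Variables (D : set T) (mD : measurable D) (I : countType) (A : set I).
Variable f : I -> T -> \bar R.
Hypothesis mf : forall i, A i -> measurable_fun D (f i).
Hypothesis f0 : forall i x, A i -> D x -> 0 <= f i x.

Let g (n : nat) (x : T) : \bar R :=
  if pickle_inv n is Some i then if i \in A then f i x else 0 else 0.

Let mg n : measurable_fun D (g n).
Proof.
rewrite /g; case: (pickle_inv n) => [i|]; last exact: measurable_cst.
by case: (boolP (i \in A)) => [/set_mem Ai|_]; [exact: mf|exact: measurable_cst].
Qed.

Let g0 n x : D x -> 0 <= g n x.
Proof.
move=> Dx; rewrite /g; case: (pickle_inv n) => // i.
by case: ifPn => // /set_mem Ai; exact: f0.
Qed.

Let esum_g x : D x -> \esum_(i in A) f i x = \sum_(n <oo) g n x.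
Proof. by move=> Dx; rewrite esum_nneseries// => i Ai; exact: f0. Qed.

Lemma measurable_esum : measurable_fun D (fun x => \esum_(i in A) f i x).
Proof.
apply: (eq_measurable_fun (fun x => \sum_(n <oo) g n x)).
  by move=> x /set_mem /esum_g.
by apply: ge0_emeasurable_sum => // n x Dx _; exact: g0.
Qed.

Lemma integral_esum : \int[mu]_(x in D) (\esum_(i in A) f i x) =
  \esum_(i in A) \int[mu]_(x in D) f i x.
Proof.
rewrite (eq_integral (fun x => \sum_(n <oo) g n x)); last first.
  by move=> x /set_mem /esum_g.
rewrite integral_nneseries// esum_nneseries; last first.
  by move=> i Ai; apply: integral_ge0 => x; exact: f0.
apply: eq_eseriesr => n _; rewrite /g; case: (pickle_inv n) => [i|]; last first.
  by rewrite integral0.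
by case: (i \in A) => //; rewrite integral0.
Qed.

End exchange.
End Sums.

Section UnitInterval.
Context {R : realType}.
Local Open Scope ereal_scope.
Implicit Types f h k : R -> \bar R.

Local Notation U := (`[0%R, 1%R]%classic : set (measurableTypeR R)).

Lemma onem_itv (t : R) : (0 <= t <= 1)%R -> (0 <= 1 - t <= 1)%R.
Proof. lra. Qed.

Lemma measurable_onem (D : set (measurableTypeR R)) :
  measurable_fun D ((fun t => 1 - t)%R : measurableTypeR R -> measurableTypeR R).
Proof. exact: measurable_funB. Qed.

Lemma lebesgue_measure_onem (A : set (measurableTypeR R)) : measurable A ->
  pushforward leb ((fun t => 1 - t)%R : _ -> measurableTypeR R) A = leb A.
Proof.
move=> mA; apply/esym/lebesgue_measure_unique => //=.
  exact: measurable_onem.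
move=> _ _ [[a b]] _ <-; rewrite /pushforward.
rewrite (_ : _ @^-1` _ = [set` `[(1 - b)%R, (1 - a)%R[]); last first.
  by apply/seteqP; split=> t /=; rewrite !in_itv/=; lra.
rewrite !lebesgue_measure_itv/= !lte_fin; congr (if _ then _ else _).
  by apply/idP/idP; lra.
by rewrite -!EFinB; congr EFin; lra.
Qed.

Lemma measurable_fun_onem f :
  measurable_fun U f -> measurable_fun U (fun t => f (1 - t)%R).
Proof.
move=> mf.
have UU : [set (1 - t)%R | t in U] `<=` U.
  by move=> _ [t + <-]; rewrite /= !in_itv/=; exact: onem_itv.
by apply: measurable_comp UU mf (@measurable_onem U); exact: measurable_itv.
Qed.

Lemma integral_onem f : measurable_fun U f -> (forall t, U t -> 0 <= f t) ->
  \int[leb]_(t in U) f (1 - t)%R = \int[leb]_(t in U) f t.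
Proof.
move=> mf f0.
transitivity
  (\int[pushforward leb ((fun t => 1 - t)%R : _ -> measurableTypeR R)]_(t in U) f t).
  rewrite ge0_integral_pushforward//=.
  - congr integral; apply/seteqP; split=> t /=; rewrite !in_itv/=; lra.
  - exact: measurable_onem.
  - by move=> t /set_mem; exact: f0.
apply: eq_measure_integral => //=; first exact: measurable_onem.
by move=> _ A mA _; exact: lebesgue_measure_onem.
Qed.

Let tri f h (p : measurableTypeR R * measurableTypeR R) : \bar R :=
  if (p.1 + p.2 <= 1)%R then (f \_ U) p.1 * (h \_ U) p.2 else 0.

Let tri_ge0 f h p : (forall t, U t -> 0 <= f t) ->
  (forall t, U t -> 0 <= h t) -> 0 <= tri f h p.
Proof.
move=> f0 h0; rewrite /tri; case: ifP => // _.
by rewrite mule_ge0 ?erestrict_ge0.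
Qed.

Let measurable_tri f h : measurable_fun U f -> measurable_fun U h ->
  measurable_fun setT (tri f h).
Proof.
move=> mf mh; apply: measurable_fun_ifT => //.
  apply: measurable_fun_ler; last exact: measurable_cst.
  by apply: measurable_funD; [exact: measurable_fst|exact: measurable_snd].
apply: emeasurable_funM.
  apply: (measurableT_comp (f := f \_ U)); last exact: measurable_fst.
  exact: (measurable_restrictT _ (measurable_itv _)).1 mf.
apply: (measurableT_comp (f := h \_ U)); last exact: measurable_snd.
exact: (measurable_restrictT _ (measurable_itv _)).1 mh.
Qed.

Let fubini_tri f h t : (forall t, U t -> 0 <= f t) ->
  measurable_fun U h -> (forall t, U t -> 0 <= h t) ->
  \int[leb]_s tri f h (t, s) =
  ((fun t => f t * \int[leb]_(s in `[0%R, (1 - t)%R]) h s) \_ U) t.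
Proof.
move=> f0 mh h0; rewrite /tri /= [RHS]patchE; case: ifPn => tU; last first.
  rewrite integral0_eq// => s _; case: ifP => // _.
  by rewrite patchE (negPf tU) mul0e.
have t01 : (0 <= t <= 1)%R by move: tU; rewrite inE /= in_itv.
have sub : `[0%R, (1 - t)%R]%classic `<=` U.
  by move=> s /=; rewrite !in_itv/=; lra.
have mh' : measurable_fun (`[0%R, (1 - t)%R] : set (measurableTypeR R)) h.
  exact: (measurable_funS (measurable_itv _) sub mh).
have ft0 : 0 <= f t by apply: f0; exact/set_mem.
rewrite -(ge0_integralZl _ _ mh')//; last by move=> s /sub; exact: h0.
rewrite [RHS]integral_mkcond; apply: eq_integral => s _.
rewrite 3!patchE tU !mem_setE/= !in_itv/=.
have [ts|ts] := leP (t + s)%R 1%R; last first.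
  by rewrite ifF//; apply/negP; lra.
have [s0|s0] := leP 0%R s => /=; last by rewrite mule0.
by rewrite !ifT//; lra.
Qed.

(** Both sides are the double integral of f t * h s over the triangle
    t + s <= 1, which is symmetric in t and s.  The symmetry of the averaging
    operator rests on this. *)
Lemma triangle f h :
  measurable_fun U f -> (forall t, U t -> 0 <= f t) ->
  measurable_fun U h -> (forall t, U t -> 0 <= h t) ->
  \int[leb]_(t in U) (f t * \int[leb]_(s in `[0%R, (1 - t)%R]) h s) =
  \int[leb]_(t in U) (h t * \int[leb]_(s in `[0%R, (1 - t)%R]) f s).
Proof.
move=> mf f0 mh h0; rewrite integral_mkcond [RHS]integral_mkcond.
transitivity (\int[leb]_t \int[leb]_s tri f h (t, s)).
  by apply: eq_integral => t _; rewrite fubini_tri.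
rewrite fubini_tonelli.
- apply: eq_integral => t _; rewrite -fubini_tri//; apply: eq_integral => s _.
  by rewrite /tri /= addrC muleC.
- exact: measurable_tri.
- by move=> p; exact: tri_ge0.
Qed.

Lemma measurable_integral_onem h :
  measurable_fun U h -> (forall t, U t -> 0 <= h t) ->
  measurable_fun U (fun t => \int[leb]_(s in `[0%R, (1 - t)%R]) h s).
Proof.
move=> mh h0.
have := @measurable_fun_fubini_tonelli_F _ _ _ _ _ leb _
  (measurable_tri (measurable_cst (1 : \bar R)) mh)
  (fun p => tri_ge0 p (fun _ _ => lee01) h0).
rewrite (_ : fubini_F _ _ =
   (fun t => \int[leb]_(s in `[0%R, (1 - t)%R]) h s) \_ U).
  by move/(measurable_restrictT _ (measurable_itv _)).
apply/funext => t; rewrite /fubini_F fubini_tri//.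
by rewrite !patchE; case: ifP => // _; rewrite mul1e.
Qed.

Lemma measurable_integral h :
  measurable_fun U h -> (forall t, U t -> 0 <= h t) ->
  measurable_fun U (fun t => \int[leb]_(s in `[0%R, t]) h s).
Proof.
move=> mh h0; have := measurable_fun_onem (measurable_integral_onem mh h0).
apply: eq_measurable_fun => t _; congr (integral _ _ _).
by rewrite (_ : 1 - (1 - t) = t)%R; last lra.
Qed.

End UnitInterval.

(** * Neumann series and approximate eigenvalues *)

Section Modulus.
Context {R : realType}.

Lemma cabsM (z t : R[i]) : cabs (z * t) = cabs z * cabs t.
Proof.
case: z t => [a b] [c d]; rewrite /cabs /= -sqrtrM ?addr_ge0 ?sqr_ge0//.
by congr Num.sqrt; ring.
Qed.

Lemma cabs_real (a : R) : cabs a%:C%C = `|a|.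
Proof. by rewrite /cabs /= expr0n /= addr0 sqrtr_sqr. Qed.

Lemma cabs0 : cabs (0 : R[i]) = 0.
Proof. by rewrite -(rmorph0 (real_complex R)) cabs_real normr0. Qed.

Lemma cabs1 : cabs (1 : R[i]) = 1.
Proof. by rewrite -(rmorph1 (real_complex R)) cabs_real normr1. Qed.

Lemma cabsN1 : cabs (-1 : R[i]) = 1.
Proof. by rewrite -(rmorphN1 (real_complex R)) cabs_real normrN1. Qed.

End Modulus.

Section Neumann.
Context {R : realType} (E : lmodType R[i]) (H : set E) (nrm : E -> R)
  (T : E -> E).
Hypothesis H0 : H 0.
Hypothesis HD : forall a f g, H f -> H g -> H (a *: f + g).
Hypothesis nrm_ge0 : forall f, H f -> 0 <= nrm f.
Hypothesis nrmD : forall f g, H f -> H g -> nrm (f + g) <= nrm f + nrm g.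
Hypothesis nrmZ : forall a f, H f -> nrm (a *: f) = cabs a * nrm f.
Hypothesis TH : forall f, H f -> H (T f).
Hypothesis Tlin : forall a f g, H f -> H g ->
  nrm (T (a *: f + g) - (a *: T f + T g)) = 0.
Variable K : R.
Hypothesis K0 : 0 <= K.
Hypothesis Tbound : forall f, H f -> nrm (T f) <= K * nrm f.

Let HZ a f : H f -> H (a *: f).
Proof. by move=> Hf; rewrite -[_ *: _]addr0; exact: HD. Qed.

Let Hadd f g : H f -> H g -> H (f + g).
Proof. by move=> Hf Hg; rewrite -[f]scale1r; exact: HD. Qed.

Let Hsub f g : H f -> H g -> H (f - g).
Proof. by move=> Hf Hg; rewrite addrC -scaleN1r; exact: HD. Qed.

Let nrm0 : nrm 0 = 0.
Proof. by have := nrmZ 0 H0; rewrite scaler0 cabs0 mul0r. Qed.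

Let nrmC f g : H f -> H g -> nrm (f - g) = nrm (g - f).
Proof.
move=> Hf Hg; rewrite -[f - g]opprB -[- (g - f)]scaleN1r nrmZ; last exact: Hsub.
by rewrite cabsN1 mul1r.
Qed.

Let nrm_tri h f g : H f -> H g -> H h ->
  nrm (f - g) <= nrm (f - h) + nrm (h - g).
Proof.
move=> Hf Hg Hh; rewrite (_ : f - g = (f - h) + (h - g)); last first.
  by rewrite addrA subrK.
by apply: nrmD; exact: Hsub.
Qed.

(* [E] consists of representatives: linearity of [T] and the equation of the
   resolvent hold up to this equivalence only. *)
Let eqv f g := [/\ H f, H g & nrm (f - g) = 0].

Let eqv_refl f : H f -> eqv f f.
Proof. by move=> Hf; split; rewrite ?subrr. Qed.

Let eqv_sym f g : eqv f g -> eqv g f.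
Proof. by move=> [Hf Hg e]; split=> //; rewrite nrmC. Qed.

Let eqv_le f g : H f -> H g -> nrm (f - g) <= 0 -> eqv f g.
Proof.
by move=> Hf Hg h; split=> //; apply/eqP; rewrite eq_le h nrm_ge0//; exact: Hsub.
Qed.

Let eqv_trans g f h : eqv f g -> eqv g h -> eqv f h.
Proof.
move=> [Hf Hg e] [_ Hh e']; apply: eqv_le => //.
by rewrite (le_trans (nrm_tri Hf Hh Hg))// e e' addr0.
Qed.

Let eqv_lin a f g f' g' : eqv f f' -> eqv g g' ->
  eqv (a *: f + g) (a *: f' + g').
Proof.
move=> [Hf Hf' e] [Hg Hg' e']; apply: eqv_le; [exact: HD|exact: HD|].
rewrite (_ : _ - _ = a *: (f - f') + (g - g')); last first.
  by rewrite scalerBr opprD addrACA.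
have Hff : H (f - f') by exact: Hsub.
rewrite (le_trans (nrmD _ _))//; [exact: HZ|exact: Hsub|].
by rewrite nrmZ// e e' mulr0 addr0.
Qed.

Let eqv_Tlin a f g : H f -> H g -> eqv (T (a *: f + g)) (a *: T f + T g).
Proof.
move=> Hf Hg; split; [by apply: TH; exact: HD| |exact: Tlin].
by apply: HD; exact: TH.
Qed.

Let nrm_eqv f g : eqv f g -> nrm f = nrm g.
Proof.
have le f' g' : eqv f' g' -> nrm f' <= nrm g'.
  move=> [Hf Hg e]; rewrite -[X in nrm X](subrK g') (le_trans (nrmD _ _))//.
    exact: Hsub.
  by rewrite e add0r.
by move=> e; apply/eqP; rewrite eq_le !le//; exact: eqv_sym.
Qed.

Let nrm_Tsub f g : H f -> H g -> nrm (T f - T g) <= K * nrm (f - g).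
Proof.
move=> Hf Hg; have := Tbound (Hsub Hf Hg); apply: le_trans.
rewrite addrC -scaleN1r [f - g]addrC -[- g]scaleN1r.
by rewrite -(nrm_eqv (eqv_Tlin (-1) Hg Hf)).
Qed.

Variable l : R[i].
Hypothesis Kl : K < cabs l.
Let B f := l *: f - T f.

Let BH f : H f -> H (B f).
Proof. by move=> Hf; apply: Hsub; [exact: HZ|exact: TH]. Qed.

Let eqv_Blin a f g : H f -> H g -> eqv (B (a *: f + g)) (a *: B f + B g).
Proof.
move=> Hf Hg; rewrite /B [l *: _ - T (_ + _)]addrC -[- T (_ + _)]scaleN1r.
rewrite [X in eqv _ X](_ : _ = -1 *: (a *: T f + T g) + l *: (a *: f + g)).
  apply: eqv_lin; first exact: eqv_Tlin.
  by apply: eqv_refl; apply: HZ; exact: HD.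
by rewrite scaleN1r !scalerDr !scalerN !scalerA (mulrC a l) opprD [RHS]addrC addrACA.
Qed.

Let B_lower u : H u -> (cabs l - K) * nrm u <= nrm (B u).
Proof.
move=> Hu; rewrite mulrBl lerBlDr -nrmZ//.
rewrite (le_trans _ (lerD (lexx _) (Tbound Hu)))//.
rewrite -[X in nrm X <= _](subrK (T u)); apply: nrmD; first exact: BH.
exact: TH.
Qed.

Let eqv_Binj f g : H f -> H g -> eqv (B f) (B g) -> eqv f g.
Proof.
move=> Hf Hg [HBf HBg e]; apply: eqv_le => //.
have l0 : 0 < cabs l - K by rewrite subr_gt0.
rewrite -(pmulr_rle0 _ l0) (le_trans (B_lower (Hsub Hf Hg)))//.
rewrite [f - g]addrC -scaleN1r (nrm_eqv (eqv_Blin _ _ _))//.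
by rewrite addrC scaleN1r e.
Qed.

(** A solution of l u - T u = f is a fixed point of u |-> (f + T u) / l, whose
    iterates w n form a geometric Cauchy sequence.  Only the images T (w n) are
    required to have a limit v, which is easier to provide than a limit of the
    w n themselves; then u = (f + v) / l.  Uniqueness and boundedness come from
    the lower bound (|l| - K) |u| <= |l u - T u|. *)
Lemma neumann :
  (forall (u : nat -> E) (C q : R), 0 <= q < 1 -> (forall n, H (u n)) ->
     (forall n, nrm (u n.+1 - u n) <= C * q ^+ n) ->
     exists2 v, H v & exists C', forall n, nrm (T (u n) - v) <= C' * q ^+ n) ->
  resolvent_set H nrm T l.
Proof.
move=> complete.
have l0 : 0 < cabs l := le_lt_trans K0 Kl.
have ln0 : l != 0.
  apply: contraTneq l0 => ->.
  by rewrite cabs0 ltxx.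
have norm_linv : cabs l^-1 = (cabs l)^-1.
  apply: (mulfI (lt0r_neq0 l0)); rewrite -cabsM divff// cabs1.
  by rewrite divff// gt_eqF.
set q := K / cabs l.
have q01 : 0 <= q < 1 by rewrite divr_ge0 ?(ltW l0)//= ltr_pdivrMr// mul1r.
have q0 : 0 <= q by case/andP: q01.
have surj f : H f -> exists2 u, H u & eqv (B u) f.
  move=> Hf.
  pose w n := iter n (fun x => l^-1 *: (f + T x)) 0.
  have Hw n : H (w n).
    by elim: n => //= n IH; apply/HZ/Hadd => //; exact: TH.
  have wS n : w n.+1 = l^-1 *: (f + T (w n)) by [].
  have HTw n : H (T (w n)) by apply: TH.
  have Cw n : nrm (w n.+1 - w n) <= nrm (w 1%N - w 0%N) * q ^+ n.
    elim: n => [|n IH]; first by rewrite expr0 mulr1.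
    rewrite (wS n.+1) [X in _ - X]wS -scalerBr nrmZ; last first.
      by apply: Hsub; apply: Hadd.
    rewrite opprD addrACA subrr add0r norm_linv.
    rewrite (le_trans (ler_wpM2l _ (nrm_Tsub (Hw _) (Hw _))))//.
      by rewrite invr_ge0 ltW.
    rewrite mulrA [_ * K]mulrC -/q exprS mulrCA.
    by rewrite ler_wpM2l.
  have [v Hv [C' Cv]] := complete w _ q q01 Hw Cw.
  pose u := l^-1 *: (f + v).
  have Hu : H u by apply/HZ/Hadd.
  exists u => //.
  suff [_ _ e] : eqv (T u) v.
    split => //; first exact: BH.
    rewrite /B /u scalerA mulfV// scale1r -/u addrAC [f + v]addrC addrK.
    by rewrite nrmC//; exact: TH.
  apply: eqv_le => //; first exact: TH.
  have bnd n : nrm (T u - v) <= (K / cabs l + q) * C' * q ^+ n.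
    rewrite (le_trans (nrm_tri _ _ (HTw n.+1)))//; first exact: TH.
    rewrite -mulrA mulrDl lerD//.
      rewrite (le_trans (nrm_Tsub _ _))// -mulrA ler_wpM2l//.
      rewrite wS -scalerBr nrmZ; last first.
        by apply: Hsub; apply: Hadd.
      rewrite norm_linv ler_wpM2l ?invr_ge0 ?(ltW l0)//.
      by rewrite opprD addrACA subrr add0r nrmC.
    by rewrite (le_trans (Cv n.+1))// exprS mulrCA.
  have cq : (fun n => (K / cabs l + q) * C' * q ^+ n) @ \oo --> (0 : R).
    rewrite -[X in _ --> X](mulr0 ((K / cabs l + q) * C')); apply: cvgMr.
    by apply: cvg_expr; rewrite ger0_norm//; case/andP: q01.
  by apply: (ler_cvg_to (cvg_cst _) cq); exact: nearW.
have /choice[S HS] : forall f, exists u, H f -> H u /\ eqv (B u) f.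
  move=> f; have [Hf|nHf] := pselect (H f); last by exists 0.
  by have [u Hu e] := surj f Hf; exists u.
exists S; split.
- split.
  + by move=> f /HS[].
  + move=> a f g Hf Hg.
    have [HSf eSf] := HS _ Hf; have [HSg eSg] := HS _ Hg.
    have [HSl eSl] := HS _ (HD a Hf Hg).
    have : eqv (S (a *: f + g)) (a *: S f + S g).
      apply: eqv_Binj => //; first exact: HD.
      apply: (eqv_trans eSl); apply: eqv_sym.
      by apply: (eqv_trans (eqv_Blin a HSf HSg)); exact: eqv_lin.
    by move=> [? ? e]; split=> //; exact: Hsub.
  + exists (cabs l - K)^-1 => f Hf; have [HSf eSf] := HS _ Hf.
    rewrite mulrC ler_pdivlMr ?subr_gt0// mulrC -(nrm_eqv eSf).
    exact: B_lower.
- by move=> f Hf; have [HSf [HB _ e]] := HS _ Hf; split=> //; exact: Hsub.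
- move=> f Hf; have HBf := BH Hf; have [HSf eSf] := HS _ HBf.
  by have [] := eqv_Binj HSf Hf eSf; split=> //; exact: Hsub.
Qed.

End Neumann.

Section ApproximatePoint.
Context {R : realType} (E : lmodType R[i]) (H : set E) (nrm : E -> R)
  (T : E -> E).

Hypothesis nrm_ge0 : forall f, 0 <= nrm f.
Hypothesis Hopp : forall f, H f -> H (- f).
Hypothesis nrmD : forall f g, H f -> H g -> nrm (f + g) <= nrm f + nrm g.
Hypothesis nrmN : forall f, H f -> nrm (- f) = nrm f.

(** A bounded inverse S of l - T would give c <= |f| <= M |l f - T f| <= M e for
    every e > 0. *)
Lemma approximate_eigenvalue (l : R[i]) (c : R) :
  (forall f, H f -> H (l *: f - T f)) -> 0 < c ->
  (forall e, 0 < e -> exists f, [/\ H f, c <= nrm f & nrm (l *: f - T f) <= e]) ->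
  spectrum H nrm T l.
Proof.
move=> HB c0 app [S [[SH _ [M SM]] _ Sl]].
have M0 : 0 < `|M| + 1 by rewrite ltr_wpDl.
have e0 : 0 < c / (2 * (`|M| + 1)) by rewrite divr_gt0// mulr_gt0.
have [f [Hf cf fe]] := app _ e0.
have [HSf Sf0] := Sl _ Hf; have HSBf := SH _ (HB _ Hf).
have : nrm f <= c / 2.
  rewrite [X in nrm X <= _](_ : f = S (l *: f - T f) - (S (l *: f - T f) - f)).
    rewrite (le_trans (nrmD _ _))//; first exact: Hopp.
    rewrite nrmN// Sf0 addr0 (le_trans (SM _ (HB _ Hf)))//.
    rewrite (@le_trans _ _ ((`|M| + 1) * nrm (l *: f - T f)))//.
      by rewrite ler_wpM2r// (le_trans (ler_norm _))// lerDl.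
    rewrite -ler_pdivlMl// (le_trans fe)//.
    by rewrite [leRHS](_ : _ = c / (2 * (`|M| + 1)))//; field; rewrite gt_eqF.
  by rewrite opprB addrC subrK.
by move: cf c0; lra.
Qed.

End ApproximatePoint.

(** * Square-integrable functions on glued intervals *)

(** A family of weighted unit intervals, with a relation saying which of their
    points are the same point of the space.  Functions are honest functions that
    respect [glue], not classes modulo null sets, since the elements of the
    complex Hilbert spaces are given by such representatives. *)
Record frame (R : realType) (I : choiceType) := Frame {
  carr : set I;
  wt : I -> R;
  wt_gt0 : forall i, carr i -> 0 < wt i;
  glue : I -> R -> I -> R -> Prop;
  glue_dom : forall i t j s, glue i t j s ->
    (carr i /\ 0 <= t <= 1) /\ (carr j /\ 0 <= s <= 1) }.

Section Frame.
Context {R : realType} {I : choiceType} (X : frame R I).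
Local Notation U := (`[0%R, 1%R]%classic : set (measurableTypeR R)).
Implicit Types (k h : I -> R -> \bar R) (u v : I -> R -> R).

Definition dom (i : I) (t : R) : Prop := carr X i /\ 0 <= t <= 1.

Definition glued (S : Type) (k : I -> R -> S) : Prop :=
  forall i t j s, glue X i t j s -> k i t = k j s.

(** The functions with values in [0, +oo] on which positive operators act. *)
Definition admissible k : Prop :=
  [/\ forall i t, dom i t -> (0 <= k i t)%E,
      forall i, carr X i -> measurable_fun U (k i) &
      glued k].

Definition integral_on k : \bar R :=
  (\esum_(i in carr X) ((wt X i)%:E * \int[leb]_(t in U) k i t))%E.

Local Notation J := integral_on.

Lemma itv_dom i t : carr X i -> U t -> dom i t.
Proof. by move=> Xi; rewrite /= in_itv. Qed.

Lemma glued_eq (S : Type) (k k' : I -> R -> S) :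
  (forall i t, dom i t -> k i t = k' i t) -> glued k -> glued k'.
Proof.
move=> e gk i t j s ijg; have [it js] := glue_dom ijg.
by rewrite -!e//; exact: gk.
Qed.

Lemma admissible_eq k k' :
  (forall i t, dom i t -> k i t = k' i t) -> admissible k -> admissible k'.
Proof.
move=> e [k0 mk gk]; split.
- by move=> i t it; rewrite -e//; exact: k0.
- move=> i Xi; apply: eq_measurable_fun (mk i Xi) => t /set_mem tU.
  by apply: e; exact: itv_dom.
- exact: glued_eq gk.
Qed.

Lemma admissible_cst (c : \bar R) : (0 <= c)%E -> admissible (fun _ _ => c).
Proof. by move=> c0; split=> // i _; exact: measurable_cst. Qed.

Lemma admissibleD k h : admissible k -> admissible h ->
  admissible (fun i t => k i t + h i t)%E.
Proof.
move=> [k0 mk gk] [h0 mh gh]; split.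
- by move=> i t it; rewrite adde_ge0 ?k0 ?h0.
- by move=> i Xi; apply: emeasurable_funD; [exact: mk|exact: mh].
- by move=> i t j s g; rewrite (gk _ _ _ _ g) (gh _ _ _ _ g).
Qed.

Lemma admissibleM k h : admissible k -> admissible h ->
  admissible (fun i t => k i t * h i t)%E.
Proof.
move=> [k0 mk gk] [h0 mh gh]; split.
- by move=> i t it; rewrite mule_ge0 ?k0 ?h0.
- by move=> i Xi; apply: emeasurable_funM; [exact: mk|exact: mh].
- by move=> i t j s g; rewrite (gk _ _ _ _ g) (gh _ _ _ _ g).
Qed.

Lemma admissibleZ (c : R) k : 0 <= c -> admissible k ->
  admissible (fun i t => c%:E * k i t)%E.
Proof. by move=> c0; apply: admissibleM; apply: admissible_cst; rewrite lee_fin. Qed.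

Let integral0 k : admissible k -> forall i, carr X i ->
  (0 <= (wt X i)%:E * \int[leb]_(t in U) k i t)%E.
Proof.
move=> [k0 _ _] i Xi; apply: mule_ge0; first by rewrite lee_fin ltW// wt_gt0.
by apply: integral_ge0 => t tU; apply/k0/itv_dom.
Qed.

Lemma eq_integral_on k h : (forall i t, dom i t -> k i t = h i t) -> J k = J h.
Proof.
move=> e; apply: eq_esum => i Xi; congr (_ * _)%E.
by apply: eq_integral => t /set_mem tU; apply: e; exact: itv_dom.
Qed.

Lemma le_integral_on k h : admissible k -> admissible h ->
  (forall i t, dom i t -> k i t <= h i t)%E -> (J k <= J h)%E.
Proof.
move=> [k0 mk gk] [h0 mh gh] kh; apply: le_esum => i Xi.
rewrite lee_pmul2l ?lte_fin ?wt_gt0//; apply: ge0_le_integral => //.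
- by move=> t tU; apply/k0/itv_dom.
- exact: mk.
- exact: mh.
- by move=> t tU; apply/kh/itv_dom.
Qed.

Lemma integral_onD k h : admissible k -> admissible h ->
  J (fun i t => k i t + h i t)%E = (J k + J h)%E.
Proof.
move=> ak ah; rewrite /J -esumD; [|exact: integral0..].
move: ak ah => [k0 mk gk] [h0 mh gh].
apply: eq_esum => i Xi; rewrite ge0_integralD//=.
- rewrite ge0_muleDr//; apply: integral_ge0 => t tU; [exact/k0/itv_dom|].
  exact/h0/itv_dom.
- by move=> t tU; apply/k0/itv_dom.
- exact: mk.
- by move=> t tU; apply/h0/itv_dom.
- exact: mh.
Qed.

Lemma integral_onZ (c : R) k : 0 <= c -> admissible k ->
  J (fun i t => c%:E * k i t)%E = (c%:E * J k)%E.
Proof.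
move=> c0 ak; rewrite /J -esumZl//; last exact: integral0.
move: ak => [k0 mk gk]; apply: eq_esum => i Xi.
rewrite ge0_integralZl//.
- by rewrite muleCA.
- exact: mk.
- by move=> t tU; apply/k0/itv_dom.
Qed.

Definition sqn u : \bar R := J (fun i t => (u i t ^+ 2)%:E).

Definition rmeasurable u : Prop :=
  (forall i, carr X i -> measurable_fun U (u i)) /\ glued u.

Definition L2real u : Prop := rmeasurable u /\ (sqn u < +oo)%E.

Lemma rmeasurable_eq u v :
  (forall i t, dom i t -> u i t = v i t) -> rmeasurable u -> rmeasurable v.
Proof.
move=> e [mu gu]; split; last exact: glued_eq gu.
move=> i Xi; apply: eq_measurable_fun (mu i Xi) => t /set_mem tU.
by apply: e; exact: itv_dom.
Qed.

Lemma admissible_EFin u : rmeasurable u -> (forall i t, dom i t -> 0 <= u i t) ->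
  admissible (fun i t => (u i t)%:E).
Proof.
move=> [mu gu] u0; split.
- by move=> i t it; rewrite lee_fin u0.
- by move=> i Xi; apply/measurable_EFinP; exact: mu.
- by move=> i t j s g; rewrite (gu _ _ _ _ g).
Qed.

Lemma rmeasurable_comp (f : R -> R) u : measurable_fun setT f ->
  rmeasurable u -> rmeasurable (fun i t => f (u i t)).
Proof.
move=> mf [mu gu]; split=> [i Xi|i t j s g]; last by rewrite (gu _ _ _ _ g).
by apply: measurableT_comp => //; exact: mu.
Qed.

Lemma rmeasurable_cst (c : R) : rmeasurable (fun _ _ => c).
Proof. by split=> // i _; exact: measurable_cst. Qed.

Lemma rmeasurableD u v : rmeasurable u -> rmeasurable v ->
  rmeasurable (fun i t => u i t + v i t).
Proof.
move=> [mu gu] [mv gv]; split=> [i Xi|i t j s g].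
  by apply: measurable_funD; [exact: mu|exact: mv].
by rewrite (gu _ _ _ _ g) (gv _ _ _ _ g).
Qed.

Lemma rmeasurableM u v : rmeasurable u -> rmeasurable v ->
  rmeasurable (fun i t => u i t * v i t).
Proof.
move=> [mu gu] [mv gv]; split=> [i Xi|i t j s g].
  by apply: measurable_funM; [exact: mu|exact: mv].
by rewrite (gu _ _ _ _ g) (gv _ _ _ _ g).
Qed.

Lemma rmeasurableZ (c : R) u : rmeasurable u -> rmeasurable (fun i t => c * u i t).
Proof. by move=> ?; apply: rmeasurableM => //; exact: rmeasurable_cst. Qed.

Lemma rmeasurableN u : rmeasurable u -> rmeasurable (fun i t => - u i t).
Proof.
by move=> /(rmeasurableZ (-1)); apply: rmeasurable_eq => i t _; rewrite mulN1r.
Qed.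

Lemma rmeasurableB u v : rmeasurable u -> rmeasurable v ->
  rmeasurable (fun i t => u i t - v i t).
Proof. by move=> mu mv; apply: rmeasurableD => //; exact: rmeasurableN. Qed.

Lemma rmeasurable_norm u : rmeasurable u -> rmeasurable (fun i t => `|u i t|).
Proof. by move=> mu; apply: rmeasurable_comp. Qed.

Lemma rmeasurable_pos u : rmeasurable u ->
  rmeasurable (fun i t => Num.max (u i t) 0).
Proof.
move=> mu; apply: (@rmeasurable_comp (fun x => Num.max x 0)) => //.
exact: measurable_maxr.
Qed.

Lemma rmeasurable_sqr u : rmeasurable u -> rmeasurable (fun i t => u i t ^+ 2).
Proof. by move=> mu; apply: (@rmeasurable_comp (fun x => x ^+ 2)). Qed.

Lemma admissible_sqr u : rmeasurable u -> admissible (fun i t => (u i t ^+ 2)%:E).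
Proof.
move=> mu; apply: admissible_EFin; first exact: rmeasurable_sqr.
by move=> i t _; exact: sqr_ge0.
Qed.
Hint Resolve admissible_sqr : core.

Lemma sqn_ge0 u : (0 <= sqn u)%E.
Proof.
apply: esum_ge0 => i Xi; apply: mule_ge0; first by rewrite lee_fin ltW// wt_gt0.
by apply: integral_ge0 => t tU; rewrite lee_fin sqr_ge0.
Qed.

Lemma eq_sqn u v : (forall i t, dom i t -> u i t = v i t) -> sqn u = sqn v.
Proof. by move=> e; apply: eq_integral_on => i t it; rewrite e. Qed.

Lemma sqnZ (c : R) u : rmeasurable u ->
  sqn (fun i t => c * u i t) = ((c ^+ 2)%:E * sqn u)%E.
Proof.
move=> mu; rewrite -integral_onZ ?sqr_ge0//; last exact: admissible_sqr.
by apply: eq_integral_on => i t _; rewrite exprMn.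
Qed.

Lemma sqnN u : sqn (fun i t => - u i t) = sqn u.
Proof. by apply: eq_integral_on => i t _; rewrite sqrrN. Qed.

Lemma le_sqn u v : rmeasurable u -> rmeasurable v ->
  (forall i t, dom i t -> `|u i t| <= `|v i t|) -> (sqn u <= sqn v)%E.
Proof.
move=> mu mv uv; apply: le_integral_on; [exact: admissible_sqr..|] => i t it.
rewrite lee_fin -(real_normK (num_real (u i t))) -(real_normK (num_real (v i t))).
by rewrite ler_pXn2r ?nnegrE//; exact: uv.
Qed.

(** Pointwise (a + b)^2 <= a^2 / s + b^2 / (1 - s), by convexity of the square.
    Optimising over s gives the triangle inequality. *)
Lemma sqnD_convex (s : R) u v : 0 < s < 1 -> rmeasurable u -> rmeasurable v ->
  (sqn (fun i t => u i t + v i t)%R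
   <= (s^-1)%:E * sqn u + ((1 - s)^-1)%:E * sqn v)%E.
Proof.
move=> /andP[s0 s1] mu mv.
have s1' : 0 < 1 - s by rewrite subr_gt0.
have is0 : 0 <= s^-1 by rewrite invr_ge0 ltW.
have is1 : 0 <= (1 - s)^-1 by rewrite invr_ge0 ltW.
rewrite -!integral_onZ//; [|exact: admissible_sqr..].
rewrite -integral_onD; [|by apply: admissibleZ => //; exact: admissible_sqr..].
apply: le_integral_on.
- by apply: admissible_sqr; exact: rmeasurableD.
- by apply: admissibleD; apply: admissibleZ => //; exact: admissible_sqr.
move=> i t _; rewrite -!EFinM -EFinD lee_fin -subr_ge0.
set a := u i t; set b := v i t.
rewrite (_ : _ - _ = ((1 - s) * a - s * b) ^+ 2 * (s^-1 * (1 - s)^-1)).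
  by rewrite mulr_ge0 ?sqr_ge0// mulr_ge0.
by field; rewrite !gt_eqF.
Qed.

Definition l2norm u : R := Num.sqrt (fine (sqn u)).

Lemma eq_l2norm u v : (forall i t, dom i t -> u i t = v i t) ->
  l2norm u = l2norm v.
Proof. by move=> e; rewrite /l2norm (eq_sqn e). Qed.

Lemma sqnE u : sqn u = J (fun i t => (u i t ^+ 2)%:E).
Proof. by []. Qed.

Lemma l2norm_ge0 u : 0 <= l2norm u.
Proof. exact: sqrtr_ge0. Qed.

Lemma sqn_fin u : L2real u -> sqn u = (fine (sqn u))%:E.
Proof. by move=> [_ uoo]; rewrite fineK// ge0_fin_numE// sqn_ge0. Qed.

Lemma sqn_l2norm u : L2real u -> sqn u = (l2norm u ^+ 2)%:E.
Proof.
move=> Lu; rewrite [LHS]sqn_fin//.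
by rewrite sqr_sqrtr// fine_ge0// sqn_ge0.
Qed.

Lemma sqn_le_l2norm u (M : R) : 0 <= M ->
  (sqn u <= (M ^+ 2)%:E)%E -> l2norm u <= M.
Proof.
move=> M0 uM; rewrite -(ger0_norm M0) -sqrtr_sqr ler_wsqrtr//.
by rewrite -lee_fin fineK// ge0_fin_numE ?sqn_ge0// (le_lt_trans uM)// ltry.
Qed.

Lemma eq_L2real u v : (forall i t, dom i t -> u i t = v i t) -> L2real u -> L2real v.
Proof.
by move=> e [mu uoo]; split; [exact: rmeasurable_eq mu|rewrite -(eq_sqn e)].
Qed.

Lemma L2realZ (c : R) u : L2real u -> L2real (fun i t => c * u i t).
Proof.
move=> Lu; have [mu uoo] := Lu; split; first exact: rmeasurableZ.
by rewrite sqnZ// sqn_fin// -EFinM ltry.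
Qed.

Lemma L2realN u : L2real u -> L2real (fun i t => - u i t).
Proof.
by move=> [mu uoo]; split; [exact: rmeasurableN|rewrite sqnN].
Qed.

Lemma L2realD u v : L2real u -> L2real v -> L2real (fun i t => u i t + v i t).
Proof.
move=> Lu Lv; have [mu _] := Lu; have [mv _] := Lv.
split; first exact: rmeasurableD.
have h : 0 < (2^-1 : R) < 1 by lra.
apply: (le_lt_trans (sqnD_convex h mu mv)).
by rewrite (sqn_fin Lu) (sqn_fin Lv) -!EFinM -EFinD ltry.
Qed.

Lemma L2realB u v : L2real u -> L2real v -> L2real (fun i t => u i t - v i t).
Proof. by move=> Lu Lv; apply: L2realD => //; exact: L2realN. Qed.

Lemma le_L2real u v : rmeasurable u -> L2real v ->
  (forall i t, dom i t -> `|u i t| <= `|v i t|) -> L2real u.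
Proof.
move=> mu [mv voo] uv; split=> //; exact: le_lt_trans (le_sqn mu mv uv) voo.
Qed.

Lemma sqn0 : sqn (fun _ _ => 0) = 0%E.
Proof.
rewrite /sqn /J esum1// => i Xi.
by rewrite integral0_eq ?mule0// => t _; rewrite expr0n.
Qed.

Lemma l2norm0 u : (forall i t, dom i t -> u i t = 0) -> l2norm u = 0.
Proof. by move=> /eq_sqn; rewrite /l2norm => ->; rewrite sqn0 sqrtr0. Qed.

Lemma L2real0 : L2real (fun _ _ => 0).
Proof. by split; [exact: rmeasurable_cst|rewrite sqn0]. Qed.

Lemma l2normZ (c : R) u : L2real u ->
  l2norm (fun i t => c * u i t) = `|c| * l2norm u.
Proof.
move=> Lu; have [mu _] := Lu.
rewrite /l2norm sqnZ// (sqn_fin Lu) -EFinM /= sqrtrM ?sqr_ge0//.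
by rewrite sqrtr_sqr.
Qed.

(* The optimal weight is s = a / (a + b); [e] keeps it away from 0 and 1. *)
Let minkowski_weight (a b e : R) : 0 <= a -> 0 <= b -> 0 < e ->
  exists s, 0 < s < 1 /\
    s^-1 * a ^+ 2 + (1 - s)^-1 * b ^+ 2 <= (a + b + e) ^+ 2.
Proof.
move=> a0 b0 e0.
have : a < a + e / 2 by lra.
have : b < b + e / 2 by lra.
rewrite (_ : a + b + e = (a + e / 2) + (b + e / 2)); last by lra.
move: (a + e / 2) (b + e / 2) => a' b' bb aa {e e0}.
have a'0 : 0 < a' by lra.
have b'0 : 0 < b' by lra.
exists (a' / (a' + b')); split.
  by rewrite divr_gt0 ?addr_gt0//= ltr_pdivrMr ?addr_gt0// mul1r ltrDl.
have -> : 1 - a' / (a' + b') = b' / (a' + b').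
  by field; rewrite gt_eqF ?addr_gt0.
rewrite !invf_div (_ : (a' + b') ^+ 2 =
  (a' + b') / a' * a' ^+ 2 + (a' + b') / b' * b' ^+ 2); last first.
  by field; rewrite !gt_eqF.
by apply: lerD; apply: ler_wpM2l; rewrite ?ler_pXn2r ?nnegrE ?divr_ge0//;
  nra || lra.
Qed.

Lemma l2normD u v : L2real u -> L2real v ->
  l2norm (fun i t => u i t + v i t) <= l2norm u + l2norm v.
Proof.
move=> Lu Lv; apply/ler_addgt0Pr => e e0.
have [mu _] := Lu; have [mv _] := Lv.
have [s [s01 se]] := minkowski_weight (l2norm_ge0 u) (l2norm_ge0 v) e0.
apply: sqn_le_l2norm; first by rewrite addr_ge0 ?addr_ge0 ?l2norm_ge0// ltW.
apply: (le_trans (sqnD_convex s01 mu mv)).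
by rewrite (sqn_l2norm Lu) (sqn_l2norm Lv) -!EFinM -EFinD lee_fin.
Qed.

(** A sum over the intervals is the supremum of its finite subsums, and for each
    of these Fatou's lemma applies to a single integral. *)
Lemma sqn_fatou (w : nat -> I -> R -> R) u (M : R) :
  (forall n, rmeasurable (w n)) ->
  (forall i t, dom i t -> w n i t @[n --> \oo] --> u i t) ->
  (forall n, (sqn (w n) <= M%:E)%E) -> (sqn u <= M%:E)%E.
Proof.
move=> mw cw wM; apply: ge_ereal_sup => _ [F [finF FX] <-].
pose W (a : I -> R -> R) i t : R :=
  if i \in F then wt X i * (a i t ^+ 2) else 0.
have W0 a i t : 0 <= W a i t.
  rewrite /W; case: ifPn => // /set_mem /FX Xi.
  by rewrite mulr_ge0 ?sqr_ge0// ltW// wt_gt0.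
pose g (a : I -> R -> R) t := \sum_(i <- finmap.enum_fset (fset_set F)) W a i t.
have g0 a t : 0 <= g a t by apply: sumr_ge0.
pose mes (a : I -> R -> R) := forall i, carr X i -> measurable_fun U (a i).
have mW a i : mes a -> measurable_fun U (W a i).
  move=> ma; rewrite /W.
  case: (boolP (i \in F)) => [/set_mem /FX Xi|_]; last exact: measurable_cst.
  apply: measurable_funM => //; apply: measurable_funX; exact: ma.
have mg a : mes a -> measurable_fun U (g a).
  by move=> ma; apply: measurable_sum => i; exact: mW.
have int_g a : mes a -> (\int[leb]_(t in U) (g a t)%:E =
    \sum_(i \in F) ((wt X i)%:E * \int[leb]_(t in U) (a i t ^+ 2)%:E))%E.
  move=> ma; rewrite fsbig_finite//=.
  under eq_integral do rewrite -sumEFin.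
  rewrite ge0_integral_sum//; last 2 first.
  - by move=> i; apply/measurable_EFinP; exact: mW.
  - by move=> i t _; rewrite lee_fin.
  rewrite [LHS]big_seq [RHS]big_seq; apply: eq_bigr => i.
  rewrite in_fset_set// => iF; rewrite /W iF.
  have Xi : carr X i by apply/FX/set_mem.
  under eq_integral do rewrite EFinM.
  rewrite ge0_integralZl ?lee_fin ?ltW ?wt_gt0//.
  + by apply/measurable_EFinP; apply: measurable_funX; exact: ma.
  + by move=> t _; rewrite lee_fin sqr_ge0.
have mesw n : mes (w n) by case: (mw n).
have mesu : mes u.
  move=> i Xi; apply: (measurable_fun_cvg (h := fun n => w n i)) => //.
  - by move=> n; exact: mesw.
  - by move=> t tU; apply: cw; exact: itv_dom.
have wgM n : (\int[leb]_(t in U) (g (w n) t)%:E <= M%:E)%E.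
  rewrite int_g//; apply: le_trans (wM n); apply: ereal_sup_ubound.
  by exists F.
rewrite -int_g//.
have -> : (\int[leb]_(t in U) (g u t)%:E =
    \int[leb]_(t in U) limn_einf (fun n => (g (w n) t)%:E))%E.
  apply: eq_integral => t /set_mem tU; apply/esym/(cvg_limn_einf_sup _).1.
  apply: cvg_EFin; first exact: nearW.
  rewrite /g; apply: cvg_big => [|i _]; first exact: add_continuous.
  rewrite /W.
  case: (boolP (i \in F)) => [/set_mem /FX Xi|_]; last exact: cvg_cst.
  apply: cvgMr; have := cw i t (itv_dom Xi tU) => cwi.
  by rewrite expr2; under eq_fun do rewrite expr2; exact: cvgM.
apply: (le_trans (fatou _ _ _ _)) => //.
- by move=> n; apply/measurable_EFinP; exact: mg.
- by move=> n t _; rewrite lee_fin.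
rewrite limn_einf_lim; apply: lime_le; first exact: is_cvg_einfs.
apply: nearW => n; apply: le_trans (wgM n).
by apply: ereal_inf_lbound; exists n => /=.
Qed.
End Frame.

(** * Positive symmetric operators *)

(** On functions with values in [0, +oo] all sums and integrals exist, so that
    the operator is total and its axioms need no convergence conditions.
    [app_cst1] makes it a contraction of L2, by the Schur test.  [app_bound] makes
    the evaluation of images at a point continuous on L2: limits of images can
    then be taken pointwise, which respects the gluing. *)
Record markov (R : realType) (I : choiceType) (X : frame R I) := Markov {
  app : (I -> R -> \bar R) -> I -> R -> \bar R;
  app_admissible : forall k, admissible X k -> admissible X (app k);
  app_le : forall k h, admissible X k -> admissible X h ->
    (forall i t, dom X i t -> (k i t <= h i t)%E) ->
    forall i t, dom X i t -> (app k i t <= app h i t)%E;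
  appD : forall k h, admissible X k -> admissible X h ->
    forall i t, dom X i t ->
    app (fun i t => k i t + h i t)%E i t = (app k i t + app h i t)%E;
  appZ : forall (c : R) k, 0 <= c -> admissible X k ->
    forall i t, dom X i t ->
    app (fun i t => c%:E * k i t)%E i t = (c%:E * app k i t)%E;
  app_sym : forall k h, admissible X k -> admissible X h ->
    integral_on X (fun i t => k i t * app h i t)%E =
    integral_on X (fun i t => app k i t * h i t)%E;
  app_cst1 : forall i t, dom X i t -> (app (fun _ _ => 1%E) i t <= 1)%E;
  app_bound : forall i t, dom X i t -> exists C : R, 0 <= C /\
    forall k, admissible X k -> (app k i t <= C%:E * integral_on X k)%E }.

Lemma geometric_increments_cvg (R : realType) (a : nat -> R) (C q : R) :
  0 <= q < 1 -> (forall n, `|a n.+1 - a n| <= C * q ^+ n) -> cvgn a.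
Proof.
move=> /andP[q0 q1] Ha.
have -> : a = (fun n => a 0%N + series (telescope a) n).
  by apply/funext => n; rewrite [LHS]eq_sum_telescope.
apply: is_cvgD; first exact: is_cvg_cst.
apply: normed_cvg; apply: (@series_le_cvg _ _ (geometric C q)).
- by move=> n /=; exact: normr_ge0.
- by move=> n /=; exact: le_trans (normr_ge0 _) (Ha n).
- by move=> n; exact: Ha.
- by apply: is_cvg_geometric_series; rewrite ger0_norm.
Qed.

Section Markov.
Context {R : realType} {I : choiceType} {X : frame R I} (M : markov X).
Local Notation U := (`[0%R, 1%R]%classic : set (measurableTypeR R)).
Local Notation J := (integral_on X).
Local Notation D := (dom X).
Local Notation L2 := (L2real X).
Implicit Types (k : I -> R -> \bar R) (u v h p q : I -> R -> R).

Definition positive u : Prop := forall i t, D i t -> 0 <= u i t.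

Lemma app_eq k (k' : I -> R -> \bar R) : admissible X k ->
  (forall i t, D i t -> k i t = k' i t) ->
  forall i t, D i t -> app M k i t = app M k' i t.
Proof.
move=> ak e i t it; have ak' : admissible X k' by exact: admissible_eq ak.
by apply/eqP; rewrite eq_le !app_le// => j s js; rewrite e.
Qed.

Lemma app_ge0 k : admissible X k -> forall i t, D i t -> (0 <= app M k i t)%E.
Proof. by move=> ak; have [] := app_admissible M ak. Qed.

Let rmeasurable_ratio u h : rmeasurable X u -> rmeasurable X h -> positive h ->
  rmeasurable X (fun i t => u i t ^+ 2 / h i t).
Proof.
move=> mu mh h0; apply: (rmeasurable_eq (u := fun i t => u i t ^+ 2 * h i t `^ (-1))).
  by move=> i t it; rewrite powR_inv1// h0.
apply: rmeasurableM; first exact: rmeasurable_sqr.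
by apply: (@rmeasurable_comp _ _ _ (fun x => x `^ (-1))) => //; exact: measurable_powR.
Qed.

(** Cauchy-Schwarz for the positive functional k |-> (T k)(i,t) applied to
    u = h^(1/2) * (u / h^(1/2)).  The proof applies the functional to
    2 u <= s h + u^2 / (s h) and chooses s. *)
Lemma app_cauchy_schwarz u h (a : R) i t :
  rmeasurable X u -> positive u ->
  rmeasurable X h -> (forall i t, D i t -> 0 < h i t) ->
  0 < a -> D i t -> (app M (fun i t => (h i t)%:E) i t <= a%:E)%E ->
  (app M (fun i t => (u i t)%:E) i t * app M (fun i t => (u i t)%:E) i t <=
   a%:E * app M (fun i t => (u i t ^+ 2 / h i t)%:E) i t)%E.
Proof.
move=> mu u0 mh h0 a0 it ha.
have h0' : positive h by move=> j s js; exact/ltW/h0.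
have au := admissible_EFin mu u0.
have ah := admissible_EFin mh h0'.
have q0 : positive (fun i t => u i t ^+ 2 / h i t).
  by move=> j s js; rewrite divr_ge0 ?sqr_ge0// h0'.
have ak := admissible_EFin (rmeasurable_ratio mu mh h0') q0.
have B0 := app_ge0 ak it; have A0 := app_ge0 au it.
move: B0; case EB : (app M _ i t) => [b| |] // b0; last first.
  by rewrite gt0_muley ?lte_fin// leey.
rewrite lee_fin in b0.
have bound (s : R) : 0 < s ->
    (app M (fun i t => (u i t)%:E) i t <= (s / 2 * a + s^-1 / 2 * b)%:E)%E.
  move=> s0; have s0' := ltW s0.
  have c1 : 0 <= s / 2 by rewrite divr_ge0.
  have c2 : 0 <= s^-1 / 2 by rewrite divr_ge0// invr_ge0.
  apply: (@le_trans _ _ (app M (fun i t => (s / 2)%:E * (h i t)%:E +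
       (s^-1 / 2)%:E * (u i t ^+ 2 / h i t)%:E)%E i t)).
    apply: app_le it => //.
      by apply: admissibleD; exact: admissibleZ.
    move=> j r jr; rewrite -!EFinM -EFinD lee_fin.
    have hp := h0 _ _ jr.
    rewrite -subr_ge0 (_ : _ - _ =
      (s * h j r - u j r) ^+ 2 * (2^-1 * s^-1 * (h j r)^-1)).
      by rewrite mulr_ge0 ?sqr_ge0// !mulr_ge0 ?invr_ge0 ?ltW.
    by field; rewrite !gt_eqF.
  rewrite appD//; [|exact: admissibleZ..].
  rewrite !appZ// EB -EFinM EFinD; apply: leeD => //.
  by rewrite (EFinM (s / 2)); apply: lee_wpmul2l => //; rewrite lee_fin.
have := bound 1 ltr01; move: bound A0.
case: (app M _ i t) => [x| |] // bound x0 _.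
rewrite -!EFinM lee_fin; rewrite lee_fin in x0.
move: x0; rewrite le_eqVlt => /predU1P[<-|x0].
  by rewrite mul0r mulr_ge0// ltW.
(* The best choice of s, for x the value of T u and a the bound of T h. *)
have xa0 : 0 < x / a by rewrite divr_gt0.
have := bound _ xa0; rewrite lee_fin invf_div mulrAC divfK ?gt_eqF// => xb.
have x20 : 0 <= x * 2 by rewrite mulr_ge0// ltW.
have /(ler_wpM2r x20) : x / 2 <= a / x / 2 * b by lra.
rewrite (_ : x / 2 * (x * 2) = x * x); last by field.
by rewrite (_ : a / x / 2 * b * (x * 2) = a * b)//; field; rewrite gt_eqF.
Qed.

(** Integrating [app_cauchy_schwarz] bounds |T u|^2 by the integral of
    l * h * T (u^2 / h); symmetry moves T onto h, and T h <= l h again. *)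
Lemma schur_test u h (l : R) :
  rmeasurable X u -> positive u ->
  rmeasurable X h -> (forall i t, D i t -> 0 < h i t) ->
  0 < l ->
  (forall i t, D i t -> (app M (fun i t => (h i t)%:E) i t <= (l * h i t)%:E)%E) ->
  (J (fun i t => app M (fun i t => (u i t)%:E) i t * app M (fun i t => (u i t)%:E) i t)
   <= (l ^+ 2)%:E * sqn X u)%E.
Proof.
move=> mu u0 mh h0 l0 hl; have l0' := ltW l0.
have h0' : positive h by move=> j s js; exact/ltW/h0.
have au := admissible_EFin mu u0.
have ah := admissible_EFin mh h0'.
pose k i t := (u i t ^+ 2 / h i t)%:E.
have ak : admissible X k.
  apply: admissible_EFin; first exact: rmeasurable_ratio.
  by move=> i t it; rewrite divr_ge0 ?sqr_ge0// h0'.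
have aTu := app_admissible M au; have aTk := app_admissible M ak.
have aTh := app_admissible M ah.
apply: (@le_trans _ _ (J (fun i t => l%:E * ((h i t)%:E * app M k i t))%E)).
  apply: le_integral_on.
  - exact: admissibleM.
  - by apply: admissibleZ => //; exact: admissibleM.
  - move=> i t it; rewrite muleA -EFinM; apply: app_cauchy_schwarz => //.
      by rewrite mulr_gt0// h0.
    exact: hl.
rewrite integral_onZ//; last exact: admissibleM.
rewrite expr2 EFinM -muleA; apply: lee_wpmul2l; first by rewrite lee_fin.
rewrite app_sym// -integral_onZ//; last exact: admissible_sqr.
apply: le_integral_on.
- exact: admissibleM.
- by apply: admissibleZ => //; exact: admissible_sqr.
move=> i t it.
apply: (@le_trans _ _ ((l * h i t)%:E * k i t)%E).
  by apply: lee_wpmul2r; [have [k0 _ _] := ak; exact: k0|exact: hl].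
have hn0 : h i t != 0 by rewrite gt_eqF ?h0.
by rewrite /k -!EFinM lee_fin (_ : _ * (_ / _) = l * u i t ^+ 2)//; field.
Qed.

Definition pos_part u : I -> R -> \bar R := fun i t => (Num.max (u i t) 0)%:E.
Definition neg_part u : I -> R -> \bar R := fun i t => (Num.max (- u i t) 0)%:E.

(** The operator on real functions; it is meaningful on L2, where both values
    are finite. *)
Definition act u : I -> R -> R :=
  fun i t => fine (app M (pos_part u) i t) - fine (app M (neg_part u) i t).

Lemma act_def u i t :
  act u i t = fine (app M (pos_part u) i t) - fine (app M (neg_part u) i t).
Proof. by []. Qed.

Let max0_ge0 (x : R) : 0 <= Num.max x 0.
Proof. by rewrite le_max lexx orbT. Qed.

Let max_posneg (x : R) : Num.max x 0 = Num.max (- x) 0 + x.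
Proof.
case: (leP x 0) => hx; case: (leP (- x) 0) => hx'; lra.
Qed.

Let norm_posneg (x : R) : `|x| = Num.max x 0 + Num.max (- x) 0.
Proof.
by rewrite max_posneg; case: (leP 0 x) => h;
  rewrite ?(ger0_norm h) ?(ltr0_norm h); case: (leP (- x) 0) => h'; lra.
Qed.

Lemma admissible_pos u : rmeasurable X u -> admissible X (pos_part u).
Proof.
by move=> mu; apply: admissible_EFin => [|i t _]; [exact: rmeasurable_pos|].
Qed.

Lemma admissible_neg u : rmeasurable X u -> admissible X (neg_part u).
Proof. by move=> mu; apply: (@admissible_pos (fun i t => - u i t)); exact: rmeasurableN. Qed.

(** Jensen's inequality, from [app_cauchy_schwarz] with h = 1. *)
Lemma app_sqr_le u i t : L2 u -> positive u -> D i t ->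
  (app M (fun i t => (u i t)%:E) i t * app M (fun i t => (u i t)%:E) i t <=
   app M (fun i t => (u i t ^+ 2)%:E) i t)%E.
Proof.
move=> [mu _] u0 it.
have := @app_cauchy_schwarz u (fun _ _ => 1) 1 i t mu u0 (rmeasurable_cst _ _)
  (fun _ _ _ => ltr01) ltr01 it (app_cst1 M it).
rewrite mul1e -(app_eq (k := fun i t => (u i t ^+ 2)%:E)
  (k' := fun i t => (u i t ^+ 2 / 1)%:E))//.
  exact: admissible_sqr.
by move=> j s _; rewrite divr1.
Qed.

Lemma app_l2_bound i t : D i t -> exists C : R, 0 <= C /\
  forall u, L2 u -> positive u ->
  app M (fun i t => (u i t)%:E) i t \is a fin_num /\
  fine (app M (fun i t => (u i t)%:E) i t) <= C * l2norm X u.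
Proof.
move=> it; have [C [C0 HC]] := app_bound M it.
exists (Num.sqrt C); split; first exact: sqrtr_ge0.
move=> u Lu u0; have [mu _] := Lu.
have := le_trans (app_sqr_le Lu u0 it) (HC _ (admissible_sqr mu)).
have := app_ge0 (admissible_EFin mu u0) it.
rewrite -/(sqn X u) (sqn_l2norm Lu) -EFinM.
case: (app M _ i t) => [x| |] //; rewrite -?EFinM !lee_fin => x0 xC.
split=> //=; rewrite -(ger0_norm x0) -sqrtr_sqr -[l2norm X u]ger0_norm ?l2norm_ge0//.
by rewrite -sqrtr_sqr -sqrtrM// ler_wsqrtr// expr2.
Qed.

Lemma app_fin u i t : L2 u -> positive u -> D i t ->
  app M (fun i t => (u i t)%:E) i t \is a fin_num.
Proof. by move=> Lu u0 it; have [C [_ /(_ u Lu u0)[]]] := app_l2_bound it. Qed.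

Lemma L2_pos u : L2 u -> L2 (fun i t => Num.max (u i t) 0).
Proof.
move=> Lu; have [mu _] := Lu; apply: le_L2real Lu _; first exact: rmeasurable_pos.
by move=> i t _; rewrite ger0_norm// ge_max ler_norm normr_ge0.
Qed.

Lemma L2_norm u : L2 u -> L2 (fun i t => `|u i t|).
Proof.
move=> Lu; have [mu _] := Lu; apply: le_L2real Lu _; first exact: rmeasurable_norm.
by move=> i t _; rewrite normr_id.
Qed.

(** Any decomposition of u as a difference of nonnegative functions computes
    [act u]: apply T to u+ + q = u- + p.  Linearity follows from this. *)
Lemma act_sub u p q : L2 p -> L2 q -> positive p -> positive q ->
  (forall i t, D i t -> u i t = p i t - q i t) -> forall i t, D i t ->
  act u i t = fine (app M (fun i t => (p i t)%:E) i t)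
            - fine (app M (fun i t => (q i t)%:E) i t).
Proof.
move=> Lp Lq p0 q0 upq i t it.
have Lu : L2 u.
  apply: (eq_L2real (u := fun i t => p i t - q i t)); last exact: L2realB.
  by move=> *; rewrite upq.
have Lu1 := L2_pos Lu; have Lu2 := L2_pos (L2realN Lu).
have P1 : positive (fun i t => Num.max (u i t) 0) by [].
have P2 : positive (fun i t => Num.max (- u i t) 0) by [].
have [mp _] := Lp; have [mq _] := Lq; have [mu1 _] := Lu1; have [mu2 _] := Lu2.
have e : (app M (pos_part u) i t + app M (fun i t => (q i t)%:E) i t =
     app M (neg_part u) i t + app M (fun i t => (p i t)%:E) i t)%E.
  rewrite -!appD//; [|exact: admissible_EFin..].
  apply: app_eq it; first by apply: admissibleD; exact: admissible_EFin.
  move=> j s js; rewrite /pos_part /neg_part -!EFinD; congr EFin.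
  rewrite (upq _ _ js).
  by rewrite max_posneg; lra.
have f1 := app_fin Lu1 P1 it; have f2 := app_fin Lu2 P2 it.
have f3 := app_fin Lp p0 it; have f4 := app_fin Lq q0 it.
move: e; rewrite /act -(fineK f1) -(fineK f2) -(fineK f3) -(fineK f4) -!EFinD.
by move=> [] e /=; lra.
Qed.

Lemma app_cst0 i t : D i t -> app M (fun _ _ => 0%:E) i t = 0%:E.
Proof.
move=> it; have a1 : admissible X (fun _ _ => 1%E).
  by apply: admissible_cst; exact: lee01.
have a0 := admissibleZ (lexx 0) a1.
rewrite -(app_eq a0 (k' := fun _ _ => 0%:E) _ it); last by move=> *; rewrite mul0e.
by rewrite (appZ M (lexx 0) a1 it) mul0e.
Qed.

Lemma act_pos u : L2 u -> positive u -> forall i t, D i t ->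
  act u i t = fine (app M (fun i t => (u i t)%:E) i t).
Proof.
move=> Lu u0 i t it; rewrite (act_sub (p := u) (q := fun _ _ => 0))//.
- by rewrite app_cst0// subr0.
- exact: L2real0.
- by move=> j s _; rewrite subr0.
Qed.

Lemma eq_act u v : L2 u -> (forall i t, D i t -> u i t = v i t) ->
  forall i t, D i t -> act u i t = act v i t.
Proof.
move=> Lu e i t it; have [mu _] := Lu.
by rewrite /act (app_eq (admissible_pos mu) (k' := pos_part v))//
  ?(app_eq (admissible_neg mu) (k' := neg_part v))// /pos_part /neg_part => j s js;
  rewrite e.
Qed.

Let actE u i t : L2 u -> D i t -> exists a b, [/\ act u i t = a - b,
  0 <= a, 0 <= b, app M (pos_part u) i t = a%:E & app M (neg_part u) i t = b%:E].
Proof.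
move=> Lu it; have [mu _] := Lu.
exists (fine (app M (pos_part u) i t)), (fine (app M (neg_part u) i t)).
split=> //.
- by rewrite fine_ge0// app_ge0//; exact: admissible_pos.
- by rewrite fine_ge0// app_ge0//; exact: admissible_neg.
- by rewrite fineK//; apply: app_fin => //; exact: L2_pos.
- by rewrite fineK//; apply: app_fin => //; apply: L2_pos; exact: L2realN.
Qed.

Lemma actD u v : L2 u -> L2 v -> forall i t, D i t ->
  act (fun i t => u i t + v i t) i t = act u i t + act v i t.
Proof.
move=> Lu Lv i t it; have [mu _] := Lu; have [mv _] := Lv.
have Lp := L2realD (L2_pos Lu) (L2_pos Lv).
have Lq := L2realD (L2_pos (L2realN Lu)) (L2_pos (L2realN Lv)).
have e1 := appD M (admissible_pos mu) (admissible_pos mv) it.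
have e2 := appD M (admissible_neg mu) (admissible_neg mv) it.
have [a [b [-> _ _ ea eb]]] := actE Lu it.
have [a' [b' [-> _ _ ea' eb']]] := actE Lv it.
rewrite ea ea' -EFinD in e1; rewrite eb eb' -EFinD in e2.
rewrite (act_sub Lp Lq _ _ _ it).
- by rewrite (_ : app M _ i t = (a + a')%:E)// (_ : app M _ i t = (b + b')%:E)//=; lra.
- by move=> j s _; rewrite addr_ge0.
- by move=> j s _; rewrite addr_ge0.
- by move=> j s _; rewrite (max_posneg (u j s)) (max_posneg (v j s)); lra.
Qed.

Lemma actN u i t : act (fun i t => - u i t) i t = - act u i t.
Proof.
rewrite /act (_ : neg_part (fun i t => - u i t) = pos_part u) ?opprB//.
by apply/funext => j; apply/funext => s; rewrite /neg_part opprK.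
Qed.

Lemma actZ (c : R) u : L2 u -> forall i t, D i t ->
  act (fun i t => c * u i t) i t = c * act u i t.
Proof.
have pos (a : R) v : 0 <= a -> L2 v -> forall i t, D i t ->
    act (fun i t => a * v i t) i t = a * act v i t.
  move=> a0 Lv i t it; have [mv _] := Lv.
  rewrite (act_sub (p := fun i t => a * Num.max (v i t) 0)
                   (q := fun i t => a * Num.max (- v i t) 0))//.
  - have [x [y [-> _ _ ex ey]]] := actE Lv it.
    have e1 := appZ M a0 (admissible_pos mv) it.
    have e2 := appZ M a0 (admissible_neg mv) it.
    rewrite ex -EFinM in e1; rewrite ey -EFinM in e2.
    by rewrite (_ : app M _ i t = (a * x)%:E)// (_ : app M _ i t = (a * y)%:E)//=; lra.
  - by apply: L2realZ; exact: L2_pos.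
  - by apply: L2realZ; apply: L2_pos; exact: L2realN.
  - by move=> j s _; rewrite mulr_ge0.
  - by move=> j s _; rewrite mulr_ge0.
  - by move=> j s _; rewrite -mulrBr; congr (a * _); rewrite max_posneg; lra.
move=> Lu i t it; have [c0|c0] := leP 0 c; first exact: pos.
transitivity (act (fun i t => (- c) * (- u i t)) i t).
  by apply: eq_act it; [exact: L2realZ|move=> j s _; rewrite mulrNN].
rewrite pos//; [|by rewrite oppr_ge0 ltW|exact: L2realN].
by rewrite actN mulrN mulNr opprK.
Qed.

Lemma actB u v : L2 u -> L2 v -> forall i t, D i t ->
  act (fun i t => u i t - v i t) i t = act u i t - act v i t.
Proof.
move=> Lu Lv i t it; by rewrite actD ?actN//; exact: L2realN.
Qed.

Lemma rmeasurable_act u : L2 u -> rmeasurable X (act u).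
Proof.
move=> [mu _].
have [_ m1 g1] := app_admissible M (admissible_pos mu).
have [_ m2 g2] := app_admissible M (admissible_neg mu).
split=> [i Xi|i t j s g]; last by rewrite /act (g1 _ _ _ _ g) (g2 _ _ _ _ g).
by apply: measurable_funB; apply: (measurableT_comp (fine_measurable measurableT));
  [exact: m1|exact: m2].
Qed.

Lemma act_ge0 u : L2 u -> positive u -> positive (act u).
Proof.
move=> Lu u0 i t it; have [mu _] := Lu; rewrite act_pos// fine_ge0// app_ge0//.
exact: admissible_EFin.
Qed.

Lemma norm_act_le u : L2 u -> forall i t, D i t ->
  `|act u i t| <= act (fun i t => `|u i t|) i t.
Proof.
move=> Lu i t it.
have Lu1 := L2_pos Lu; have Lu2 := L2_pos (L2realN Lu).
have [a [b [-> a0 b0 ea eb]]] := actE Lu it.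
rewrite (eq_act (v := fun i t => Num.max (u i t) 0 + Num.max (- u i t) 0) _ _ it).
- rewrite actD// !act_pos// -/(pos_part u) -/(neg_part u) ea eb /=.
  by rewrite ler_norml; apply/andP; lra.
- exact: L2_norm.
- by move=> j s _; rewrite norm_posneg.
Qed.

Lemma l2norm_norm u : l2norm X (fun i t => `|u i t|) = l2norm X u.
Proof.
congr (Num.sqrt (fine _)); apply: eq_integral_on => i t _.
by rewrite real_normK ?num_real.
Qed.

Lemma act_bound i t : D i t -> exists C : R, 0 <= C /\
  forall u, L2 u -> `|act u i t| <= C * l2norm X u.
Proof.
move=> it; have [C [C0 HC]] := app_l2_bound it; exists C; split=> // u Lu.
have n0 : positive (fun i t => `|u i t|) by [].
apply: (le_trans (norm_act_le Lu it)); rewrite (act_pos (L2_norm Lu) n0 it).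
by have [_] := HC _ (L2_norm Lu) n0; rewrite l2norm_norm.
Qed.

Definition op_bound (K : R) : Prop :=
  0 <= K /\ forall u, L2 u -> L2 (act u) /\ l2norm X (act u) <= K * l2norm X u.

(** Nonnegative functions suffice, because |T u| <= T |u|. *)
Lemma op_bound_sqn (K : R) : 0 <= K ->
  (forall u, L2 u -> positive u -> (sqn X (act u) <= (K ^+ 2)%:E * sqn X u)%E) ->
  op_bound K.
Proof.
move=> K0 HK; split=> // u Lu.
have n0 : positive (fun i t => `|u i t|) by [].
have Ln := L2_norm Lu.
have : (sqn X (act u) <= ((K * l2norm X u) ^+ 2)%:E)%E.
  rewrite exprMn EFinM -(l2norm_norm u) -(sqn_l2norm Ln).
  apply: le_trans (HK _ Ln n0); apply: le_sqn; [exact: rmeasurable_act..|].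
  move=> i t it; apply: le_trans (norm_act_le Lu it) _; exact: ler_norm.
move=> h; split; last by apply: sqn_le_l2norm => //; rewrite mulr_ge0 ?l2norm_ge0.
split; first exact: rmeasurable_act.
by apply: (le_lt_trans h); exact: ltry.
Qed.

Lemma sqn_act_pos u : L2 u -> positive u ->
  sqn X (act u) = J (fun i t => app M (fun i t => (u i t)%:E) i t *
                                app M (fun i t => (u i t)%:E) i t)%E.
Proof.
move=> Lu u0; apply: eq_integral_on => i t it.
by rewrite (act_pos Lu u0 it) expr2 EFinM fineK ?app_fin.
Qed.

Lemma schur_op_bound h (l : R) :
  rmeasurable X h -> (forall i t, D i t -> 0 < h i t) -> 0 < l ->
  (forall i t, D i t -> (app M (fun i t => (h i t)%:E) i t <= (l * h i t)%:E)%E) ->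
  op_bound l.
Proof.
move=> mh h0 l0 hl; apply: op_bound_sqn => [|u Lu u0]; first exact: ltW.
have [mu _] := Lu.
by rewrite (sqn_act_pos Lu u0); exact: schur_test mh h0 l0 hl.
Qed.

Lemma op_bound1 : op_bound 1.
Proof.
apply: (schur_op_bound (rmeasurable_cst X 1) (fun _ _ _ => ltr01) ltr01).
by move=> i t it; rewrite mulr1; exact: app_cst1.
Qed.

Lemma L2_act u : L2 u -> L2 (act u).
Proof. by move=> Lu; have [] := op_bound1.2 u Lu. Qed.

Lemma geometric_tail (w : nat -> I -> R -> R) (C q : R) : 0 <= q < 1 ->
  (forall n, L2 (w n)) ->
  (forall n, l2norm X (fun i t => w n.+1 i t - w n i t) <= C * q ^+ n) ->
  forall n m, l2norm X (fun i t => w (n + m)%N i t - w n i t) <=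
    C / (1 - q) * q ^+ n.
Proof.
move=> /andP[q0 q1] Lw Hw n m.
have C0 : 0 <= C.
  by have := Hw 0%N; rewrite expr0 mulr1; apply: le_trans; exact: l2norm_ge0.
have q1' : 0 < 1 - q by rewrite subr_gt0.
suff : l2norm X (fun i t => w (n + m)%N i t - w n i t) <=
    C / (1 - q) * q ^+ n * (1 - q ^+ m).
  move/le_trans; apply; rewrite ler_piMr//.
    by rewrite mulr_ge0 ?exprn_ge0// divr_ge0// ltW.
  by rewrite lerBlDr lerDl exprn_ge0.
elim: m => [|m IH].
  by rewrite expr0 subrr mulr0 addn0 l2norm0// => i t _; rewrite subrr.
rewrite /l2norm (eq_sqn (v := fun i t => (w (n + m.+1)%N i t - w (n + m)%N i t) +
   (w (n + m)%N i t - w n i t))); last by move=> i t _; lra.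
rewrite -/(l2norm X _) (le_trans (l2normD _ _))//; [exact: L2realB..|].
rewrite addnS (le_trans (lerD (Hw _) IH))// exprD exprS.
rewrite le_eqVlt; apply/orP; left; apply/eqP; field.
by rewrite gt_eqF.
Qed.

(** The images of a geometric Cauchy sequence converge at every point, by
    [act_bound]; the pointwise limit is measurable and respects the gluing, and
    Fatou's lemma bounds its distance to the sequence.  This provides the limits
    that [neumann] asks for. *)
Lemma act_complete (w : nat -> I -> R -> R) (C q : R) : 0 <= q < 1 ->
  (forall n, L2 (w n)) ->
  (forall n, l2norm X (fun i t => w n.+1 i t - w n i t) <= C * q ^+ n) ->
  exists v, L2 v /\ forall n,
    l2norm X (fun i t => act (w n) i t - v i t) <= C / (1 - q) * q ^+ n.
Proof.
move=> q01 Lw Hw; have /andP[q0 q1] := q01.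
have LT n : L2 (act (w n)) by exact: L2_act.
have cvg_act i t : D i t -> cvgn (fun n => act (w n) i t).
  move=> it; have [B [B0 HB]] := act_bound it.
  apply: (@geometric_increments_cvg _ _ (B * C) q) => // n.
  rewrite -actB// (le_trans (HB _ (L2realB (Lw _) (Lw _))))//.
  by rewrite -mulrA ler_wpM2l.
pose v i t := limn (fun n => act (w n) i t).
have cv i t : D i t -> act (w n) i t @[n --> \oo] --> v i t.
  by move=> it; exact: cvg_act.
have mv : rmeasurable X v.
  split=> [i Xi|i t j s g].
    apply: (measurable_fun_cvg (h := fun n => act (w n) i)) => //.
    - by move=> n; have [[m _] _] := LT n; exact: m.
    - by move=> t tU; apply: cv; exact: itv_dom.
  rewrite /v; congr (lim (_ @ \oo)); apply/funext => n.
  by have [[_ gn] _] := LT n; exact: gn.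
have Cq n : 0 <= C / (1 - q) * q ^+ n.
  apply: le_trans (geometric_tail q01 Lw Hw n 0); exact: l2norm_ge0.
have bnd n : (sqn X (fun i t => act (w n) i t - v i t)%R <=
    ((C / (1 - q) * q ^+ n) ^+ 2)%:E)%E.
  rewrite -sqnN.
  apply: (@sqn_fatou _ _ X (fun m i t => act (w (n + m)%N) i t - act (w n) i t)).
  - by move=> m; have [mm _] := LT (n + m)%N; have [mn _] := LT n; exact: rmeasurableB.
  - move=> i t it; rewrite [X in _ --> X]opprB.
    suff h : act (w (n + m)%N) i t @[m --> \oo] --> v i t.
      by apply: cvgB h _; exact: cvg_cst.
    rewrite (_ : (fun m => _) = (fun m => act (w (m + n)%N) i t)).
      by rewrite (cvg_shiftn n (fun m => act (w m) i t)); exact: cv.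
    by apply/funext => m; rewrite addnC.
  - move=> m; have LB : L2 (fun i t => w (n + m)%N i t - w n i t) by exact: L2realB.
    rewrite (eq_sqn (v := act (fun i t => w (n + m)%N i t - w n i t))); last first.
      by move=> i t it; rewrite actB.
    rewrite (sqn_l2norm (L2_act LB)) lee_fin ler_pXn2r ?nnegrE ?l2norm_ge0//.
    apply: le_trans (geometric_tail q01 Lw Hw n m).
    by have [_] := op_bound1.2 _ LB; rewrite mul1r.
exists v; split; last by move=> n; apply: sqn_le_l2norm.
have LB : L2 (fun i t => act (w 0%N) i t - v i t).
  split; last by apply: (le_lt_trans (bnd 0%N)); exact: ltry.
  by have [m0 _] := LT 0%N; exact: rmeasurableB.
by apply: eq_L2real (L2realB (LT 0%N) LB) => i t _; lra.
Qed.

End Markov.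
Arguments positive {R I} X u.
Arguments rmeasurable_cst {R I} X c.
(* From here on these are used through their lemmas; unfolding them would expose
   the integrals to conversion. *)
#[global] Opaque act l2norm sqn integral_on.

(** * The norm as an approximate eigenvalue *)

Section OperatorNorm.
Context {R : realType} {I : choiceType} {X : frame R I} (M : markov X).
Local Notation D := (dom X).
Local Notation L2 := (L2real X).
Local Notation nr := (l2norm X).
Local Notation T := (act M).

Definition op_norm : R :=
  sup [set nr (T u) | u in [set u | L2 u /\ nr u <= 1]].

Let nonempty : [set nr (T u) | u in [set u | L2 u /\ nr u <= 1]] !=set0.
Proof.
exists (nr (T (fun _ _ => 0))), (fun _ _ => 0) => //; split; first exact: L2real0.
by rewrite l2norm0.
Qed.

Let bounded : has_ubound [set nr (T u) | u in [set u | L2 u /\ nr u <= 1]].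
Proof.
exists 1 => _ [u [Lu u1] <-]; have [_] := (op_bound1 M).2 u Lu.
by rewrite mul1r => /le_trans; apply.
Qed.

Lemma op_norm_ge u : L2 u -> nr u <= 1 -> nr (T u) <= op_norm.
Proof. by move=> Lu u1; apply: ub_le_sup => //; exists u. Qed.

Lemma op_norm_ge0 : 0 <= op_norm.
Proof.
apply: le_trans (op_norm_ge (L2real0 X) _); first exact: l2norm_ge0.
by rewrite l2norm0.
Qed.

Lemma op_norm_bound : op_bound M op_norm.
Proof.
split=> [|u Lu]; first exact: op_norm_ge0.
split; first exact: L2_act.
have LTu := L2_act M Lu.
have [u0|u0] := eqVneq (nr u) 0.
  by have [_] := (op_bound1 M).2 u Lu; rewrite u0 !mulr0.
have un : 0 < nr u by rewrite lt_neqAle eq_sym u0 l2norm_ge0.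
have Lv : L2 (fun i t => (nr u)^-1 * u i t) by exact: L2realZ.
have : nr (T (fun i t => (nr u)^-1 * u i t)) <= op_norm.
  by apply: op_norm_ge => //; rewrite l2normZ// gtr0_norm ?invr_gt0// mulVf.
have -> : nr (T (fun i t => (nr u)^-1 * u i t)) = nr (fun i t => (nr u)^-1 * T u i t).
  by apply: eq_l2norm => i t it; rewrite actZ.
by rewrite l2normZ// gtr0_norm ?invr_gt0// mulrC ler_pdivrMr.
Qed.

Lemma act_sym_sqr f : L2 f -> positive X f ->
  integral_on X (fun i t => (f i t * T (T f) i t)%:E) = sqn X (T f).
Proof.
move=> Lf f0; have [mf _] := Lf.
have LTf := L2_act M Lf; have Tf0 := act_ge0 M Lf f0; have [mTf _] := LTf.
have af := admissible_EFin mf f0; have aTf := admissible_EFin mTf Tf0.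
have fE g : L2 g -> positive X g -> forall i t, D i t ->
    (T g i t)%:E = app M (fun i t => (g i t)%:E) i t.
  by move=> Lg g0 i t it; rewrite (act_pos M Lg g0 it) fineK// app_fin.
transitivity (integral_on X (fun i t => (f i t)%:E *
    app M (fun i t => (T f i t)%:E) i t)%E).
  by apply: eq_integral_on => i t it; rewrite EFinM (fE _ LTf Tf0).
rewrite app_sym// sqnE; apply: eq_integral_on => i t it.
by rewrite -(fE _ Lf f0)// -EFinM expr2.
Qed.

(** The expansion of |T^2 f - a f|^2, where symmetry turns the cross term into
    |T f|^2.  The cross term is on the left so that all terms are nonnegative and
    the identity can be proved between integrals with values in [0, +oo]. *)
Lemma sqn_sub_sym f : L2 f -> positive X f -> forall a : R, 0 <= a ->
  nr (fun i t => T (T f) i t - a * f i t) ^+ 2 + (2 * a) * nr (T f) ^+ 2 =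
  nr (T (T f)) ^+ 2 + a ^+ 2 * nr f ^+ 2.
Proof.
move=> Lf f0 a a0; have [mf _] := Lf.
have LTf := L2_act M Lf; have LTTf := L2_act M LTf.
have Tf0 := act_ge0 M Lf f0; have TTf0 := act_ge0 M LTf Tf0.
have [mTf _] := LTf; have [mTTf _] := LTTf.
have Ld : L2 (fun i t => T (T f) i t - a * f i t).
  by apply: L2realB => //; exact: L2realZ.
have [md _] := Ld; have Laf := L2realZ a Lf; have [maf _] := Laf.
have am : admissible X (fun i t => (f i t * T (T f) i t)%:E).
  apply: admissible_EFin; first exact: rmeasurableM.
  by move=> i t it; rewrite mulr_ge0 ?f0 ?TTf0.
have a2 : 0 <= 2 * a by rewrite mulr_ge0.
have : (sqn X (fun i t => T (T f) i t - a * f i t)%R + (2 * a)%:E * sqn X (T f) =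
    sqn X (T (T f)) + (a ^+ 2)%:E * sqn X f)%E.
  rewrite -sqnZ// -(act_sym_sqr Lf f0) -integral_onZ// !sqnE.
  rewrite -!integral_onD//; [|exact: admissible_sqr..|exact: admissible_sqr|
    exact: admissibleZ].
  apply: eq_integral_on => i t it; rewrite -!EFinM -!EFinD; congr EFin; ring.
rewrite (sqn_l2norm Ld) (sqn_l2norm LTf) (sqn_l2norm LTTf) (sqn_l2norm Lf).
by rewrite -!EFinM -!EFinD => -[].
Qed.

Let half_le (L d x : R) : d <= L / 2 -> L - d <= x -> L / 2 <= x.
Proof. lra. Qed.

(* [x], [y], [z] and [n] stand for the norms of f, T f, T^2 f and
   T^2 f - L^2 f: the last one is small when y is at least L - d. *)
Let residual_le (L d e x y z n : R) : 0 < L -> 0 <= d -> d <= L / 2 ->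
  2 * L ^+ 3 * d <= e ^+ 2 -> 0 <= x -> x <= 1 -> L - d <= y -> 0 <= z ->
  z <= L * y ->
  n ^+ 2 + (2 * L ^+ 2) * y ^+ 2 = z ^+ 2 + (L ^+ 2) ^+ 2 * x ^+ 2 ->
  n ^+ 2 <= e ^+ 2.
Proof.
move=> L0 d0 dL Ld x0 x1 yL z0 zL E.
have y0 : 0 <= L - d by lra.
have L2 : 0 <= L ^+ 2 by exact: sqr_ge0.
have e1 : z ^+ 2 <= L ^+ 2 * y ^+ 2.
  by rewrite -exprMn ler_pXn2r// nnegrE; apply: le_trans zL.
have e2 : (L ^+ 2) ^+ 2 * x ^+ 2 <= (L ^+ 2) ^+ 2.
  by rewrite ler_piMr ?sqr_ge0// expr_le1.
have e3 : L ^+ 2 * (L - d) ^+ 2 <= L ^+ 2 * y ^+ 2.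
  by rewrite ler_wpM2l// ler_pXn2r// nnegrE; apply: le_trans yL.
have e4 : 0 <= L ^+ 2 * d ^+ 2 by rewrite mulr_ge0// sqr_ge0.
have e5 : L ^+ 2 * (L - d) ^+ 2 =
    (L ^+ 2) ^+ 2 - 2 * L ^+ 3 * d + L ^+ 2 * d ^+ 2 by ring.
move: e1 e2 e3 e4 e5 E Ld.
move: (L ^+ 2 * (L - d) ^+ 2) (2 * L ^+ 3 * d) (L ^+ 2 * d ^+ 2)
  ((L ^+ 2) ^+ 2 * x ^+ 2) ((L ^+ 2) ^+ 2) => a b c g h.
rewrite -mulrA; move: (L ^+ 2 * y ^+ 2) => k; lra.
Qed.

(** If f >= 0 has norm at most 1 and |T f| is close to L, then [sqn_sub_sym]
    with a = L^2 shows that (T - L) (T + L) f = T^2 f - L^2 f is small.  Positivity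
    keeps g = T f + L f away from 0, for g >= L f and L |f| >= |T f|; without
    it, -L could be the approximate eigenvalue. *)
Lemma approximate_eigenvector (e : R) : 0 < op_norm -> 0 < e ->
  exists g, [/\ L2 g, positive X g, op_norm / 2 <= nr g &
    nr (fun i t => T g i t - op_norm * g i t) <= e].
Proof.
set L := op_norm => L0 e0.
have [LK HL] := op_norm_bound; rewrite -/L in LK HL.
pose d := Num.min (L / 2) (e ^+ 2 / (2 * L ^+ 3)).
have d0 : 0 < d by rewrite lt_min !divr_gt0// ?mulr_gt0 ?exprn_gt0.
have [_ [u [Lu u1] <-] ud] := sup_adherent d0 (conj nonempty bounded).
rewrite -/op_norm -/L in ud.
pose f i t := `|u i t|.
have Lf : L2 f by exact: L2_norm.
have f0 : positive X f by move=> i t _; exact: normr_ge0.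
have LTf := L2_act M Lf; have LTTf := L2_act M LTf.
have Tf0 := act_ge0 M Lf f0.
have f1 : nr f <= 1 by rewrite l2norm_norm.
have Tfd : L - d <= nr (T f).
  apply: (le_trans (ltW ud)); apply: sqn_le_l2norm; first exact: l2norm_ge0.
  rewrite -sqn_l2norm//; have [m1 _] := L2_act M Lu; have [m2 _] := LTf.
  apply: le_sqn => // i t it.
  exact: le_trans (norm_act_le M Lu it) (ler_norm _).
have dL : d <= L / 2 by rewrite ge_min lexx.
have dE : d <= e ^+ 2 / (2 * L ^+ 3) by rewrite ge_min lexx orbT.
have f12 : L / 2 <= L * nr f.
  by have [_] := HL _ Lf; apply: le_trans; exact: half_le dL Tfd.
have LLf : L2 (fun i t => L * f i t) by exact: L2realZ.
exists (fun i t => T f i t + L * f i t); split.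
- exact: L2realD.
- by move=> i t it; rewrite addr_ge0 ?Tf0// mulr_ge0// f0.
- apply: (@le_trans _ _ (nr (fun i t => L * f i t))).
    by rewrite l2normZ// ger0_norm.
  apply: sqn_le_l2norm; first exact: l2norm_ge0.
  rewrite -sqn_l2norm; last exact: L2realD.
  have [m1 _] := LLf; have [m2 _] := LTf.
  apply: le_sqn => //; first exact: rmeasurableD.
  move=> i t it; have h1 := Tf0 _ _ it.
  have h2 : 0 <= L * f i t by apply: mulr_ge0 => //; exact: f0.
  by rewrite (ger0_norm h2) (ger0_norm (addr_ge0 h1 h2)) lerDr.
- have -> : nr (fun i t => T (fun i t => T f i t + L * f i t) i t -
        L * (T f i t + L * f i t)) = nr (fun i t => T (T f) i t - L ^+ 2 * f i t).
    apply: eq_l2norm => i t it.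
    by rewrite actD// actZ//; ring.
  have E := sqn_sub_sym Lf f0 (sqr_ge0 L).
  have [_ TTf] := HL _ LTf.
  rewrite -(ler_pXn2r (n := 2)) ?nnegrE ?l2norm_ge0 ?(ltW e0)//.
  apply: (residual_le L0 (ltW d0) dL _ (l2norm_ge0 X f) f1 Tfd
            (l2norm_ge0 X (T (T f))) TTf E).
  by rewrite mulrC -ler_pdivlMr// mulr_gt0// exprn_gt0.
Qed.

(** The negative part v of u satisfies l v <= T v: where u < 0,
    l v = - l u <= - T u <= T v.  Hence l |v| <= |T v| <= K |v|, and v = 0. *)
Lemma supersolution_ge0 u (K l : R) : op_bound M K -> K < l -> L2 u ->
  (forall i t, D i t -> T u i t <= l * u i t) ->
  nr (fun i t => Num.max (- u i t) 0) = 0.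
Proof.
move=> [K0 HK] Kl Lu ul; set v := fun i t => Num.max (- u i t) 0.
have Lv : L2 v by apply: L2_pos; exact: L2realN.
have Lp : L2 (fun i t => Num.max (u i t) 0) by exact: L2_pos.
have v0 : positive X v by move=> i t _; rewrite le_max lexx orbT.
have p0 : positive X (fun i t => Num.max (u i t) 0).
  by move=> i t _; rewrite le_max lexx orbT.
have Tv0 := act_ge0 M Lv v0; have l0 : 0 < l := le_lt_trans K0 Kl.
have lv i t : D i t -> l * v i t <= T v i t.
  move=> it; rewrite /v /=; case: (leP (- u i t) 0) => h.
    by rewrite mulr0; exact: Tv0.
  have : T u i t = T (fun i t => Num.max (u i t) 0 - v i t) i t.
    apply: eq_act it => // j s _.
    by rewrite /v; case: (leP (u j s) 0) => ?; case: (leP (- u j s) 0) => ?; lra.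
  rewrite actB//; have := act_ge0 M Lp p0 it; have := ul _ _ it.
  by rewrite mulrN; lra.
have [LTv TvK] := HK _ Lv.
have : l * nr v <= K * nr v.
  apply: le_trans TvK; rewrite -[l]gtr0_norm// -l2normZ//.
  apply: sqn_le_l2norm; first exact: l2norm_ge0.
  rewrite -sqn_l2norm//; have [m1 _] := L2realZ l Lv; have [m2 _] := LTv.
  apply: le_sqn => // i t it; rewrite !ger0_norm ?Tv0 ?mulr_ge0 ?v0 ?(ltW l0)//.
    exact: lv.
rewrite -subr_ge0 -mulrBl => h; apply/eqP; rewrite eq_le l2norm_ge0 andbT.
by rewrite -(nmulr_rge0 _ (_ : K - l < 0))// subr_lt0.
Qed.

End OperatorNorm.

(** * Complex functions *)

(** A complex Hilbert space of representatives and an operator on it which are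
    seen, through real and imaginary parts, as two copies of the real L2 of a
    frame and of the real operator.  The operator is real, so bounds and
    approximate eigenvectors pass from the real to the complex setting. *)
Section ComplexModel.
Context {R : realType} {I : choiceType} {X : frame R I} (M : markov X).
Local Notation D := (dom X).
Local Notation L2 := (L2real X).
Local Notation nr := (l2norm X).
Local Notation T := (act M).
Variables (E : lmodType R[i]) (re im : E -> I -> R -> R) (H : set E)
  (nrm : E -> R) (A : E -> E).
Hypothesis HP : forall f, H f <-> L2 (re f) /\ L2 (im f).
Hypothesis nrmE : forall f, H f -> nrm f = Num.sqrt (nr (re f) ^+ 2 + nr (im f) ^+ 2).
Hypothesis nrm_ge0 : forall f, 0 <= nrm f.
Hypothesis re_lin : forall (a : R[i]) f g i t, re (a *: f + g) i t =
  complex.Re a * re f i t - complex.Im a * im f i t + re g i t.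
Hypothesis im_lin : forall (a : R[i]) f g i t, im (a *: f + g) i t =
  complex.Re a * im f i t + complex.Im a * re f i t + im g i t.
Hypothesis pairing : forall u v, glued X u -> glued X v ->
  exists f, forall i t, D i t -> re f i t = u i t /\ im f i t = v i t.
Hypothesis reA : forall f, H f -> forall i t, D i t -> re (A f) i t = T (re f) i t.
Hypothesis imA : forall f, H f -> forall i t, D i t -> im (A f) i t = T (im f) i t.

Let re0 i t : re 0 i t = 0.
Proof.
have := re_lin 1 0 0 i t; rewrite scaler0 addr0 /= mul1r mul0r subr0.
by move: (re 0 i t) => x; lra.
Qed.

Let im0 i t : im 0 i t = 0.
Proof.
have := im_lin 1 0 0 i t; rewrite scaler0 addr0 /= mul1r mul0r addr0.
by move: (im 0 i t) => x; lra.
Qed.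

Let reZ a f i t : re (a *: f) i t =
  complex.Re a * re f i t - complex.Im a * im f i t.
Proof. by rewrite -[a *: f]addr0 re_lin re0 addr0. Qed.

Let imZ a f i t : im (a *: f) i t =
  complex.Re a * im f i t + complex.Im a * re f i t.
Proof. by rewrite -[a *: f]addr0 im_lin im0 addr0. Qed.

Let reD f g i t : re (f + g) i t = re f i t + re g i t.
Proof. by rewrite -[f]scale1r re_lin scale1r /= mul1r mul0r subr0. Qed.

Let imD f g i t : im (f + g) i t = im f i t + im g i t.
Proof. by rewrite -[f]scale1r im_lin scale1r /= mul1r mul0r addr0. Qed.

Let reN f i t : re (- f) i t = - re f i t.
Proof. by rewrite -scaleN1r reZ /= oppr0 mul0r subr0 mulN1r. Qed.

Let imN f i t : im (- f) i t = - im f i t.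
Proof. by rewrite -scaleN1r imZ /= oppr0 mul0r addr0 mulN1r. Qed.

Let fext (u v : I -> R -> R) : (forall i t, u i t = v i t) -> u = v.
Proof. by move=> e; apply/funext => i; apply/funext => t; exact: e. Qed.

Let HD a f g : H f -> H g -> H (a *: f + g).
Proof.
move=> /HP[Lf Lf'] /HP[Lg Lg']; apply/HP; split.
  apply: eq_L2real (L2realD (L2realB (L2realZ (complex.Re a) Lf)
    (L2realZ (complex.Im a) Lf')) Lg) => i t _; exact/esym/re_lin.
apply: eq_L2real (L2realD (L2realD (L2realZ (complex.Re a) Lf')
    (L2realZ (complex.Im a) Lf)) Lg') => i t _; exact/esym/im_lin.
Qed.

Let H0 : H 0.
Proof.
apply/HP; split; apply: eq_L2real (L2real0 X) => i t _; [exact/esym/re0|exact/esym/im0].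
Qed.

Let Hadd f g : H f -> H g -> H (f + g).
Proof. by move=> Hf Hg; rewrite -[f]scale1r; exact: HD. Qed.

Let Hopp f : H f -> H (- f).
Proof. by move=> Hf; rewrite -[- f]addr0 -scaleN1r; exact: HD. Qed.

Let nrm_sqr f : H f -> nrm f ^+ 2 = nr (re f) ^+ 2 + nr (im f) ^+ 2.
Proof. by move=> Hf; rewrite nrmE// sqr_sqrtr// addr_ge0 ?sqr_ge0. Qed.

Let nr_re_le f : H f -> nr (re f) <= nrm f.
Proof.
move=> Hf; rewrite -(ler_pXn2r (n := 2)) ?nnegrE ?l2norm_ge0//.
by rewrite nrm_sqr// lerDl sqr_ge0.
Qed.

Let nr_im_le f : H f -> nr (im f) <= nrm f.
Proof.
move=> Hf; rewrite -(ler_pXn2r (n := 2)) ?nnegrE ?l2norm_ge0//.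
by rewrite nrm_sqr// lerDr sqr_ge0.
Qed.

Let euclid (a b c d : R) :
  Num.sqrt ((a + c) ^+ 2 + (b + d) ^+ 2) <=
  Num.sqrt (a ^+ 2 + b ^+ 2) + Num.sqrt (c ^+ 2 + d ^+ 2).
Proof.
have p0 x y : 0 <= x ^+ 2 + y ^+ 2 :> R by rewrite addr_ge0 ?sqr_ge0.
rewrite -(ler_pXn2r (n := 2)) ?nnegrE ?addr_ge0 ?sqrtr_ge0//.
rewrite sqr_sqrtr// [leRHS]sqrrD !sqr_sqrtr// -sqrtrM//.
have : a * c + b * d <= Num.sqrt ((a ^+ 2 + b ^+ 2) * (c ^+ 2 + d ^+ 2)).
  apply: (le_trans (ler_norm _)); rewrite -sqrtr_sqr ler_wsqrtr//.
  rewrite -subr_ge0 (_ : _ - _ = (a * d - b * c) ^+ 2) ?sqr_ge0//; ring.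
move: (Num.sqrt _) => s h.
rewrite (_ : _ + _ = a ^+ 2 + b ^+ 2 + (c ^+ 2 + d ^+ 2) + (a * c + b * d) *+ 2).
  by lra.
by rewrite mulr2n; ring.
Qed.

Let nrmD f g : H f -> H g -> nrm (f + g) <= nrm f + nrm g.
Proof.
move=> Hf Hg; have [Lf Lf'] := (HP f).1 Hf; have [Lg Lg'] := (HP g).1 Hg.
rewrite !nrmE//; last exact: Hadd.
apply: le_trans (euclid _ _ _ _); rewrite ler_wsqrtr// lerD//.
  rewrite ler_pXn2r ?nnegrE ?addr_ge0 ?l2norm_ge0//.
  rewrite (_ : re (f + g) = fun i t => re f i t + re g i t); first exact: l2normD.
  by apply: fext => i t; exact: reD.
rewrite ler_pXn2r ?nnegrE ?addr_ge0 ?l2norm_ge0//.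
rewrite (_ : im (f + g) = fun i t => im f i t + im g i t); first exact: l2normD.
by apply: fext => i t; exact: imD.
Qed.

Let nrmZ a f : H f -> nrm (a *: f) = cabs a * nrm f.
Proof.
move=> Hf; have [Lf Lf'] := (HP f).1 Hf.
have Haf : H (a *: f) by rewrite -[_ *: _]addr0; exact: HD.
have [Laf Laf'] := (HP _).1 Haf.
rewrite !nrmE// /cabs -sqrtrM ?addr_ge0 ?sqr_ge0//; congr Num.sqrt.
have [m1 _] := Lf; have [m2 _] := Lf'; have [m3 _] := Laf; have [m4 _] := Laf'.
have : (sqn X (re (a *: f)) + sqn X (im (a *: f)) =
    (complex.Re a ^+ 2 + complex.Im a ^+ 2)%:E * (sqn X (re f) + sqn X (im f)))%E.
  rewrite !sqnE -!integral_onD; [|exact: admissible_sqr..].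
  rewrite -integral_onZ//; last 2 first.
  - by rewrite addr_ge0 ?sqr_ge0.
  - by apply: admissibleD; exact: admissible_sqr.
  apply: eq_integral_on => i t _; rewrite -!EFinD -EFinM reZ imZ; congr EFin; ring.
by rewrite !sqn_l2norm// -!EFinD -EFinM => -[].
Qed.

Let nrmN f : H f -> nrm (- f) = nrm f.
Proof. by move=> Hf; rewrite -scaleN1r nrmZ// cabsN1 mul1r. Qed.

Let AH f : H f -> H (A f).
Proof.
move=> Hf; have [Lf Lf'] := (HP f).1 Hf; apply/HP; split.
  by apply: eq_L2real (L2_act M Lf) => i t it; rewrite reA.
by apply: eq_L2real (L2_act M Lf') => i t it; rewrite imA.
Qed.

Let nrm_eq0 f : H f -> (forall i t, D i t -> re f i t = 0) ->
  (forall i t, D i t -> im f i t = 0) -> nrm f = 0.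
Proof.
by move=> Hf r0 i0; rewrite nrmE// !l2norm0// expr0n addr0 sqrtr0.
Qed.

Let Alin a f g : H f -> H g -> nrm (A (a *: f + g) - (a *: A f + A g)) = 0.
Proof.
move=> Hf Hg; have [Lf Lf'] := (HP f).1 Hf; have [Lg Lg'] := (HP g).1 Hg.
have Hl := HD a Hf Hg.
have HAf := AH Hf; have HAg := AH Hg; have HAl := AH Hl.
have La := L2realZ (complex.Re a) Lf; have Lb := L2realZ (complex.Im a) Lf'.
have La' := L2realZ (complex.Re a) Lf'; have Lb' := L2realZ (complex.Im a) Lf.
apply: nrm_eq0; first by apply: Hadd => //; apply: Hopp; exact: HD.
- move=> i t it; rewrite reD reN re_lin !reA//.
  rewrite (_ : re (a *: f + g) = fun i t => complex.Re a * re f i t -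
    complex.Im a * im f i t + re g i t); last by apply: fext => *; exact: re_lin.
  rewrite (actD M (L2realB La Lb) Lg it) (actB M La Lb it).
  by rewrite (actZ M _ Lf it) (actZ M _ Lf' it) (imA Hf it) subrr.
- move=> i t it; rewrite imD imN im_lin !imA//.
  rewrite (_ : im (a *: f + g) = fun i t => complex.Re a * im f i t +
    complex.Im a * re f i t + im g i t); last by apply: fext => *; exact: im_lin.
  rewrite (actD M (L2realD La' Lb') Lg' it) (actD M La' Lb' it).
  by rewrite (actZ M _ Lf' it) (actZ M _ Lf it) (reA Hf it) subrr.
Qed.

Let A_complete (u : nat -> E) (C q : R) : 0 <= q < 1 -> (forall n, H (u n)) ->
     (forall n, nrm (u n.+1 - u n) <= C * q ^+ n) ->
     exists2 v, H v & exists C', forall n, nrm (A (u n) - v) <= C' * q ^+ n.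
Proof.
move=> q01 Hu Hn; have /andP[q0 q1] := q01.
have Hsub n : H (u n.+1 - u n) by apply: Hadd => //; exact: Hopp.
have Lu n : L2 (re (u n)) by have [] := (HP _).1 (Hu n).
have Lu' n : L2 (im (u n)) by have [] := (HP _).1 (Hu n).
have [|x [Lx cx]] := act_complete M q01 Lu (C := C).
  move=> n; apply: le_trans (Hn n); apply: le_trans (nr_re_le (Hsub n)).
  rewrite le_eqVlt; apply/orP; left; apply/eqP; apply: eq_l2norm => i t _.
  by rewrite reD reN.
have [|y [Ly cy]] := act_complete M q01 Lu' (C := C).
  move=> n; apply: le_trans (Hn n); apply: le_trans (nr_im_le (Hsub n)).
  rewrite le_eqVlt; apply/orP; left; apply/eqP; apply: eq_l2norm => i t _.
  by rewrite imD imN.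
have [[_ gx] _] := Lx; have [[_ gy] _] := Ly.
have [v vxy] := pairing gx gy.
have Hv : H v.
  apply/HP; split; [apply: eq_L2real Lx|apply: eq_L2real Ly];
  by move=> i t it; have [] := vxy _ _ it.
exists v => //; exists (2 * (C / (1 - q))) => n.
have HAu := AH (Hu n).
have Hd : H (A (u n) - v) by apply: Hadd => //; exact: Hopp.
have e1 : nr (re (A (u n) - v)) <= C / (1 - q) * q ^+ n.
  apply: le_trans (cx n); rewrite le_eqVlt; apply/orP; left; apply/eqP.
  by apply: eq_l2norm => i t it; rewrite reD reN reA// (vxy _ _ it).1.
have e2 : nr (im (A (u n) - v)) <= C / (1 - q) * q ^+ n.
  apply: le_trans (cy n); rewrite le_eqVlt; apply/orP; left; apply/eqP.
  by apply: eq_l2norm => i t it; rewrite imD imN imA// (vxy _ _ it).2.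
rewrite nrmE//; have := euclid (nr (re (A (u n) - v))) 0 0 (nr (im (A (u n) - v))).
rewrite addr0 add0r => /le_trans; apply.
rewrite !expr0n /= addr0 add0r !sqrtr_sqr !ger0_norm ?l2norm_ge0//.
by rewrite -mulrA mulr_natl mulr2n lerD.
Qed.

Lemma op_bound_resolvent (K : R) (l : R[i]) :
  op_bound M K -> K < cabs l -> resolvent_set H nrm A l.
Proof.
move=> [K0 HK] Kl.
apply: (neumann H0 HD _ nrmD nrmZ AH Alin K0 _ Kl A_complete) => [//|f Hf].
have [Lf Lf'] := (HP f).1 Hf; have HAf := AH Hf.
have e1 : nr (re (A f)) <= K * nr (re f).
  by rewrite (eq_l2norm (reA Hf)); have [] := HK _ Lf.
have e2 : nr (im (A f)) <= K * nr (im f).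
  by rewrite (eq_l2norm (imA Hf)); have [] := HK _ Lf'.
rewrite -(ler_pXn2r (n := 2)) ?nnegrE ?mulr_ge0//.
rewrite exprMn !nrm_sqr// mulrDr -!exprMn lerD//.
  by rewrite ler_pXn2r ?nnegrE ?mulr_ge0 ?l2norm_ge0.
by rewrite ler_pXn2r ?nnegrE ?mulr_ge0 ?l2norm_ge0.
Qed.

Lemma approximate_spectrum (l c : R) : 0 < c ->
  (forall e, 0 < e -> exists u, [/\ L2 u, c <= nr u &
     nr (fun i t => T u i t - l * u i t) <= e]) ->
  spectrum H nrm A l%:C%C.
Proof.
move=> c0 app; apply: (approximate_eigenvalue nrm_ge0 Hopp nrmD nrmN _ c0).
  by move=> f Hf; apply: HD => //; apply: Hopp; exact: AH.
move=> e e0; have [u [Lu cu ue]] := app e e0.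
have [[_ gu] _] := Lu; have [[_ g0] _] := L2real0 X.
have [f fu] := pairing gu g0.
have Lf : L2 (re f) by apply: eq_L2real Lu => i t it; have [] := fu _ _ it.
have Lf' : L2 (im f).
  by apply: eq_L2real (L2real0 X) => i t it; have [] := fu _ _ it.
have Hf : H f by apply/HP.
have HAf := AH Hf.
have Hr : H (l%:C%C *: f - A f) by apply: HD => //; exact: Hopp.
exists f; split=> //.
  apply: le_trans (nr_re_le Hf); rewrite (eq_l2norm (v := u))// => i t it.
  by have [] := fu _ _ it.
rewrite nrmE// [X in _ + X ^+ 2]l2norm0; last first.
  move=> i t it; rewrite im_lin imN imA//= mul0r addr0 (fu _ _ it).2 mulr0 add0r.
  rewrite (eq_act M (v := fun _ _ => 0) _ _ it)//; last first.
    by move=> j s js; have [] := fu _ _ js.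
  by rewrite (act_pos M (L2real0 X) _ it)// app_cst0// oppr0.
rewrite expr0n addr0 sqrtr_sqr ger0_norm ?l2norm_ge0//.
apply: le_trans ue; rewrite le_eqVlt; apply/orP; left; apply/eqP.
have Ld : L2 (fun i t => T u i t - l * u i t).
  by apply: L2realB; [exact: L2_act|exact: L2realZ].
have [md _] := Ld.
transitivity (nr (fun i t => -1 * (T u i t - l * u i t))); last first.
  by rewrite l2normZ// normrN1 mul1r.
apply: eq_l2norm => i t it; rewrite re_lin reN reA//= mul0r subr0 (fu _ _ it).1.
rewrite (eq_act M (v := u) Lf _ it); first by ring.
by move=> j s js; have [] := fu _ _ js.
Qed.

End ComplexModel.

(** * The transition operator *)

Section RSum.
Context {R : realType}.

Lemma pmule_fin_num (r : R) (x : \bar R) : 0 < r ->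
  (r%:E * x)%E \is a fin_num -> x \is a fin_num.
Proof.
move=> r0; case: x => // ; [rewrite gt0_muley|rewrite gt0_muleNy]; rewrite ?lte_fin//.
Qed.

(** The signed sum is defined by positive and negative parts of the terms; this
    lets it be computed from any other decomposition with finite sums. *)
Lemma rsum_sub (I : choiceType) (D : set I) (f : I -> R) (p q : I -> \bar R) :
  (forall i, D i -> 0 <= p i)%E -> (forall i, D i -> 0 <= q i)%E ->
  \esum_(i in D) p i \is a fin_num -> \esum_(i in D) q i \is a fin_num ->
  (forall i, D i -> f i = fine (p i) - fine (q i)) ->
  rsum D f = fine (\esum_(i in D) p i) - fine (\esum_(i in D) q i).
Proof.
move=> p0 q0 fp fq fpq.
have sum (g : I -> \bar R) : (forall i, D i -> 0 <= g i)%E ->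
    \esum_(i in D) g i \is a fin_num ->
    summable D g.
  move=> g0 fg; rewrite summableE (eq_esum (b := g))// => i Di.
  by rewrite gee0_abs// g0.
have fin (g : I -> \bar R) : (forall i, D i -> 0 <= g i)%E ->
    \esum_(i in D) g i \is a fin_num ->
    forall i, D i -> g i \is a fin_num.
  by move=> g0 fg i Di; rewrite fin_num_abs (summable_pinfty (sum g g0 fg)).
have e i : D i -> (EFin \o f) i = (p \- q)%E i.
  by move=> Di /=; rewrite fpq// EFinB !fineK// ?(fin p)// (fin q).
rewrite /rsum -fineB//; congr fine.
rewrite -(esumB (sum p p0 fp) (sum q q0 fq) p0 q0).
congr (_ - _)%E; apply: eq_esum => i Di.
  by rewrite !funeposE (e i Di).
by rewrite !funenegE (e i Di).
Qed.

End RSum.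

Section Network.
Context {R : realType} {V : countType} (N : network R V).
Local Notation nbrs x := [set y | nbr N x y].
Local Notation c := (cond N).
Local Notation U := (`[0%R, 1%R]%classic : set (measurableTypeR R)).
Implicit Types (x y : V).

Lemma exists_nbr x : exists y, nbr N x y.
Proof.
have [a [b ab]] := nbr_edge N; have [p] := nbr_connected N x a.
by case: p => [_ /= ->|y p /= /andP[xy _] _]; [exists b|exists y].
Qed.

Lemma cond_ge0 x y : nbr N x y -> (0 <= (c x y)%:E)%E.
Proof. by move=> xy; rewrite lee_fin ltW// cond_gt0. Qed.

Lemma m0E x : (\esum_(y in nbrs x) (c x y)%:E)%E = (m0 N x)%:E.
Proof.
rewrite /m0 fineK// ge0_fin_numE ?cond_fin//; apply: esum_ge0 => y; exact: cond_ge0.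
Qed.

Lemma cond_le_m0 x y : nbr N x y -> c x y <= m0 N x.
Proof.
move=> xy; rewrite -lee_fin -m0E; apply: esum_ge; exists [set y].
  by split=> // z ->.
by rewrite fsbig_set1.
Qed.

Lemma m0_gt0 x : 0 < m0 N x.
Proof.
by have [y xy] := exists_nbr x; rewrite (lt_le_trans (cond_gt0 xy))// cond_le_m0.
Qed.

Let glue0 (x : V) (t : R) (y : V) (s : R) : Prop :=
  [/\ x = y, 0 <= t <= 1 & 0 <= s <= 1].

Let glue0_dom x t y s : glue0 x t y s ->
  (setT x /\ 0 <= t <= 1) /\ (setT y /\ 0 <= s <= 1).
Proof. by case. Qed.

(** A vertex is an interval of weight m0 all of whose points are glued, so that
    functions are constant on it. *)
Definition vertex_frame : frame R V :=
  Frame (fun x (_ : setT x) => m0_gt0 x) glue0_dom.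

Local Notation F := vertex_frame.

Lemma vertex_cst (S : Type) (k : V -> R -> S) : glued F k ->
  forall x t, 0 <= t <= 1 -> k x t = k x 0%R.
Proof. by move=> gk x t t01; apply: gk; split=> //; rewrite lexx ler01. Qed.

Lemma vertex_dom x : dom F x 0.
Proof. by split=> //; rewrite lexx ler01. Qed.

Lemma vertex_dom_itv x t : dom F x t -> 0 <= t <= 1.
Proof. by case. Qed.

Lemma vertex_integral (k : V -> R -> \bar R) : glued F k ->
  integral_on F k = (\esum_(x in [set: V]) ((m0 N x)%:E * k x 0%R))%E.
Proof.
move=> gk; apply: eq_esum => x _; congr (_ * _)%E.
transitivity (\int[leb]_(t in U) cst (k x 0%R) t)%E.
  apply: eq_integral => t /set_mem tU /=.
  have t01 : 0 <= t <= 1 by move: tU; rewrite /= in_itv.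
  exact: vertex_cst gk x t t01.
by rewrite integral_cst//= lebesgue_measure_itv/= lte01 oppr0 adde0 mule1.
Qed.

Definition vertex_app (k : V -> R -> \bar R) (x : V) (t : R) : \bar R :=
  ((m0 N x)^-1%:E * \esum_(y in nbrs x) ((c x y)%:E * k y 0%R))%E.

Let im0_ge0 x : 0 <= (m0 N x)^-1.
Proof. by rewrite invr_ge0 ltW// m0_gt0. Qed.

Let term_ge0 k x y : admissible F k -> nbr N x y -> (0 <= (c x y)%:E * k y 0%R)%E.
Proof.
by move=> [k0 _ _] xy; apply: mule_ge0; [exact: cond_ge0|apply/k0/vertex_dom].
Qed.

Let vertex_app_admissible k : admissible F k -> admissible F (vertex_app k).
Proof.
move=> ak; split.
- move=> x t _; apply: mule_ge0; first by rewrite lee_fin.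
  by apply: esum_ge0 => y; exact: term_ge0.
- by move=> x _; exact: measurable_cst.
- by move=> x t y s [-> _ _].
Qed.

Let vertex_app_le k h : admissible F k -> admissible F h ->
  (forall x t, dom F x t -> (k x t <= h x t)%E) ->
  forall x t, dom F x t -> (vertex_app k x t <= vertex_app h x t)%E.
Proof.
move=> _ _ kh x t _; apply: lee_wpmul2l; first by rewrite lee_fin.
apply: le_esum => y xy; apply: lee_wpmul2l; first exact: cond_ge0.
exact/kh/vertex_dom.
Qed.

Let vertex_appD k h : admissible F k -> admissible F h ->
  forall x t, dom F x t ->
  vertex_app (fun x t => k x t + h x t)%E x t = (vertex_app k x t + vertex_app h x t)%E.
Proof.
move=> ak ah x t _; rewrite /vertex_app -ge0_muleDr; last 2 first.
- by apply: esum_ge0 => y; exact: term_ge0.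
- by apply: esum_ge0 => y; exact: term_ge0.
rewrite -esumD; [|by move=> y; exact: term_ge0..].
congr (_ * _)%E; apply: eq_esum => y xy; have [k0 _ _] := ak; have [h0 _ _] := ah.
by rewrite ge0_muleDr ?k0 ?h0//; exact: vertex_dom.
Qed.

Let vertex_appZ (a : R) k : 0 <= a -> admissible F k ->
  forall x t, dom F x t ->
  vertex_app (fun x t => a%:E * k x t)%E x t = (a%:E * vertex_app k x t)%E.
Proof.
move=> a0 ak x t _; rewrite /vertex_app muleCA; congr (_ * _)%E.
rewrite -esumZl//; last by move=> y; exact: term_ge0.
by apply: eq_esum => y _; rewrite muleCA.
Qed.

(* The form is the sum of c(xy) k(x) h(y) over oriented edges, the factor m0 of
   the measure cancelling that of P; its symmetry is that of c. *)
Let vertex_app_form k h : admissible F k -> admissible F h ->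
  integral_on F (fun x t => k x t * vertex_app h x t)%E =
  (\esum_(x in [set: V]) \esum_(y in nbrs x) ((c x y)%:E * (k x 0%R * h y 0%R)))%E.
Proof.
move=> ak ah; have aTh := vertex_app_admissible ah.
rewrite vertex_integral; last by have [_ _ g] := admissibleM ak aTh.
apply: eq_esum => x _; have [k0 _ _] := ak; have [h0 _ _] := ah.
rewrite /vertex_app muleCA [X in (_ * X)%E]muleA -EFinM mulfV ?gt_eqF ?m0_gt0//.
rewrite mul1e -ge0_esumZl ?k0//; last 2 first.
- exact: vertex_dom.
- by move=> y; exact: term_ge0.
by apply: eq_esum => y _; rewrite muleCA.
Qed.

Let vertex_app_sym k h : admissible F k -> admissible F h ->
  integral_on F (fun x t => k x t * vertex_app h x t)%E =
  integral_on F (fun x t => vertex_app k x t * h x t)%E.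
Proof.
move=> ak ah; rewrite vertex_app_form//.
under [RHS]eq_integral_on do rewrite muleC.
rewrite vertex_app_form// (@swap_esum _ _ _ _ _ [set: V] (fun y => nbrs y)).
- apply: eq_esum => x _; apply: eq_esum => y xy.
  by rewrite (cond_sym xy) [(k y 0%R * _)%E]muleC.
- by move=> x y; split => -[_]; rewrite /= nbr_sym.
- move=> x y _ xy; apply: mule_ge0; first exact: cond_ge0.
  have [k0 _ _] := ak; have [h0 _ _] := ah.
  by apply: mule_ge0; [apply/k0/vertex_dom|apply/h0/vertex_dom].
Qed.

Let vertex_app_cst1 x t : dom F x t -> (vertex_app (fun _ _ => 1%E) x t <= 1)%E.
Proof.
move=> _; rewrite /vertex_app; under eq_esum do rewrite mule1.
by rewrite m0E -EFinM mulVf ?gt_eqF ?m0_gt0.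
Qed.

(* Each c(xy) = c(yx) is at most m0(y). *)
Let vertex_app_bound x t : dom F x t -> exists C : R, 0 <= C /\
  forall k, admissible F k -> (vertex_app k x t <= C%:E * integral_on F k)%E.
Proof.
move=> _; exists ((m0 N x)^-1); split=> // k ak; have [k0 _ gk] := ak.
apply: lee_wpmul2l; first by rewrite lee_fin.
rewrite vertex_integral//.
apply: (@le_trans _ _ (\esum_(y in nbrs x) ((m0 N y)%:E * k y 0%R))%E).
  apply: le_esum => y xy; apply: lee_wpmul2r; first exact/k0/vertex_dom.
  by rewrite lee_fin (cond_sym xy) cond_le_m0// nbr_sym.
rewrite esum_mkcond; apply: le_esum => y _; case: ifP => // _.
by apply: mule_ge0; [rewrite lee_fin ltW// m0_gt0|apply/k0/vertex_dom].
Qed.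

Definition vertex_markov : markov vertex_frame :=
  Markov vertex_app_admissible vertex_app_le vertex_appD vertex_appZ
    vertex_app_sym vertex_app_cst1 vertex_app_bound.

Local Notation T := (act vertex_markov).

Definition vre (g : vertex_fun R V) : V -> R -> R := fun x _ => complex.Re (g x).
Definition vim (g : vertex_fun R V) : V -> R -> R := fun x _ => complex.Im (g x).

Let rmeasurable_vertex (u : V -> R) : rmeasurable F (fun x _ => u x).
Proof. by split=> [x _|x t y s [->]]; first exact: measurable_cst. Qed.

Lemma sqn_vertex (u : V -> R) :
  sqn F (fun x _ => u x) = (\esum_(x in [set: V]) (u x ^+ 2 * m0 N x)%:E)%E.
Proof.
rewrite sqnE vertex_integral; last by move=> x t y s [->].
by apply: eq_esum => x _; rewrite -EFinM mulrC.
Qed.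

Let m0_ge0 x : 0 <= m0 N x.
Proof. exact/ltW/m0_gt0. Qed.

Let cabs_sqr (z : R[i]) : cabs z ^+ 2 = complex.Re z ^+ 2 + complex.Im z ^+ 2.
Proof. by rewrite sqr_sqrtr// addr_ge0 ?sqr_ge0. Qed.

Lemma normsq0E g : normsq0 N g = (sqn F (vre g) + sqn F (vim g))%E.
Proof.
rewrite !sqn_vertex -esumD; first by apply: eq_esum => x _;
  rewrite -EFinD -mulrDl cabs_sqr.
- by move=> x _; rewrite lee_fin mulr_ge0// sqr_ge0.
- by move=> x _; rewrite lee_fin mulr_ge0// sqr_ge0.
Qed.

Lemma ell2P g : ell2 N g <-> L2real F (vre g) /\ L2real F (vim g).
Proof.
rewrite /ell2 /= normsq0E; split.
  move=> h; split; split; try exact: rmeasurable_vertex.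
    by apply: le_lt_trans h; rewrite leeDl// sqn_ge0.
  by apply: le_lt_trans h; rewrite leeDr// sqn_ge0.
by move=> [[_ h1] [_ h2]]; exact: lte_add_pinfty.
Qed.

Lemma norm0E g : ell2 N g ->
  norm0 N g = Num.sqrt (l2norm F (vre g) ^+ 2 + l2norm F (vim g) ^+ 2).
Proof.
move=> /ell2P[L1 L2]; rewrite /norm0 normsq0E.
by rewrite (sqn_l2norm L1) (sqn_l2norm L2).
Qed.

Lemma vre_lin (a : R[i]) (f g : vertex_fun R V) x t : vre (a *: f + g) x t =
  complex.Re a * vre f x t - complex.Im a * vim f x t + vre g x t.
Proof.
rewrite /vre /vim (_ : (a *: f + g) x = a * f x + g x)//.
by case: a (f x) (g x) => [a1 a2] [b1 b2] [c1 c2].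
Qed.

Lemma vim_lin (a : R[i]) (f g : vertex_fun R V) x t : vim (a *: f + g) x t =
  complex.Re a * vim f x t + complex.Im a * vre f x t + vim g x t.
Proof.
rewrite /vre /vim (_ : (a *: f + g) x = a * f x + g x)//.
by case: a (f x) (g x) => [a1 a2] [b1 b2] [c1 c2] /=; ring.
Qed.

Lemma vertex_pairing u v : glued F u -> glued F v ->
  exists f : vertex_fun R V, forall x t, dom F x t ->
    vre f x t = u x t /\ vim f x t = v x t.
Proof.
move=> gu gv; exists (fun x => Complex (u x 0%R) (v x 0%R)) => x t /vertex_dom_itv t01.
by rewrite /vre /vim /= (vertex_cst gu x t01) (vertex_cst gv x t01).
Qed.

Let vertex_act (u : V -> R) x t : L2real F (fun x _ => u x) ->
  T (fun x _ => u x) x t = (m0 N x)^-1 * rsum (nbrs x) (fun y => c x y * u y).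
Proof.
move=> Lu.
have im_gt0 : 0 < (m0 N x)^-1 by rewrite invr_gt0 m0_gt0.
have fin v : L2real F v -> positive F v ->
    (\esum_(y in nbrs x) ((c x y)%:E * (v y 0%R)%:E))%E \is a fin_num.
  move=> Lv v0; apply: (pmule_fin_num im_gt0).
  exact: (app_fin vertex_markov Lv v0 (vertex_dom x)).
have pos0 (v : V -> R -> R) : positive F (fun x t => Num.max (v x t) 0).
  by move=> y s _; rewrite le_max lexx orbT.
have f1 := fin _ (L2_pos Lu) (pos0 _).
have f2 := fin _ (L2_pos (L2realN Lu)) (pos0 _).
rewrite (rsum_sub (p := fun y => ((c x y)%:E * (Num.max (u y) 0)%:E)%E)
  (q := fun y => ((c x y)%:E * (Num.max (- u y) 0)%:E)%E) _ _ f1 f2).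
- by rewrite mulrBr act_def /= /vertex_app /pos_part /neg_part !fineM.
- by move=> y xy; apply: mule_ge0; [exact: cond_ge0|rewrite lee_fin le_max lexx orbT].
- by move=> y xy; apply: mule_ge0; [exact: cond_ge0|rewrite lee_fin le_max lexx orbT].
- move=> y xy; rewrite -!EFinM /= -mulrBr; congr (_ * _).
  by case: (leP (u y) 0) => ?; case: (leP (- u y) 0) => ?; lra.
Qed.

Lemma vre_transition f : ell2 N f -> forall x t, dom F x t ->
  vre (transition N f) x t = T (vre f) x t.
Proof.
move=> /ell2P[L1 _] x t _; rewrite (vertex_act (u := fun x => complex.Re (f x)))//.
rewrite /vre /transition /= mul0r subr0; congr (_ * _); congr rsum.
by apply/funext => y; case: (f y) => a b /=; rewrite mul0r subr0.
Qed.

Lemma vim_transition f : ell2 N f -> forall x t, dom F x t ->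
  vim (transition N f) x t = T (vim f) x t.
Proof.
move=> /ell2P[_ L2] x t _; rewrite (vertex_act (u := fun x => complex.Im (f x)))//.
rewrite /vim /transition /= mul0r addr0; congr (_ * _); congr rsum.
by apply/funext => y; case: (f y) => a b /=; rewrite mul0r addr0.
Qed.

End Network.

(** * The averaging operator *)

Section Skeleton.
Context {R : realType} {V : countType} (N : network R V).
Local Notation nbrs x := [set y | nbr N x y].
Local Notation c := (cond N).
Local Notation U := (`[0%R, 1%R]%classic : set (measurableTypeR R)).
Implicit Types (x y : V) (k h : V * V -> R -> \bar R).

Let edges : set (V * V) := [set p | nbr N p.1 p.2].

Let half_cond_gt0 (p : V * V) : edges p -> 0 < c p.1 p.2 / 2.
Proof. by move=> pE; rewrite divr_gt0// cond_gt0. Qed.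

Let glue1 (p : V * V) (t : R) (q : V * V) (s : R) : Prop :=
  ((edges p /\ 0 <= t <= 1) /\ (edges q /\ 0 <= s <= 1)) /\
  ((q = (p.2, p.1) /\ s = 1 - t) \/ [/\ q.1 = p.1, t = 0 & s = 0]).

Let glue1_dom p t q s : glue1 p t q s ->
  (edges p /\ 0 <= t <= 1) /\ (edges q /\ 0 <= s <= 1).
Proof. by case. Qed.

(** The intervals are the oriented edges.  Each edge occurs twice, whence the
    half conductances; points are glued by reversal of the orientation and at a
    common origin. *)
Definition skeleton_frame : frame R (V * V)%type := Frame half_cond_gt0 glue1_dom.

Local Notation F := skeleton_frame.

Let edge_ge0 k x y t : admissible F k -> nbr N x y -> U t -> (0 <= k (x, y) t)%E.
Proof. by move=> [k0 _ _] xy tU; apply/k0/itv_dom. Qed.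

Let edge_meas k x y : admissible F k -> nbr N x y -> measurable_fun U (k (x, y)).
Proof. by move=> [_ mk _] xy; exact: mk. Qed.

Let sub_itv (t : R) : 0 <= t <= 1 -> `[0%R, t]%classic `<=` U.
Proof. by move=> t01 s /=; rewrite !in_itv/=; lra. Qed.

Let edge_meas_sub k x y t : admissible F k -> nbr N x y -> 0 <= t <= 1 ->
  measurable_fun (`[0%R, t]%classic : set (measurableTypeR R)) (k (x, y)).
Proof.
move=> ak xy t01; apply: measurable_funS (edge_meas ak xy) => //.
exact: sub_itv.
Qed.

Let edge_ge0_sub k x y t : admissible F k -> nbr N x y -> 0 <= t <= 1 ->
  forall s, `[0%R, t]%classic s -> (0 <= k (x, y) s)%E.
Proof. by move=> ak xy t01 s /(sub_itv t01); exact: edge_ge0. Qed.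

Let prim k x y (t : R) : \bar R := (\int[leb]_(s in `[0%R, t]) k (x, y) s)%E.

Let prim_ge0 k x y t : admissible F k -> nbr N x y -> 0 <= t <= 1 ->
  (0 <= prim k x y t)%E.
Proof. by move=> ak xy t01; apply: integral_ge0; exact: edge_ge0_sub. Qed.

(** Both terms of A F (xy,t) have this form: one is the star of x at 1 - t, the
    other the star of y at t. *)
Definition star_average k x (t : R) : \bar R :=
  ((m0 N x)^-1%:E *
   \esum_(u in nbrs x) ((c x u)%:E * \int[leb]_(s in `[0%R, t]) k (x, u) s))%E.

Local Notation star := star_average.

Definition skeleton_app k (p : V * V) (t : R) : \bar R :=
  (star k p.1 (1 - t)%R + star k p.2 t)%E.

Let im0_ge0 x : 0 <= (m0 N x)^-1.
Proof. by rewrite invr_ge0 ltW// m0_gt0. Qed.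

Let im0_ge0' x : (0 <= ((m0 N x)^-1)%:E)%E.
Proof. by rewrite lee_fin. Qed.

Let term_ge0 k x u t : admissible F k -> nbr N x u -> 0 <= t <= 1 ->
  (0 <= (c x u)%:E * prim k x u t)%E.
Proof. by move=> *; apply: mule_ge0; [exact: cond_ge0|exact: prim_ge0]. Qed.

Lemma star_ge0 k x t : admissible F k -> 0 <= t <= 1 -> (0 <= star k x t)%E.
Proof.
by move=> ak t01; apply: mule_ge0 => //; apply: esum_ge0 => u xu; exact: term_ge0.
Qed.

Let star_meas k x : admissible F k -> measurable_fun U (star k x).
Proof.
move=> ak; apply: emeasurable_funM; first exact: measurable_cst.
apply: measurable_esum => // [u xu|u t xu tU].
  apply: emeasurable_funM; first exact: measurable_cst.
  apply: measurable_integral; first exact: edge_meas.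
  by move=> t tU; exact: edge_ge0.
by apply: term_ge0 => //; move: tU; rewrite /= in_itv.
Qed.

Lemma star0 k x : star k x 0 = 0%E.
Proof.
rewrite /star_average esum1 ?mule0// => u _.
by rewrite set_itv1 integral_set1 mule0.
Qed.

Let U01 (t : R) : U t -> 0 <= t <= 1.
Proof. by rewrite /= in_itv. Qed.

Let skeleton_app_admissible k : admissible F k -> admissible F (skeleton_app k).
Proof.
move=> ak; split.
- move=> p t [_ t01]; apply: adde_ge0; apply: star_ge0 => //; exact: onem_itv.
- move=> p _; apply: emeasurable_funD; last exact: star_meas.
  by apply: (@measurable_fun_onem _ (star k p.1)); exact: star_meas.
- move=> [x y] t q s [_ [[-> ->]|[/= qx -> ->]]]; rewrite /skeleton_app /=.
    by rewrite addeC (_ : 1 - (1 - t) = t)//; lra.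
  by rewrite qx !star0.
Qed.

Let star_le k h x t : admissible F k -> admissible F h ->
  (forall p t, dom F p t -> (k p t <= h p t)%E) -> 0 <= t <= 1 ->
  (star k x t <= star h x t)%E.
Proof.
move=> ak ah kh t01; apply: lee_wpmul2l => //; apply: le_esum => u xu.
apply: lee_wpmul2l; first exact: cond_ge0.
apply: ge0_le_integral => //.
- exact: edge_ge0_sub.
- exact: edge_meas_sub.
- exact: edge_meas_sub.
- by move=> s /(sub_itv t01) sU; apply: kh; exact: itv_dom.
Qed.

Let skeleton_app_le k h : admissible F k -> admissible F h ->
  (forall p t, dom F p t -> (k p t <= h p t)%E) ->
  forall p t, dom F p t -> (skeleton_app k p t <= skeleton_app h p t)%E.
Proof.
move=> ak ah kh p t [_ t01]; apply: leeD; apply: star_le => //; exact: onem_itv.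
Qed.

Let starD k h x t : admissible F k -> admissible F h -> 0 <= t <= 1 ->
  star (fun p t => k p t + h p t)%E x t = (star k x t + star h x t)%E.
Proof.
move=> ak ah t01; rewrite /star_average -ge0_muleDr; last 2 first.
- by apply: esum_ge0 => u xu; exact: term_ge0.
- by apply: esum_ge0 => u xu; exact: term_ge0.
rewrite -esumD; [|by move=> u xu; exact: term_ge0..].
congr (_ * _)%E; apply: eq_esum => u xu.
rewrite -ge0_muleDr; [|exact: prim_ge0..]; congr (_ * _)%E.
by apply: ge0_integralD => //;
  [exact: edge_ge0_sub|exact: edge_meas_sub|exact: edge_ge0_sub|exact: edge_meas_sub].
Qed.

Let skeleton_appD k h : admissible F k -> admissible F h ->
  forall p t, dom F p t ->
  skeleton_app (fun p t => k p t + h p t)%E p t =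
  (skeleton_app k p t + skeleton_app h p t)%E.
Proof.
move=> ak ah p t [_ t01]; rewrite /skeleton_app !starD//; last exact: onem_itv.
by rewrite addeACA.
Qed.

Let starZ (a : R) k x t : 0 <= a -> admissible F k -> 0 <= t <= 1 ->
  star (fun p t => a%:E * k p t)%E x t = (a%:E * star k x t)%E.
Proof.
move=> a0 ak t01; rewrite /star_average muleCA; congr (_ * _)%E.
rewrite -esumZl//; last by move=> u xu; exact: term_ge0.
apply: eq_esum => u xu; rewrite muleCA; congr (_ * _)%E.
by apply: ge0_integralZl => //; [exact: edge_meas_sub|exact: edge_ge0_sub].
Qed.

Let skeleton_appZ (a : R) k : 0 <= a -> admissible F k ->
  forall p t, dom F p t ->
  skeleton_app (fun p t => a%:E * k p t)%E p t = (a%:E * skeleton_app k p t)%E.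
Proof.
move=> a0 ak p t [_ t01]; rewrite /skeleton_app !starZ//; last exact: onem_itv.
by rewrite ge0_muleDr//; apply: star_ge0 => //; exact: onem_itv.
Qed.

Let star_cst1 x t : 0 <= t <= 1 -> star (fun _ _ => 1%E) x t = t%:E.
Proof.
move=> /andP[t0 _]; rewrite /star_average.
transitivity ((m0 N x)^-1%:E * \esum_(u in nbrs x) (t%:E * (c x u)%:E))%E.
  congr (_ * _)%E; apply: eq_esum => u _; rewrite muleC; congr (_ * _)%E.
  rewrite integral_cst//= lebesgue_measure_itv/= lte_fin mul1e.
  by case: ltgtP t0 => // [_|<-] _; rewrite ?oppr0 ?adde0.
rewrite esumZl//; last by move=> u; exact: cond_ge0.
by rewrite m0E -!EFinM mulrCA mulVf ?mulr1// gt_eqF// m0_gt0.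
Qed.

Let skeleton_app_cst1 p t : dom F p t -> (skeleton_app (fun _ _ => 1%E) p t <= 1)%E.
Proof.
move=> [_ t01]; rewrite /skeleton_app !star_cst1//; last exact: onem_itv.
by rewrite -EFinD subrK.
Qed.

Lemma skeleton_integral k :
  (forall p t, dom F p t -> 0 <= k p t)%E ->
  integral_on F k = ((2^-1)%:E * \esum_(x in [set: V]) \esum_(y in nbrs x)
    ((c x y)%:E * \int[leb]_(t in U) k (x, y) t))%E.
Proof.
move=> k0; have t0 x y : nbr N x y -> (0 <= (c x y)%:E * \int[leb]_(t in U) k (x, y) t)%E.
  move=> xy; apply: mule_ge0; first exact: cond_ge0.
  by apply: integral_ge0 => t tU; apply/k0/itv_dom.
rewrite esum_esum; last by move=> x y _ xy; exact: t0.
rewrite -esumZl//; last by move=> [x y] [_ xy]; exact: t0.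
rewrite (_ : [set: V] `*`` _ = edges); last first.
  by apply/seteqP; split=> -[x y] //= [].
by apply: eq_esum => -[x y] _ /=; rewrite mulrC EFinM muleA.
Qed.

Let star_bound k x t : admissible F k -> 0 <= t <= 1 ->
  (star k x t <= ((m0 N x)^-1 * 2)%:E * integral_on F k)%E.
Proof.
move=> ak t01; have [k0 _ _] := ak.
rewrite EFinM skeleton_integral// -muleA; apply: lee_wpmul2l => //.
rewrite muleA -EFinM mulfV// mul1e.
apply: (@le_trans _ _ (\esum_(u in nbrs x) ((c x u)%:E * \int[leb]_(t in U) k (x, u) t))%E).
  apply: le_esum => u xu; apply: lee_wpmul2l; first exact: cond_ge0.
  apply: ge0_subset_integral => //; [exact: edge_meas|by move=> s; exact: edge_ge0|].
  exact: sub_itv.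
apply: esum_ge; exists [set x]; first by split.
by rewrite fsbig_set1.
Qed.

Let skeleton_app_bound p t : dom F p t -> exists C : R, 0 <= C /\
  forall k, admissible F k -> (skeleton_app k p t <= C%:E * integral_on F k)%E.
Proof.
move=> [_ t01]; exists ((m0 N p.1)^-1 * 2 + (m0 N p.2)^-1 * 2).
split=> [|k ak]; first by rewrite addr_ge0// mulr_ge0.
rewrite EFinD ge0_muleDl ?lee_fin ?mulr_ge0//.
by apply: leeD; apply: star_bound => //; exact: onem_itv.
Qed.

(* The part of the bilinear form that comes from the star of the origin of each
   oriented edge.  Reversing the edges shows that the stars of the ends
   contribute the same: the two parts, each with half conductances, add up to
   this one with full conductances. *)
Let half_form k h : \bar R := (\esum_(x in [set: V]) \esum_(y in nbrs x)
  ((c x y)%:E * \int[leb]_(t in U) (k (x, y) t * star h x (1 - t)%R)))%E.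

Let star_onem_meas h x : admissible F h -> measurable_fun U (fun t => star h x (1 - t)).
Proof. by move=> ah; apply: measurable_fun_onem; exact: star_meas. Qed.

Let star_onem_ge0 h x t : admissible F h -> U t -> (0 <= star h x (1 - t)%R)%E.
Proof. by move=> ah /U01 t01; apply: star_ge0 => //; exact: onem_itv. Qed.

Let half_formE k h : admissible F k -> admissible F h ->
  half_form k h = (\esum_(x in [set: V]) \esum_(y in nbrs x) \esum_(u in nbrs x)
   (((m0 N x)^-1%:E * ((c x y)%:E * (c x u)%:E)) *
    \int[leb]_(t in U) (k (x, y) t * \int[leb]_(s in `[0%R, (1 - t)%R]) h (x, u) s)))%E.
Proof.
move=> ak ah; apply: eq_esum => x _; apply: eq_esum => y xy.
have prim_m u : nbr N x u -> measurable_fun U (fun t => prim h x u (1 - t)).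
  move=> xu; apply: measurable_integral_onem; first exact: edge_meas.
  by move=> t; exact: edge_ge0.
have prim_0 u t : nbr N x u -> U t -> (0 <= prim h x u (1 - t)%R)%E.
  by move=> xu /U01 t01; apply: prim_ge0 => //; exact: onem_itv.
have kp_m u : nbr N x u ->
    measurable_fun U (fun t => k (x, y) t * prim h x u (1 - t)%R)%E.
  by move=> xu; apply: emeasurable_funM; [exact: edge_meas|exact: prim_m].
have kp_0 u t : nbr N x u -> U t -> (0 <= k (x, y) t * prim h x u (1 - t)%R)%E.
  by move=> xu tU; apply: mule_ge0; [exact: edge_ge0|exact: prim_0].
transitivity ((c x y)%:E * \int[leb]_(t in U) \esum_(u in nbrs x)
   (((m0 N x)^-1%:E * (c x u)%:E) * (k (x, y) t * prim h x u (1 - t)%R)))%E.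
  congr (_ * _)%E; apply: eq_integral => t /set_mem tU.
  rewrite /star_average -ge0_esumZl//; last first.
    by move=> u xu; apply: mule_ge0; [exact: cond_ge0|exact: prim_0].
  rewrite -ge0_esumZl; last 2 first.
  - exact: edge_ge0.
  - move=> u xu; apply: mule_ge0 => //.
    by apply: mule_ge0; [exact: cond_ge0|exact: prim_0].
  by apply: eq_esum => u xu; rewrite [RHS]muleCA; congr (_ * _)%E;
    rewrite muleA.
rewrite integral_esum//; last 2 first.
- by move=> u xu; apply: emeasurable_funM; [exact: measurable_cst|exact: kp_m].
- move=> u t xu tU; apply: mule_ge0; last exact: kp_0.
  by apply: mule_ge0 => //; exact: cond_ge0.
rewrite -esumZl; last 2 first.
- by rewrite ltW// cond_gt0.
- move=> u xu; apply: integral_ge0 => t tU; apply: mule_ge0; last exact: kp_0.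
  by apply: mule_ge0 => //; exact: cond_ge0.
apply: eq_esum => u xu; rewrite ge0_integralZl//.
- by rewrite !muleA; congr (_ * _ * _)%E; rewrite muleC.
- exact: kp_m.
- by move=> t; exact: kp_0.
- by apply: mule_ge0 => //; exact: cond_ge0.
Qed.

(* Exchanging two edges at x exchanges the two sides of [triangle]. *)
Let half_form_sym k h : admissible F k -> admissible F h ->
  half_form k h = half_form h k.
Proof.
move=> ak ah; rewrite (half_formE ak ah) (half_formE ah ak); apply: eq_esum => x _.
apply: (etrans (@swap_esum _ _ _ (nbrs x) (fun=> nbrs x) (nbrs x)
  (fun=> nbrs x) _ _ _)); last first.
- apply: eq_esum => u xu; apply: eq_esum => y xy.
  rewrite [(_%:E * (c x y)%:E)%E]muleC; congr (_ * _)%E; apply: triangle.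
  + exact: edge_meas.
  + by move=> t; exact: edge_ge0.
  + exact: edge_meas.
  + by move=> t; exact: edge_ge0.
- move=> y u xy xu; apply: mule_ge0.
    by apply: mule_ge0 => //; apply: mule_ge0; exact: cond_ge0.
  apply: integral_ge0 => t tU; apply: mule_ge0; first exact: edge_ge0.
  by apply: prim_ge0 => //; apply: onem_itv; exact: U01.
- by move=> y u; split=> -[].
Qed.

Let edge_flip k x y t : admissible F k -> nbr N x y -> U t ->
  k (y, x) (1 - t) = k (x, y) t.
Proof.
move=> [_ _ gk] xy /U01 t01; apply/esym/gk; split; last by left.
by split; split=> //; [rewrite /edges /= nbr_sym|exact: onem_itv].
Qed.

Let skeleton_form k h : admissible F k -> admissible F h ->
  integral_on F (fun p t => k p t * skeleton_app h p t)%E = half_form k h.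
Proof.
move=> ak ah; have aTh := skeleton_app_admissible ah.
have [kTh0 _ _] := admissibleM ak aTh.
rewrite skeleton_integral//.
have ks x y : nbr N x y -> forall t, U t -> (0 <= k (x, y) t * star h x (1 - t)%R)%E.
  by move=> xy t tU; apply: mule_ge0; [exact: edge_ge0|exact: star_onem_ge0].
have ks' x y : nbr N x y -> forall t, U t -> (0 <= k (x, y) t * star h y t)%E.
  by move=> xy t tU; apply: mule_ge0; [exact: edge_ge0|apply: star_ge0 => //; exact: U01].
have ms x y : nbr N x y -> measurable_fun U (fun t => k (x, y) t * star h x (1 - t)%R)%E.
  by move=> xy; apply: emeasurable_funM; [exact: edge_meas|exact: star_onem_meas].
have ms' x y : nbr N x y -> measurable_fun U (fun t => k (x, y) t * star h y t)%E.
  by move=> xy; apply: emeasurable_funM; [exact: edge_meas|exact: star_meas].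
have i0 x y : nbr N x y ->
    (0 <= (c x y)%:E * \int[leb]_(t in U) (k (x, y) t * star h x (1 - t)%R))%E.
  move=> xy; apply: mule_ge0; first exact: cond_ge0.
  by apply: integral_ge0; exact: ks.
have i0' x y : nbr N x y ->
    (0 <= (c x y)%:E * \int[leb]_(t in U) (k (x, y) t * star h y t))%E.
  move=> xy; apply: mule_ge0; first exact: cond_ge0.
  by apply: integral_ge0; exact: ks'.
transitivity ((2^-1)%:E * (half_form k h + \esum_(x in [set: V]) \esum_(y in nbrs x)
    ((c x y)%:E * \int[leb]_(t in U) (k (x, y) t * star h y t))))%E.
  congr (_ * _)%E; rewrite /half_form -esumD; last 2 first.
  - by move=> x _; apply: esum_ge0 => y; exact: i0.
  - by move=> x _; apply: esum_ge0 => y; exact: i0'.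
  apply: eq_esum => x _; rewrite -esumD; [|by move=> y; exact: i0|by move=> y; exact: i0'].
  apply: eq_esum => y xy; rewrite -ge0_muleDr; last 2 first.
  - by apply: integral_ge0; exact: ks.
  - by apply: integral_ge0; exact: ks'.
  congr (_ * _)%E; rewrite -ge0_integralD//.
  - apply: eq_integral => t /set_mem tU; rewrite /skeleton_app /= ge0_muleDr//.
    + exact: star_onem_ge0.
    + by apply: star_ge0 => //; exact: U01.
  - exact: ks.
  - exact: ms.
  - exact: ks'.
  - exact: ms'.
rewrite (@swap_esum _ _ _ _ _ [set: V] (fun y => nbrs y)); last 2 first.
- by move=> x y; split => -[_]; rewrite /= nbr_sym.
- by move=> x y _; exact: i0'.
rewrite (_ : \esum_(y in _) _ = half_form k h); last first.
  apply: eq_esum => y _; apply: eq_esum => x yx.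
  have xy : nbr N x y by rewrite nbr_sym.
  rewrite -(cond_sym yx); apply: (f_equal (mule (c y x)%:E)).
  apply: (etrans _ (integral_onem (ms y x yx) (ks y x yx))).
  apply: eq_integral => t /set_mem tU /=; rewrite (edge_flip ak xy tU).
  by rewrite (_ : 1 - (1 - t) = t)%R//; lra.
have : (0 <= half_form k h)%E by apply: esum_ge0 => x _; apply: esum_ge0 => y; exact: i0.
case: (half_form k h) => [r| |] // _; last by rewrite addye// gt0_muley// lte_fin.
by rewrite -EFinD -EFinM; congr EFin; lra.
Qed.

Let skeleton_app_sym k h : admissible F k -> admissible F h ->
  integral_on F (fun p t => k p t * skeleton_app h p t)%E =
  integral_on F (fun p t => skeleton_app k p t * h p t)%E.
Proof.
move=> ak ah; under [RHS]eq_integral_on do rewrite muleC.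
rewrite (skeleton_form ak ah) (skeleton_form ah ak); exact: half_form_sym.
Qed.

Definition skeleton_markov : markov skeleton_frame :=
  Markov skeleton_app_admissible skeleton_app_le skeleton_appD skeleton_appZ
    skeleton_app_sym skeleton_app_cst1 skeleton_app_bound.

Local Notation T := (act skeleton_markov).

Definition sre (f : skel_fun R V) : V * V -> R -> R :=
  fun p t => complex.Re (f p.1 p.2 t).
Definition sim (f : skel_fun R V) : V * V -> R -> R :=
  fun p t => complex.Im (f p.1 p.2 t).

Let eqC (z w : R[i]) : complex.Re z = complex.Re w -> complex.Im z = complex.Im w ->
  z = w.
Proof. by case: z w => [a b] [a' b'] /= -> ->. Qed.

Lemma on_skeletonP f : on_skeleton N f <-> glued F (sre f) /\ glued F (sim f).
Proof.
split=> [[f1 f2]|[gr gi]].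
  have E p t q s : glue F p t q s -> f p.1 p.2 t = f q.1 q.2 s.
    case: p q => [x y] [x' y'] [[[/= xy t01] [/= xy' _]] [[[-> ->] ->]|[/= e -> ->]]].
      exact: f1.
    by subst x'; exact: f2.
  by split=> p t q s g; rewrite /sre /sim (E _ _ _ _ g).
split=> [x y t xy t01|x y z xy xz].
  have g : glue F (x, y) t (y, x) (1 - t).
    split; last by left.
    by split; split=> //; [rewrite /edges /= nbr_sym|exact: onem_itv].
  by apply: eqC; [exact: (gr _ _ _ _ g)|exact: (gi _ _ _ _ g)].
have g : glue F (x, y) 0 (x, z) 0.
  split; last by right.
  by split; split; rewrite ?lexx ?ler01.
by apply: eqC; [exact: (gr _ _ _ _ g)|exact: (gi _ _ _ _ g)].
Qed.

Lemma skeleton_rmeasurableP f : on_skeleton N f /\ measurable_skeleton N f <->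
  rmeasurable F (sre f) /\ rmeasurable F (sim f).
Proof.
split=> [[/on_skeletonP[gr gi] m]|[[mr gr] [mi gi]]].
  by split; split=> // -[x y] xy; have [] := m x y xy.
split; first exact/on_skeletonP.
by move=> x y xy; split; [exact: mr (x, y) xy|exact: mi (x, y) xy].
Qed.

Let cabs_sqr (z : R[i]) : cabs z ^+ 2 = complex.Re z ^+ 2 + complex.Im z ^+ 2.
Proof. by rewrite sqr_sqrtr// addr_ge0 ?sqr_ge0. Qed.

Lemma normsq1E f : rmeasurable F (sre f) -> rmeasurable F (sim f) ->
  normsq1 N f = (sqn F (sre f) + sqn F (sim f))%E.
Proof.
move=> mr mi; rewrite !sqnE -integral_onD; [|exact: admissible_sqr..].
rewrite skeleton_integral; last first.
  by move=> p t _; rewrite -EFinD lee_fin addr_ge0 ?sqr_ge0.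
congr (_ * _)%E; apply: eq_esum => x _; apply: eq_esum => y _; congr (_ * _)%E.
by apply: eq_integral => t _; rewrite cabs_sqr EFinD.
Qed.

Lemma L2P f : L2 N f <-> L2real F (sre f) /\ L2real F (sim f).
Proof.
split=> [[sk m fin]|[[mr fr] [mi fi]]].
  have [mr mi] := (skeleton_rmeasurableP f).1 (conj sk m).
  rewrite normsq1E// in fin; split; split=> //.
    by apply: le_lt_trans fin; rewrite leeDl// sqn_ge0.
  by apply: le_lt_trans fin; rewrite leeDr// sqn_ge0.
have [sk m] := (skeleton_rmeasurableP f).2 (conj mr mi).
by split=> //; rewrite normsq1E//; exact: lte_add_pinfty.
Qed.

Lemma norm1E f : L2 N f ->
  norm1 N f = Num.sqrt (l2norm F (sre f) ^+ 2 + l2norm F (sim f) ^+ 2).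
Proof.
move=> /L2P[L1 L2]; have [m1 _] := L1; have [m2 _] := L2.
by rewrite /norm1 normsq1E// (sqn_l2norm L1) (sqn_l2norm L2).
Qed.

Lemma sre_lin (a : R[i]) (f g : skel_fun R V) p t : sre (a *: f + g) p t =
  complex.Re a * sre f p t - complex.Im a * sim f p t + sre g p t.
Proof.
rewrite /sre /sim (_ : (a *: f + g) p.1 p.2 t = a * f p.1 p.2 t + g p.1 p.2 t)//.
by case: a (f p.1 p.2 t) (g p.1 p.2 t) => [a1 a2] [b1 b2] [c1 c2].
Qed.

Lemma sim_lin (a : R[i]) (f g : skel_fun R V) p t : sim (a *: f + g) p t =
  complex.Re a * sim f p t + complex.Im a * sre f p t + sim g p t.
Proof.
rewrite /sre /sim (_ : (a *: f + g) p.1 p.2 t = a * f p.1 p.2 t + g p.1 p.2 t)//.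
by case: a (f p.1 p.2 t) (g p.1 p.2 t) => [a1 a2] [b1 b2] [c1 c2] /=; ring.
Qed.

Lemma skeleton_pairing u v : glued F u -> glued F v ->
  exists f : skel_fun R V, forall p t, dom F p t ->
    sre f p t = u p t /\ sim f p t = v p t.
Proof.
move=> _ _; exists (fun x y t => Complex (u (x, y) t) (v (x, y) t)) => -[x y] t _.
by [].
Qed.

Let star_act (u : V * V -> R -> R) x t : L2real F u -> 0 <= t <= 1 ->
  [/\ star (pos_part u) x t \is a fin_num, star (neg_part u) x t \is a fin_num &
  (m0 N x)^-1 * rsum (nbrs x) (fun y => c x y * \int[leb]_(s in `[0, t]) u (x, y) s) =
  fine (star (pos_part u) x t) - fine (star (neg_part u) x t)].
Proof.
move=> Lu t01; have [z xz] := exists_nbr N x.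
have im_gt0 : 0 < (m0 N x)^-1 by rewrite invr_gt0 m0_gt0.
have [mu _] := Lu.
have ap := admissible_pos mu; have an := admissible_neg mu.
have pos0 (v : V * V -> R -> R) : positive F (fun p t => Num.max (v p t) 0).
  by move=> p s _; rewrite le_max lexx orbT.
have fin v : L2real F v -> positive F v -> admissible F (fun p t => (v p t)%:E) ->
    star (fun p t => (v p t)%:E) x t \is a fin_num.
  move=> Lv v0 av.
  have d : dom F (x, z) (1 - t) by split=> //; exact: onem_itv.
  have := app_fin skeleton_markov Lv v0 d; rewrite /= /skeleton_app /=.
  rewrite ge0_fin_numE; last first.
    by apply: adde_ge0; apply: star_ge0 => //; do ?apply: onem_itv.
  rewrite (_ : 1 - (1 - t) = t); last by lra.
  move=> h; rewrite ge0_fin_numE ?star_ge0//; apply: le_lt_trans h.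
  by rewrite leeDl// star_ge0//; exact: onem_itv.
have fp := fin _ (L2_pos Lu) (pos0 _) ap.
have fn := fin _ (L2_pos (L2realN Lu)) (pos0 _) an.
split=> //.
have fp' := pmule_fin_num im_gt0 fp; have fn' := pmule_fin_num im_gt0 fn.
rewrite (rsum_sub _ _ fp' fn').
- by rewrite mulrBr /star_average !fineM.
- by move=> y xy; exact: (term_ge0 ap xy t01).
- by move=> y xy; exact: (term_ge0 an xy t01).
- move=> y xy.
  have fin1 k : admissible F k ->
      (\esum_(u in nbrs x) ((c x u)%:E * prim k x u t))%E \is a fin_num ->
      prim k x y t \is a fin_num.
    move=> ak sfin; apply: (pmule_fin_num (cond_gt0 xy)).
    rewrite ge0_fin_numE; last exact: term_ge0.
    apply: (@le_lt_trans _ _ (\esum_(u in nbrs x) ((c x u)%:E * prim k x u t))%E).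
      apply: esum_ge; exists [set y]; first by split=> // ? ->.
      by rewrite fsbig_set1.
    by rewrite -ge0_fin_numE//; apply: esum_ge0 => w xw; exact: term_ge0.
  have p1 := fin1 _ ap fp'; have p2 := fin1 _ an fn'.
  rewrite !fineM// -mulrBr; congr (_ * _).
  rewrite /Rintegral integralE -fineB//; congr fine; congr (_ - _)%E.
    rewrite /prim.
    by apply: eq_integral => s _; rewrite funeposE /= /pos_part EFin_max.
  by apply: eq_integral => s _; rewrite funenegE /= /neg_part EFin_max EFinN.
Qed.

Let skeleton_act u x y t : L2real F u -> dom F (x, y) t ->
  T u (x, y) t =
  (m0 N x)^-1 * rsum (nbrs x) (fun v => c x v * \int[leb]_(s in `[0, 1 - t]) u (x, v) s) +
  (m0 N y)^-1 * rsum (nbrs y) (fun v => c y v * \int[leb]_(s in `[0, t]) u (y, v) s).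
Proof.
move=> Lu [_ t01]; have [f1 f2 ->] := star_act x Lu (onem_itv t01).
have [f3 f4 ->] := star_act y Lu t01.
by rewrite act_def /= /skeleton_app /= !fineD//; ring.
Qed.

Let ReM (a : R) (z : R[i]) : complex.Re (a%:C%C * z) = a * complex.Re z.
Proof. by case: z => x y /=; rewrite mul0r subr0. Qed.

Let ImM (a : R) (z : R[i]) : complex.Im (a%:C%C * z) = a * complex.Im z.
Proof. by case: z => x y /=; rewrite mul0r addr0. Qed.

Let ReD (z w : R[i]) : complex.Re (z + w) = complex.Re z + complex.Re w.
Proof. by case: z w => [a b] [a' b']. Qed.

Let ImD (z w : R[i]) : complex.Im (z + w) = complex.Im z + complex.Im w.
Proof. by case: z w => [a b] [a' b']. Qed.

Lemma sre_averaging f : L2 N f -> forall p t, dom F p t ->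
  sre (averaging N f) p t = T (sre f) p t.
Proof.
move=> /L2P[L1 _] [x y] t d; rewrite skeleton_act// /sre /averaging ReD !ReM.
by congr (_ * _ + _ * _); apply: (f_equal (rsum _)); apply/funext => v; rewrite ReM.
Qed.

Lemma sim_averaging f : L2 N f -> forall p t, dom F p t ->
  sim (averaging N f) p t = T (sim f) p t.
Proof.
move=> /L2P[_ L2] [x y] t d; rewrite skeleton_act// /sim /averaging ImD !ImM.
by congr (_ * _ + _ * _); apply: (f_equal (rsum _)); apply/funext => v; rewrite ImM.
Qed.

End Skeleton.

(** * Interpolation along the edges *)

Section Interpolation.
Context {R : realType} {V : countType} (N : network R V).
Local Notation nbrs x := [set y | nbr N x y].
Local Notation c := (cond N).
Local Notation U := (`[0%R, 1%R]%classic : set (measurableTypeR R)).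
Local Notation F0 := (vertex_frame N).
Local Notation F1 := (skeleton_frame N).
Implicit Types (b phi : R -> R) (g h : V -> R).

(** The condition b 0 = 0 of the lemmas below makes the value at a vertex x,
    g x * b 1, the same on all edges at x. *)
Definition interpolate b g : V * V -> R -> R :=
  fun p t => g p.1 * b (1 - t) + g p.2 * b t.

Lemma measurable_onem_comp b : measurable_fun U b ->
  measurable_fun U (fun t => b (1 - t)).
Proof.
move=> mb; have UU : [set (1 - t)%R | t in U] `<=` U.
  by move=> _ [t + <-]; rewrite /= !in_itv/=; exact: onem_itv.
by apply: measurable_comp UU mb (@measurable_onem _ U); exact: measurable_itv.
Qed.

Lemma interpolate_rmeasurable b g : measurable_fun U b -> b 0 = 0 ->
  rmeasurable F1 (interpolate b g).
Proof.
move=> mb b0; split.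
  move=> p _; apply: measurable_funD; apply: measurable_funM;
    [exact: measurable_cst|exact: measurable_onem_comp|exact: measurable_cst|exact: mb].
move=> [x y] t q s [_ [[-> ->]|[/= qx -> ->]]]; rewrite /interpolate /=.
  by rewrite addrC (_ : 1 - (1 - t) = t)//; lra.
by rewrite qx b0 !mulr0.
Qed.

Lemma esum_cond_fst (a : V -> R) : (forall x, 0 <= a x) ->
  (\esum_(x in [set: V]) \esum_(y in nbrs x) ((c x y)%:E * (a x)%:E) =
   \esum_(x in [set: V]) (a x * m0 N x)%:E)%E.
Proof.
move=> a0; apply: eq_esum => x _; rewrite EFinM -m0E -esumZl//; last first.
  by move=> y; exact: cond_ge0.
by apply: eq_esum => y _; rewrite muleC.
Qed.

Lemma esum_cond_snd (a : V -> R) : (forall x, 0 <= a x) ->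
  (\esum_(x in [set: V]) \esum_(y in nbrs x) ((c x y)%:E * (a y)%:E) =
   \esum_(x in [set: V]) (a x * m0 N x)%:E)%E.
Proof.
move=> a0; rewrite -esum_cond_fst// (@swap_esum _ _ _ _ _ [set: V] (fun y => nbrs y)).
- by apply: eq_esum => y _; apply: eq_esum => x yx; rewrite (cond_sym yx).
- by move=> x y; split => -[_]; rewrite /= nbr_sym.
- by move=> x y _ xy; apply: mule_ge0; rewrite ?lee_fin//; exact: cond_ge0.
Qed.

(** Each vertex value enters with the total conductance of its edges, which is
    m0, so the two norms are comparable.  The constant is not optimal; it is a
    square so that the bound passes to norms. *)
Lemma sqn_interpolate_le b g (C : R) : measurable_fun U b -> b 0 = 0 ->
  (forall t, 0 <= t <= 1 -> `|b t| <= C) ->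
  (sqn F1 (interpolate b g) <= ((2 * C) ^+ 2)%:E * sqn F0 (fun x _ => g x))%E.
Proof.
move=> mb b0 bC; have mi := interpolate_rmeasurable g mb b0.
have C0 : 0 <= C by apply: le_trans (bC 0 _); rewrite ?normr_ge0 ?lexx ?ler01.
have sq0 (x : R) : 0 <= x ^+ 2 by exact: sqr_ge0.
rewrite sqnE skeleton_integral; last by move=> p t _; rewrite lee_fin.
apply: (@le_trans _ _ ((2^-1)%:E * \esum_(x in [set: V]) \esum_(y in nbrs x)
   ((2 * C ^+ 2)%:E * ((c x y)%:E * (g x ^+ 2)%:E + (c x y)%:E * (g y ^+ 2)%:E)))%E).
  apply: lee_wpmul2l; first by rewrite lee_fin.
  apply: le_esum => x _; apply: le_esum => y xy.
  rewrite -muleDr// muleCA; apply: lee_wpmul2l; first exact: cond_ge0.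
  apply: (@le_trans _ _ (\int[leb]_(t in U)
      (cst ((2 * C ^+ 2) * (g x ^+ 2 + g y ^+ 2))%:E t))%E).
    apply: ge0_le_integral => //.
    - by move=> t _; rewrite lee_fin.
    - apply/measurable_EFinP; apply: measurable_funX.
      exact: (mi.1 (x, y) xy).
    - move=> t tU; rewrite lee_fin /interpolate /=.
      have t01 : 0 <= t <= 1 by move: tU; rewrite /= in_itv.
      have h1 := bC _ (onem_itv t01); have h2 := bC _ t01.
      have s1 : b (1 - t) ^+ 2 <= C ^+ 2.
        by rewrite -real_normK ?num_real// ler_pXn2r ?nnegrE.
      have s2 : b t ^+ 2 <= C ^+ 2.
        by rewrite -real_normK ?num_real// ler_pXn2r ?nnegrE.
      have p3 (m n : R) : (m + n) ^+ 2 <= 2 * m ^+ 2 + 2 * n ^+ 2.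
        rewrite -subr_ge0 (_ : _ - _ = (m - n) ^+ 2) ?sqr_ge0//; ring.
      apply: (le_trans (p3 _ _)).
      rewrite (_ : 2 * C ^+ 2 * _ = 2 * (g x ^+ 2 * C ^+ 2) + 2 * (g y ^+ 2 * C ^+ 2));
        last by ring.
      by rewrite !exprMn lerD// ler_wpM2l// ler_wpM2l.
  rewrite integral_cst//= lebesgue_measure_itv/= lte01 oppr0 adde0 mule1.
  by rewrite -EFinD -EFinM.
have t0 x y (a : V -> R) z : nbr N x y -> (0 <= (c x y)%:E * (a z ^+ 2)%:E)%E.
  by move=> xy; apply: mule_ge0; [exact: cond_ge0|rewrite lee_fin].
have E : (\esum_(x in [set: V]) \esum_(y in nbrs x)
   ((2 * C ^+ 2)%:E * ((c x y)%:E * (g x ^+ 2)%:E + (c x y)%:E * (g y ^+ 2)%:E)) =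
   (2 * C ^+ 2)%:E * (sqn F0 (fun x _ => g x) + sqn F0 (fun x _ => g x)))%E.
  rewrite sqn_vertex -[X in (_ * (X + _))%E]esum_cond_fst//.
  rewrite -[X in (_ * (_ + X))%E]esum_cond_snd// -esumD; last 2 first.
  - by move=> x _; apply: esum_ge0 => y; exact: t0.
  - by move=> x _; apply: esum_ge0 => y; exact: t0.
  rewrite -esumZl ?mulr_ge0//; last first.
    by move=> x _; apply: adde_ge0; apply: esum_ge0 => y; exact: t0.
  apply: eq_esum => x _; rewrite -esumD; [|by move=> y; exact: t0..].
  rewrite -esumZl ?mulr_ge0// => y xy; apply: adde_ge0; exact: t0.
rewrite E muleA -EFinM; have : (0 <= sqn F0 (fun x _ => g x))%E by exact: sqn_ge0.
case: (sqn F0 _) => [s| |] // s0; last first.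
  rewrite addye//.
  have [->|Cn0] := eqVneq C 0; first by rewrite expr0n /= !mulr0 expr0n !mul0e.
  have Cp : 0 < C by rewrite lt_neqAle eq_sym Cn0.
  by rewrite !gt0_muley ?lte_fin ?mulr_gt0 ?exprn_gt0 ?invr_gt0.
rewrite -EFinD -!EFinM lee_fin; rewrite lee_fin in s0.
rewrite [leLHS](_ : _ = 2 * (C ^+ 2 * s)); last by field.
rewrite [leRHS](_ : _ = 4 * (C ^+ 2 * s)); last by ring.
by rewrite ler_wpM2r ?mulr_ge0// ler_nat.
Qed.

(** All terms being nonnegative, the contribution of the end of each oriented
    edge may be dropped. *)
Lemma sqn_interpolate_ge b g (D : R) : measurable_fun U b -> b 0 = 0 ->
  (forall t, 0 <= t <= 1 -> 0 <= b t) -> (forall x, 0 <= g x) -> 0 <= D ->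
  (D%:E <= \int[leb]_(t in U) (b (1 - t) ^+ 2)%:E)%E ->
  ((2^-1 * D)%:E * sqn F0 (fun x _ => g x) <= sqn F1 (interpolate b g))%E.
Proof.
move=> mb b0 bp gp D0 HD; have mi := interpolate_rmeasurable g mb b0.
have sq0 (x : R) : 0 <= x ^+ 2 by exact: sqr_ge0.
have mb1 := measurable_onem_comp mb.
have mb2 : measurable_fun U (fun t => (b (1 - t) ^+ 2)%:E).
  by apply/measurable_EFinP; exact: measurable_funX.
have t0 x y (a : V -> R) z : nbr N x y -> (0 <= (c x y)%:E * (a z ^+ 2)%:E)%E.
  by move=> xy; apply: mule_ge0; [exact: cond_ge0|rewrite lee_fin].
rewrite sqn_vertex -esum_cond_fst// EFinM -muleA.
rewrite [sqn F1 _]sqnE skeleton_integral; last by move=> p t _; rewrite lee_fin.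
apply: lee_wpmul2l; first by rewrite lee_fin.
rewrite -esumZl//; last by move=> x _; apply: esum_ge0 => y; exact: t0.
apply: le_esum => x _; rewrite -esumZl//; last by move=> y; exact: t0.
apply: le_esum => y xy; rewrite muleCA; apply: lee_wpmul2l; first exact: cond_ge0.
apply: (@le_trans _ _ ((g x ^+ 2)%:E * \int[leb]_(t in U) (b (1 - t) ^+ 2)%:E)%E).
  by rewrite muleC; apply: lee_wpmul2l => //; rewrite lee_fin.
rewrite -ge0_integralZl ?lee_fin//; last by move=> t _; rewrite lee_fin.
apply: ge0_le_integral => //.
- by move=> t _; rewrite -EFinM lee_fin mulr_ge0.
- by apply: emeasurable_funM => //; exact: measurable_cst.
- by apply/measurable_EFinP; apply: measurable_funX; exact: (mi.1 (x, y) xy).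
- move=> t tU; rewrite -EFinM lee_fin -exprMn /interpolate /=.
  have t01 : 0 <= t <= 1 by move: tU; rewrite /= in_itv.
  have p1 : 0 <= g x * b (1 - t) by rewrite mulr_ge0// bp// onem_itv.
  have p2 : 0 <= g y * b t by rewrite mulr_ge0// bp.
  by rewrite ler_pXn2r ?nnegrE ?addr_ge0// lerDl.
Qed.

End Interpolation.

(** * Profiles *)

(** The functions whose interpolations turn the equation P g = r g into
    A F = l F: sin (w t) for r = cos w and l = sin w / w, and t for r = l = 1. *)
Record profile (R : realType) (r l : R) := Profile {
  prof :> R -> R;
  prof0 : prof 0 = 0;
  prof_gt0 : forall t, 0 < t <= 1 -> 0 < prof t;
  prof_derive : forall t : R,
    is_derive t (1 : R) prof ((prof (1 - t) + r * prof t) / l) }.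

Section Profile.
Context {R : realType} (r l : R) (phi : profile r l).
Hypothesis r0 : 0 <= r.
Hypothesis l0 : 0 < l.
Local Notation U := (`[0%R, 1%R]%classic : set (measurableTypeR R)).

Lemma profile_continuous (t : R) : {for t, continuous phi}.
Proof.
have h := prof_derive phi t.
by apply/differentiable_continuous; apply/derivable1_diffP; case: h.
Qed.

Lemma profile_measurable (D : set (measurableTypeR R)) : measurable_fun D phi.
Proof.
apply: measurable_funTS; apply: continuous_measurable_fun => t.
exact: profile_continuous.
Qed.

Lemma profile_onem_measurable (D : set (measurableTypeR R)) :
  measurable_fun D (fun t => phi (1 - t)).
Proof.
apply: measurable_funTS; apply: (measurableT_comp (f := phi)).
  exact: profile_measurable.
exact: measurable_onem.
Qed.

Lemma profile_ge0 t : 0 <= t <= 1 -> 0 <= phi t.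
Proof.
move=> /andP[]; rewrite le_eqVlt => /predU1P[<- _|t0 t1]; first by rewrite prof0.
by apply/ltW/prof_gt0; rewrite t0.
Qed.

Lemma profile_bounded : exists C : R, forall t, 0 <= t <= 1 -> `|phi t| <= C.
Proof.
have [|c _ hc] := @EVT_max R phi 0 1 ler01.
  by apply: continuous_subspaceT => t; exact: profile_continuous.
exists (phi c) => t t01; rewrite ger0_norm ?profile_ge0//.
by apply: hc; rewrite in_itv.
Qed.

Definition int_onem (t : R) : \bar R := (\int[leb]_(s in `[0%R, t]) (phi (1 - s)%R)%:E)%E.
Definition int_profile (t : R) : \bar R := (\int[leb]_(s in `[0%R, t]) (phi s)%:E)%E.
Local Notation A := int_onem.
Local Notation B := int_profile.

Let sub01 (t s : R) : 0 <= t <= 1 -> `[0%R, t]%classic s -> 0 <= s <= 1.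
Proof. by rewrite /= in_itv/=; lra. Qed.

Lemma int_onem_ge0 t : 0 <= t <= 1 -> (0 <= A t)%E.
Proof.
move=> t01; apply: integral_ge0 => s /(sub01 t01) s01.
by rewrite lee_fin profile_ge0// onem_itv.
Qed.

Lemma int_profile_ge0 t : 0 <= t <= 1 -> (0 <= B t)%E.
Proof.
by move=> t01; apply: integral_ge0 => s /(sub01 t01) s01; rewrite lee_fin profile_ge0.
Qed.

(** The integrated form of the equation of [phi]: the left side is the value of
    the averaging operator on an interpolated eigenfunction, at the star of a
    vertex where that eigenfunction is 1. *)
Lemma profile_integral t : 0 <= t <= 1 -> (A t + r%:E * B t = (l * phi t)%:E)%E.
Proof.
move=> t01; have /andP[] := t01; rewrite le_eqVlt => /predU1P[<- _|t0 t1].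
  by rewrite /A /B set_itv1 !integral_set1 prof0 !mulr0 mule0 adde0.
rewrite /B -ge0_integralZl ?lee_fin//; last 2 first.
- by apply/measurable_EFinP; exact: profile_measurable.
- by move=> s /(sub01 t01) s01; rewrite lee_fin profile_ge0.
rewrite /A -ge0_integralD//; last 4 first.
- by move=> s /(sub01 t01) s01; rewrite lee_fin profile_ge0// onem_itv.
- by apply/measurable_EFinP; exact: profile_onem_measurable.
- by move=> s /(sub01 t01) s01; rewrite -EFinM lee_fin mulr_ge0// profile_ge0.
- by apply: emeasurable_funM; [exact: measurable_cst|
    apply/measurable_EFinP; exact: profile_measurable].
transitivity (\int[leb]_(s in `[0%R, t]) (phi (1 - s) + r * phi s)%:E)%E.
  by apply: eq_integral => s _; rewrite EFinD EFinM.
have cF (s : R) : {for s, continuous (fun s => l * phi s)}.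
  by apply: cvgMr; exact: profile_continuous.
have dF (s : R) : is_derive s (1 : R) (fun s => l * phi s) (phi (1 - s) + r * phi s).
  have h := prof_derive phi s.
  apply: (is_derive_eq (is_deriveM (is_derive_cst l s 1) h)).
  by rewrite /GRing.scale /= mulr0 addr0 mulrCA mulfV ?mulr1// gt_eqF.
rewrite (@continuous_FTC2 _ _ (fun s => l * phi s)) //.
- by rewrite prof0 mulr0 sube0.
- apply: continuous_subspaceT => s.
  have c1 : {for s, continuous (fun s : R => 1 - s)}.
    by apply: cvgB; [exact: cvg_cst|exact: cvg_id].
  have c2 : {for s, continuous (phi \o (fun s : R => 1 - s))}.
    exact: (continuous_comp c1 (@profile_continuous (1 - s))).
  have c3 : {for s, continuous (fun s : R => r * phi s)}.
    by apply: cvgMr; exact: profile_continuous.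
  exact: (cvgD c2 c3).
- split.
  + by move=> s _; have [] := dF s.
  + by apply: cvg_at_right_filter; exact: cF.
  + by apply: cvg_at_left_filter; exact: cF.
- by move=> s _; rewrite derive1E; have [_ ->] := dF s.
Qed.

Let A1B1 : A 1 = B 1.
Proof.
apply: (@integral_onem R (fun s => (phi s)%:E)).
  by apply/measurable_EFinP; exact: profile_measurable.
by move=> t tU; rewrite lee_fin profile_ge0//; move: tU; rewrite /= in_itv.
Qed.

Let one01 : 0 <= (1 : R) <= 1.
Proof. by rewrite ler01 lexx. Qed.

(* The two integrals agree at 1, so [profile_integral] gives their value. *)
Let A1 : A 1 = (l * phi 1 / (1 + r))%:E.
Proof.
have := profile_integral one01; rewrite -A1B1.
have := int_onem_ge0 one01; case: (A 1) => [a| |] // a0.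
  rewrite -EFinM -EFinD => -[e]; congr EFin; rewrite -e; field.
  by rewrite gt_eqF// ltr_pwDl.
have : (0 <= r%:E * +oo)%E by apply: mule_ge0; rewrite ?lee_fin ?leey.
by case: (r%:E * +oo)%E.
Qed.

Lemma int_profile_le t : 0 <= t <= 1 -> (B t <= (l * phi 1 / (1 + r))%:E)%E.
Proof.
move=> t01; rewrite -A1 A1B1; apply: ge0_subset_integral => //.
- by apply/measurable_EFinP; exact: profile_measurable.
- by move=> s /(sub01 one01) s01; rewrite lee_fin profile_ge0.
- by move=> s /=; rewrite !in_itv/=; lra.
Qed.

Definition primitive (t : R) : R := fine (B t).

Lemma int_profileE t : 0 <= t <= 1 -> B t = (primitive t)%:E.
Proof.
move=> t01; rewrite /primitive fineK// ge0_fin_numE ?int_profile_ge0//.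
exact: le_lt_trans (int_profile_le t01) (ltry _).
Qed.

Lemma int_onemE t : 0 <= t <= 1 -> A t = (l * phi t - r * primitive t)%:E.
Proof.
move=> t01; have := profile_integral t01; rewrite int_profileE//.
have := int_onem_ge0 t01; case: (A t) => [a| |] // _.
by rewrite -EFinM -EFinD => -[<-]; congr EFin; rewrite addrK.
Qed.

Lemma primitive0 : primitive 0 = 0.
Proof. by rewrite /primitive /B set_itv1 integral_set1. Qed.

Lemma primitive_bounded t : 0 <= t <= 1 -> `|primitive t| <= l * phi 1 / (1 + r).
Proof.
move=> t01; have := int_profile_le t01; have := int_profile_ge0 t01.
by rewrite int_profileE// !lee_fin => h1 h2; rewrite ger0_norm.
Qed.

Lemma primitive_measurable : measurable_fun U primitive.
Proof.
apply: (measurableT_comp (fine_measurable measurableT)).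
apply: (@measurable_integral R (fun s => (phi s)%:E)).
  by apply/measurable_EFinP; exact: profile_measurable.
by move=> t tU; rewrite lee_fin profile_ge0//; move: tU; rewrite /= in_itv.
Qed.

(** With a the mean of [phi], the inequality 2 a phi <= phi^2 + a^2 integrates
    to a lower bound a^2. *)
Lemma profile_square_integral : exists2 D : R, 0 < D &
  (D%:E <= \int[leb]_(t in U) (phi (1 - t) ^+ 2)%:E)%E.
Proof.
set a := l * phi 1 / (1 + r); have a0 : 0 < a.
  by rewrite divr_gt0 ?mulr_gt0 ?ltr_pwDl//; apply: prof_gt0; rewrite ltr01 lexx.
exists (a ^+ 2); first by rewrite exprn_gt0.
have mp : measurable_fun U (fun t => (phi (1 - t))%:E).
  by apply/measurable_EFinP; exact: profile_onem_measurable.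
have mp2 : measurable_fun U (fun t => (phi (1 - t) ^+ 2)%:E).
  by apply/measurable_EFinP; apply: measurable_funX; exact: profile_onem_measurable.
have p0 t : U t -> 0 <= phi (1 - t).
  by move=> tU; rewrite profile_ge0//; apply: onem_itv; move: tU; rewrite /= in_itv.
have : (\int[leb]_(t in U) ((2 * a)%:E * (phi (1 - t))%:E) <=
    \int[leb]_(t in U) ((phi (1 - t) ^+ 2)%:E + cst (a ^+ 2)%:E t))%E.
  apply: ge0_le_integral => //.
  - move=> t tU; rewrite -EFinM lee_fin.
    by apply: mulr_ge0; [rewrite mulr_ge0// ltW|exact: p0].
  - by apply: emeasurable_funM => //; exact: measurable_cst.
  - by apply: emeasurable_funD.
  - move=> t tU; rewrite -EFinM -EFinD lee_fin -subr_ge0.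
    by rewrite (_ : _ - _ = (phi (1 - t) - a) ^+ 2) ?sqr_ge0//; ring.
have -> : (\int[leb]_(t in U) ((2 * a)%:E * (phi (1 - t))%:E) =
    (2 * a)%:E * A 1)%E.
  have a20 : (0 <= (2 * a)%:E)%E by rewrite lee_fin mulr_ge0// ltW.
  by apply: ge0_integralZl => // t tU; rewrite lee_fin p0.
rewrite ge0_integralD//; [|by move=> t _; rewrite lee_fin sqr_ge0..].
rewrite integral_cst//= lebesgue_measure_itv/= lte01 oppr0 adde0 mule1 A1 -/a.
case: (\int[leb]_(t in U) _)%E => [d| |]; rewrite ?leey// -EFinM.
by rewrite -EFinD !lee_fin; lra.
Qed.

End Profile.

(** * From the vertices to the one-skeleton *)

Section SkeletonNorm.
Context {R : realType} {V : countType} (N : network R V).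
Variables (r l : R) (phi : profile r l).
Hypothesis r0 : 0 <= r.
Hypothesis l0 : 0 < l.
Local Notation nbrs x := [set y | nbr N x y].
Local Notation c := (cond N).
Local Notation F0 := (vertex_frame N).
Local Notation F1 := (skeleton_frame N).
Local Notation P := (act (vertex_markov N)).
Local Notation A := (act (skeleton_markov N)).
Implicit Types (g h : V -> R).

Let phi_meas := profile_measurable phi.

Let interp_meas g : rmeasurable F1 (interpolate phi g).
Proof. by apply: interpolate_rmeasurable; [exact: phi_meas|exact: prof0]. Qed.

Lemma interpolate_ge0 g : (forall x, 0 <= g x) -> positive F1 (interpolate phi g).
Proof.
move=> g0 p t [_ t01]; rewrite addr_ge0// mulr_ge0// profile_ge0//.
exact: onem_itv.
Qed.

Let sub01 (t s : R) : 0 <= t <= 1 -> `[0%R, t]%classic s -> 0 <= s <= 1.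
Proof. by rewrite /= in_itv/=; lra. Qed.

(** On the edge from x to u the integrand is g x phi(1 - s) + g u phi(s), and
    the weights c(xu) / m0(x) sum to 1. *)
Lemma star_interpolate g x t : (forall x, 0 <= g x) -> 0 <= t <= 1 ->
  star_average N (fun p t => (interpolate phi g p t)%:E) x t =
  ((g x)%:E * int_onem phi t +
   vertex_app N (fun x _ => (g x)%:E) x 0%R * int_profile phi t)%E.
Proof.
move=> g0 t01.
have a0 := int_onem_ge0 phi t01; have b0 := int_profile_ge0 phi t01.
have ga0 y : (0 <= (g y)%:E)%E by rewrite lee_fin.
have E u : nbr N x u -> (\int[leb]_(s in `[0%R, t]) (interpolate phi g (x, u) s)%:E =
    (g x)%:E * int_onem phi t + (g u)%:E * int_profile phi t)%E.
  move=> xu; rewrite -ge0_integralZl//; last 2 first.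
  - by apply/measurable_EFinP; exact: profile_onem_measurable.
  - by move=> s /(sub01 t01) s01; rewrite lee_fin profile_ge0// onem_itv.
  rewrite -ge0_integralZl//; last 2 first.
  - by apply/measurable_EFinP; exact: phi_meas.
  - by move=> s /(sub01 t01) s01; rewrite lee_fin profile_ge0.
  rewrite -ge0_integralD//.
  - by move=> s /(sub01 t01) s01; rewrite -EFinM lee_fin mulr_ge0// profile_ge0// onem_itv.
  - apply: emeasurable_funM; first exact: measurable_cst.
    by apply/measurable_EFinP; exact: profile_onem_measurable.
  - by move=> s /(sub01 t01) s01; rewrite -EFinM lee_fin mulr_ge0// profile_ge0.
  - apply: emeasurable_funM; first exact: measurable_cst.
    by apply/measurable_EFinP; exact: phi_meas.
have c0 u : nbr N x u -> (0 <= (c x u)%:E)%E by exact: cond_ge0.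
rewrite /star_average (eq_esum (b := fun u => ((g x)%:E * int_onem phi t) * (c x u)%:E +
   int_profile phi t * ((c x u)%:E * (g u)%:E)))%E; last first.
  move=> u xu; rewrite E// ge0_muleDr ?mule_ge0//; congr (_ + _)%E.
    by rewrite muleC.
  by rewrite muleA muleC.
rewrite esumD; last 2 first.
- by move=> u xu; rewrite !mule_ge0// c0.
- by move=> u xu; rewrite !mule_ge0// c0.
rewrite !ge0_esumZl//; last 2 first.
- by move=> u xu; rewrite mule_ge0// c0.
- by rewrite mule_ge0.
have s0 : (0 <= \esum_(i in nbrs x) ((c x i)%:E * (g i)%:E))%E.
  by apply: esum_ge0 => u xu; rewrite mule_ge0// c0.
rewrite ge0_muleDr; last 2 first.
- by rewrite m0E !mule_ge0// lee_fin ltW// m0_gt0.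
- by rewrite mule_ge0.
congr (_ + _)%E; last by rewrite /vertex_app muleCA muleC.
by rewrite m0E muleCA -EFinM mulVf ?mule1// gt_eqF// m0_gt0.
Qed.

(** The interpolation F of h satisfies A F <= l F, by [star_interpolate] and
    [profile_integral], and it is positive even at the vertices, since t and
    1 - t do not vanish together.  The Schur test applies with F as weight. *)
Lemma superharmonic_op_bound h : (forall x, 0 < h x) ->
  (forall x, vertex_app N (fun x _ => (h x)%:E) x 0%R <= (r * h x)%:E)%E ->
  op_bound (skeleton_markov N) l.
Proof.
move=> hp hr; have h0 x : 0 <= h x by exact: ltW.
have star_le x t : 0 <= t <= 1 ->
    (star_average N (fun p t => (interpolate phi h p t)%:E) x t <=
     (l * (h x * phi t))%:E)%E.
  move=> t01; rewrite star_interpolate//.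
  have a0 := int_onem_ge0 phi t01; have b0 := int_profile_ge0 phi t01.
  apply: (@le_trans _ _ ((h x)%:E * int_onem phi t +
      (r * h x)%:E * int_profile phi t)%E).
    by rewrite leeD2l// lee_wpmul2r.
  rewrite mulrC EFinM -muleA -ge0_muleDr//; last first.
    by rewrite mule_ge0// lee_fin.
  by rewrite profile_integral// -EFinM mulrCA.
apply: (schur_op_bound (interp_meas h) _ l0).
  move=> p t [_ t01]; rewrite /interpolate; have t01' := onem_itv t01.
  have [t0|t0] := ltP 0 t.
    apply: ltr_wpDl; first by rewrite mulr_ge0// profile_ge0.
    by rewrite mulr_gt0// prof_gt0//; lra.
  apply: ltr_wpDr; first by rewrite mulr_ge0// profile_ge0.
  by rewrite mulr_gt0// prof_gt0//; lra.
move=> p t [_ t01] /=; rewrite /skeleton_app.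
apply: (le_trans (leeD (star_le _ _ (onem_itv t01)) (star_le _ _ t01))).
by rewrite -EFinD lee_fin -mulrDr.
Qed.

Let bounded_interpolate g : L2real F0 (fun x _ => g x) ->
  L2real F1 (interpolate phi g).
Proof.
move=> Lg; have [C HC] := profile_bounded phi.
split; first exact: interp_meas.
apply: (@le_lt_trans _ _ (((2 * C) ^+ 2)%:E * sqn F0 (fun x _ => g x))%E).
  by apply: sqn_interpolate_le => //; exact: prof0.
by rewrite (sqn_l2norm Lg) -EFinM ltry.
Qed.

(** The error P g - r g at the vertices is carried to the edges by a bounded
    function, so it stays small. *)
Lemma act_interpolate g : L2real F0 (fun x _ => g x) -> (forall x, 0 <= g x) ->
  forall p t, dom F1 p t ->
  A (interpolate phi g) p t - l * interpolate phi g p t =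
  interpolate (primitive phi) (fun x => P (fun x _ => g x) x 0 - r * g x) p t.
Proof.
move=> Lg g0 [x y] t d; have [_ t01] := d; have t01' := onem_itv t01.
have gp : positive F0 (fun x _ => g x) by move=> z s _; exact: g0.
have LF := bounded_interpolate Lg; have Fp := interpolate_ge0 g0.
have PE z : vertex_app N (fun x _ => (g x)%:E) z 0%R = (P (fun x _ => g x) z 0)%:E.
  rewrite (act_pos (vertex_markov N) Lg gp (vertex_dom N z)) fineK//.
  exact: (app_fin (vertex_markov N) Lg gp (vertex_dom N z)).
have starE z s : 0 <= s <= 1 ->
    star_average N (fun p t => (interpolate phi g p t)%:E) z s =
    (g z * (l * phi s - r * primitive phi s) +
     P (fun x _ => g x) z 0 * primitive phi s)%:E.
  by move=> s01; rewrite star_interpolate// int_onemE// int_profileE// PE.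
rewrite (act_pos (skeleton_markov N) LF Fp d).
have -> : app (skeleton_markov N) (fun p t => (interpolate phi g p t)%:E) (x, y) t =
  (star_average N (fun p t => (interpolate phi g p t)%:E) x (1 - t)%R +
   star_average N (fun p t => (interpolate phi g p t)%:E) y t)%E by [].
rewrite !starE//.
by rewrite /interpolate /=; ring.
Qed.

(** [act_interpolate] keeps residuals small.  The lower bound b of the norms does
    not depend on e, because [phi] has a positive square integral and, g and
    [phi] being nonnegative, nothing cancels. *)
Lemma approximate_interpolate (a : R) : 0 < a ->
  (forall e : R, 0 < e -> exists g : V -> R -> R,
    [/\ L2real F0 g, positive F0 g, a <= l2norm F0 g &
     l2norm F0 (fun x t => P g x t - r * g x t) <= e]) ->
  exists2 b, 0 < b & forall e : R, 0 < e -> exists u, [/\ L2real F1 u, b <= l2norm F1 u &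
    l2norm F1 (fun p t => A u p t - l * u p t) <= e].
Proof.
move=> a0 app; have [D D0 HD] := profile_square_integral phi r0 l0.
have D20 : 0 < 2^-1 * D by rewrite mulr_gt0// invr_gt0.
exists (Num.sqrt (2^-1 * D) * a) => [|e e0]; first by rewrite mulr_gt0// sqrtr_gt0.
set C := l * phi 1 / (1 + r).
have C0 : 0 < C.
  by rewrite divr_gt0 ?mulr_gt0 ?ltr_pwDl//; apply: prof_gt0; rewrite ltr01 lexx.
have e'0 : 0 < e / (2 * C) by rewrite divr_gt0// mulr_gt0.
have [g' [Lg' g'0 ag' ge']] := app _ e'0.
have [[_ glg] _] := Lg'; pose g x := g' x 0.
have gE x t : dom F0 x t -> g' x t = g x.
  by move=> /vertex_dom_itv t01; exact: (vertex_cst glg x t01).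
have Lg : L2real F0 (fun x _ => g x) by apply: eq_L2real Lg' => x t; exact: gE.
have g0 x : 0 <= g x by apply: g'0; exact: vertex_dom.
have PE x t : dom F0 x t -> P g' x t = P (fun x _ => g x) x 0.
  move=> xt; have [[_ gP] _] := L2_act (vertex_markov N) Lg'.
  rewrite (vertex_cst gP x (vertex_dom_itv xt)).
  by rewrite (eq_act (v := fun x _ => g x) _ Lg' gE (vertex_dom N x)).
pose q x := P (fun x _ => g x) x 0 - r * g x.
have qE x t : dom F0 x t -> P g' x t - r * g' x t = q x.
  by move=> xt; rewrite PE// gE.
have Lq : L2real F0 (fun x _ => q x).
  by apply: eq_L2real (L2realB (L2_act _ Lg') (L2realZ r Lg')) => x t; exact: qE.
have LF := bounded_interpolate Lg.
exists (interpolate phi g); split=> //.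
  rewrite -(ler_pXn2r (n := 2)) ?nnegrE ?l2norm_ge0 ?mulr_ge0 ?sqrtr_ge0 ?(ltW a0)//.
  rewrite exprMn sqr_sqrtr ?(ltW D20)//.
  apply: (@le_trans _ _ (2^-1 * D * l2norm F0 (fun x _ => g x) ^+ 2)).
    rewrite ler_wpM2l ?(ltW D20)// ler_pXn2r ?nnegrE ?l2norm_ge0 ?(ltW a0)//.
    by rewrite -(eq_l2norm gE).
  rewrite -lee_fin EFinM -(sqn_l2norm Lg) -(sqn_l2norm LF).
  apply: sqn_interpolate_ge => //; [exact: prof0|exact: profile_ge0|exact: ltW].
rewrite (eq_l2norm (act_interpolate Lg g0)).
apply: sqn_le_l2norm; first exact: ltW.
apply: (@le_trans _ _ (((2 * C) ^+ 2)%:E * sqn F0 (fun x _ => q x))%E).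
  apply: sqn_interpolate_le; [exact: primitive_measurable|exact: primitive0|].
  by move=> t t01; exact: primitive_bounded.
rewrite (sqn_l2norm Lq) -EFinM lee_fin -exprMn.
have c2 : 0 < 2 * C by rewrite mulr_gt0.
have q0 : 0 <= 2 * C * l2norm F0 (fun x _ => q x).
  by apply: mulr_ge0; [exact: ltW|exact: l2norm_ge0].
rewrite ler_pXn2r ?nnegrE ?q0 ?(ltW e0)//.
by rewrite mulrC -ler_pdivlMr// -(eq_l2norm qE).
Qed.

End SkeletonNorm.

(** * The two spectral radii *)

Section Spectra.
Context {R : realType} {V : countType} (N : network R V).
Local Notation F0 := (vertex_frame N).
Local Notation F1 := (skeleton_frame N).
Local Notation P := (act (vertex_markov N)).
Local Notation A := (act (skeleton_markov N)).

Let norm0_ge0 g : 0 <= norm0 N g. Proof. exact: sqrtr_ge0. Qed.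
Let norm1_ge0 g : 0 <= norm1 N g. Proof. exact: sqrtr_ge0. Qed.

Lemma transition_resolvent (K : R) (l : R[i]) :
  op_bound (vertex_markov N) K -> K < cabs l ->
  resolvent_set (ell2 N) (norm0 N) (transition N) l.
Proof.
exact: (op_bound_resolvent (@ell2P _ _ N) (@norm0E _ _ N) norm0_ge0
  (@vre_lin _ _) (@vim_lin _ _) (@vertex_pairing _ _ N)
  (@vre_transition _ _ N) (@vim_transition _ _ N)).
Qed.

Lemma transition_spectrum (l a : R) : 0 < a ->
  (forall e, 0 < e -> exists u, [/\ L2real F0 u, a <= l2norm F0 u &
     l2norm F0 (fun x t => P u x t - l * u x t) <= e]) ->
  spectrum (ell2 N) (norm0 N) (transition N) l%:C%C.
Proof.
exact: (approximate_spectrum (@ell2P _ _ N) (@norm0E _ _ N) norm0_ge0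
  (@vre_lin _ _) (@vim_lin _ _) (@vertex_pairing _ _ N)
  (@vre_transition _ _ N) (@vim_transition _ _ N)).
Qed.

Lemma averaging_resolvent (K : R) (l : R[i]) :
  op_bound (skeleton_markov N) K -> K < cabs l ->
  resolvent_set (L2 N) (norm1 N) (averaging N) l.
Proof.
exact: (op_bound_resolvent (@L2P _ _ N) (@norm1E _ _ N) norm1_ge0
  (@sre_lin _ _) (@sim_lin _ _) (@skeleton_pairing _ _ N)
  (@sre_averaging _ _ N) (@sim_averaging _ _ N)).
Qed.

Lemma averaging_spectrum (l a : R) : 0 < a ->
  (forall e, 0 < e -> exists u, [/\ L2real F1 u, a <= l2norm F1 u &
     l2norm F1 (fun p t => A u p t - l * u p t) <= e]) ->
  spectrum (L2 N) (norm1 N) (averaging N) l%:C%C.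
Proof.
exact: (approximate_spectrum (@L2P _ _ N) (@norm1E _ _ N) norm1_ge0
  (@sre_lin _ _) (@sim_lin _ _) (@skeleton_pairing _ _ N)
  (@sre_averaging _ _ N) (@sim_averaging _ _ N)).
Qed.

Let dirac (o : V) : V -> R -> R := fun x _ => (x == o)%:R.

Let L2_dirac o : L2real F0 (dirac o).
Proof.
split; first by split=> [x _|x t y s [->]//]; exact: measurable_cst.
rewrite (sqn_vertex N (fun x => (x == o)%:R)).
rewrite (esum_mkcond _ (fun x => ((x == o)%:R ^+ 2 * m0 N x)%:E)).
rewrite (eq_esum (b := fun x => if x \in [set o] then (m0 N o)%:E else 0%E)).
  by rewrite -esum_mkcond esum_set1 ?ltry// lee_fin ltW// m0_gt0.
move=> x _; rewrite in_setT; case: (eqVneq x o) => [->|xo].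
  by rewrite mem_set// expr1n mul1r.
by rewrite expr0n /= mul0r memNset//= => xo'; move: xo; rewrite xo' eqxx.
Qed.

(** Every vertex has positive mass, so null functions on the vertices vanish
    identically; on the one-skeleton this fails. *)
Lemma l2norm_vertex0 (u : V -> R) : L2real F0 (fun x _ => u x) ->
  l2norm F0 (fun x _ => u x) = 0 -> forall x, u x = 0.
Proof.
move=> Lu u0 x; have := sqn_l2norm Lu; rewrite u0 expr0n sqn_vertex => s0.
have h0 y : (0 <= (u y ^+ 2 * m0 N y)%:E)%E.
  by rewrite lee_fin mulr_ge0 ?sqr_ge0// ltW// m0_gt0.
have : ((u x ^+ 2 * m0 N x)%:E <= 0)%E.
  rewrite -[leRHS]s0; apply: esum_ge; exists [set x]; first by split.
  by rewrite fsbig_set1.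
rewrite lee_fin pmulr_lle0 ?m0_gt0// => h.
by apply/eqP; rewrite -sqrf_eq0 eq_le h sqr_ge0.
Qed.

Let act_ge_term (u : V -> R) x y : L2real F0 (fun x _ => u x) ->
  (forall x, 0 <= u x) -> nbr N x y ->
  (m0 N x)^-1 * (cond N x y * u y) <= P (fun x _ => u x) x 0.
Proof.
move=> Lu u0 xy; have up : positive F0 (fun x _ => u x) by move=> *; exact: u0.
have d := vertex_dom N x.
rewrite (act_pos (vertex_markov N) Lu up d) -lee_fin fineK; last first.
  exact: (app_fin (vertex_markov N) Lu up d).
rewrite EFinM; apply: lee_wpmul2l; first by rewrite lee_fin invr_ge0 ltW// m0_gt0.
rewrite EFinM; apply: esum_ge; exists [set y]; first by split=> // ? ->.
by rewrite fsbig_set1.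
Qed.

(** If b is a neighbour of a, then P maps the point mass at b to a function that
    is positive at a. *)
Lemma op_norm_transition_gt0 : 0 < op_norm (vertex_markov N).
Proof.
have [a [b ab]] := nbr_edge N.
rewrite lt_neqAle op_norm_ge0 andbT; apply/eqP => L0.
have [_] := op_norm_bound (vertex_markov N); rewrite -L0 => /(_ _ (L2_dirac b))[LP].
rewrite mul0r => n0.
have LP' : L2real F0 (fun x _ => P (dirac b) x 0).
  have [[_ g] _] := LP; apply: (eq_L2real _ LP) => x t xt.
  exact: (vertex_cst g x (vertex_dom_itv xt)).
have z : l2norm F0 (fun x _ => P (dirac b) x 0) = 0.
  apply/eqP; rewrite eq_le l2norm_ge0 andbT; apply: le_trans n0.
  rewrite le_eqVlt; apply/orP; left; apply/eqP; apply: eq_l2norm => x t xt.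
  have [[_ g] _] := LP; exact/esym/(vertex_cst g x (vertex_dom_itv xt)).
have := act_ge_term (u := fun x => (x == b)%:R) (L2_dirac b) (fun x => ler0n _ _) ab.
rewrite (l2norm_vertex0 LP' z) eqxx mulr1 leNgt mulr_gt0 ?invr_gt0 ?m0_gt0//.
exact: cond_gt0.
Qed.

Lemma sup_max (S : set R) x : S x -> (forall y, S y -> y <= x) -> sup S = x.
Proof.
move=> Sx Sle; apply/eqP; rewrite eq_le; apply/andP; split.
  by apply: ge_sup => //; exists x.
by apply: ub_le_sup => //; exists x => y; exact: Sle.
Qed.

(** The norm L is itself in the spectrum, with positive approximate eigenvectors,
    and the spectrum is contained in the disc of radius L. *)
Lemma rhoP_op_norm : rhoP N = op_norm (vertex_markov N).
Proof.
have L0 := op_norm_transition_gt0.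
apply: sup_max.
  exists (op_norm (vertex_markov N))%:C%C; last by rewrite cabs_real ger0_norm// ltW.
  apply: (transition_spectrum (a := op_norm (vertex_markov N) / 2)).
    by rewrite divr_gt0.
  move=> e e0; have [g [Lg _ ag ge]] := approximate_eigenvector L0 e0.
  by exists g; split.
move=> _ [z sz <-]; rewrite leNgt; apply/negP => h; apply: sz.
exact: (transition_resolvent (op_norm_bound _) h).
Qed.

(** The upper bound is asked of every minorant of the operator bounds, that is,
    of their infimum: for rho(P) < 1 the value l is a limit of bounds. *)
Lemma rhoA_eq (l a : R) : 0 <= l -> 0 < a ->
  (forall e, 0 < e -> exists u, [/\ L2real F1 u, a <= l2norm F1 u &
     l2norm F1 (fun p t => A u p t - l * u p t) <= e]) ->
  (forall m, (forall K, op_bound (skeleton_markov N) K -> m <= K) -> m <= l) ->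
  rhoA N = l.
Proof.
move=> l0 a0 app ub; apply: sup_max.
  exists l%:C%C; last by rewrite cabs_real ger0_norm.
  exact: averaging_spectrum app.
move=> _ [z sz <-]; apply: ub => K HK; rewrite leNgt; apply/negP => h; apply: sz.
exact: averaging_resolvent HK h.
Qed.

(** Let u be the resolvent at l applied to the point mass at v0, so that
    l u - P u is that point mass.  Then P u <= l u, and u >= 0 by
    [supersolution_ge0].  If u x = 0 then P u x = 0, so u vanishes at the
    neighbours of x, and by connectedness at v0, which l u - P u = 1 forbids. *)
Lemma superharmonic_exists (l : R) : op_norm (vertex_markov N) < l ->
  exists h : V -> R, (forall x, 0 < h x) /\
    forall x, (vertex_app N (fun x _ => (h x)%:E) x 0%R <= (l * h x)%:E)%E.
Proof.
move=> Ll; have L0 := op_norm_ge0 (vertex_markov N).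
have l0 : 0 < l := le_lt_trans L0 Ll.
have [v0 _] := nbr_edge N.
have norm_lt : op_norm (vertex_markov N) < cabs (l%:C%C) by rewrite cabs_real gtr0_norm.
have [S [[SH _ _] resol _]] := transition_resolvent (op_norm_bound _) norm_lt.
pose g : vertex_fun R V := fun x => ((x == v0)%:R)%:C%C.
have Hg : ell2 N g.
  apply/ell2P; split; first exact: L2_dirac.
  exact: L2real0.
have HS := SH _ Hg; have [Hr Nr] := resol _ Hg.
pose u x := complex.Re (S g x).
have [Lu _] := (ell2P N _).1 HS.
have [Lr Li] := (ell2P N _).1 Hr.
have uE x : l * u x - P (fun x _ => u x) x 0 = (x == v0)%:R.
  have r0 : l2norm F0 (vre (l%:C%C *: S g - transition N (S g) - g)) = 0.
    apply/eqP; rewrite -sqrf_eq0 eq_le sqr_ge0 andbT.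
    have : norm0 N (l%:C%C *: S g - transition N (S g) - g) ^+ 2 = 0.
      by rewrite Nr expr0n.
    rewrite (norm0E Hr) sqr_sqrtr ?addr_ge0 ?sqr_ge0// => <-.
    by rewrite lerDl sqr_ge0.
  have := l2norm_vertex0 Lr r0 x.
  have := vre_transition HS (vertex_dom N x).
  rewrite /vre; set T := transition N (S g); move=> eT.
  rewrite (_ : (l%:C%C *: S g - T - g) x = l%:C%C * S g x - T x - g x)//.
  move=> e; rewrite /u; move: e eT; rewrite /g /u; case: (S g x) (T x) => [s1 s2] [t1 t2] /=.
  by rewrite mul0r subr0 => e et; rewrite -et; lra.
have d x := vertex_dom N x.
have Pu x t : dom F0 x t -> P (fun x _ => u x) x t = P (fun x _ => u x) x 0.
  move=> xt; have [[_ gP] _] := L2_act (vertex_markov N) Lu.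
  exact: (vertex_cst gP x (vertex_dom_itv xt)).
have Pu_le x : P (fun x _ => u x) x 0 <= l * u x.
  by rewrite -subr_ge0 uE ler0n.
have u0 x : 0 <= u x.
  have Pul y t : dom F0 y t -> P (fun x _ => u x) y t <= l * u y.
    by move=> yt; rewrite Pu.
  have n0 := supersolution_ge0 (op_norm_bound (vertex_markov N)) Ll Lu Pul.
  have := l2norm_vertex0 (u := fun x => Num.max (- u x) 0) (L2_pos (L2realN Lu)) n0 x.
  by case: (leP (- u x) 0) => h; lra.
have up : positive F0 (fun x _ => u x) by move=> *; exact: u0.
have nbr0 x y : u x = 0 -> nbr N x y -> u y = 0.
  move=> ux xy; have h := act_ge_term Lu u0 xy; have h' := Pu_le x.
  rewrite ux mulr0 in h'; have := le_trans h h'.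
  rewrite pmulr_rle0 ?invr_gt0 ?m0_gt0// pmulr_rle0 ?cond_gt0// => uy.
  by apply/eqP; rewrite eq_le uy u0.
have path0 p x : path (nbr N) x p -> u x = 0 -> u (last x p) = 0.
  by elim: p x => //= y p IH x /andP[xy yp] ux; apply: IH yp _; exact: nbr0 xy.
exists u; split=> x.
  rewrite lt_neqAle u0 andbT eq_sym; apply/eqP => ux.
  have [p xp po] := nbr_connected N x v0.
  have uo : u v0 = 0 by rewrite -po; exact: path0 xp ux.
  have := uE v0; rewrite uo mulr0 eqxx mulr1n.
  by move: (act_ge0 (vertex_markov N) Lu up (d v0)) => h e; lra.
have e : vertex_app N (fun x _ => (u x)%:E) x 0%R = (P (fun x _ => u x) x 0)%:E.
  rewrite (act_pos (vertex_markov N) Lu up (d x)) fineK//.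
  exact: (app_fin (vertex_markov N) Lu up (d x)).
by rewrite e lee_fin.
Qed.

End Spectra.

Section SineProfile.
Context {R : realType}.
Variable w : R.
Hypothesis w01 : 0 < w <= pi / 2.

Let w0 : 0 < w. Proof. by case/andP: w01. Qed.
Let wpi2 : w <= pi / 2. Proof. by case/andP: w01. Qed.
Let wpi : w < pi. Proof. have h := pi_gt0 R; have h' := wpi2; lra. Qed.
Let sinw : 0 < sin w. Proof. by rewrite sin_gt0_pi// w0 wpi. Qed.

Let sine (t : R) : R := sin (w * t).

Let sine0 : sine 0 = 0.
Proof. by rewrite /sine mulr0 sin0. Qed.

Let sine_gt0 t : 0 < t <= 1 -> 0 < sine t.
Proof.
move=> /andP[t0 t1]; rewrite /sine sin_gt0_pi// mulr_gt0//=.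
by apply: le_lt_trans wpi; rewrite ler_piMr// ltW.
Qed.

Let sine_derive (t : R) : is_derive t (1 : R) sine
  ((sine (1 - t) + cos w * sine t) / (sin w / w)).
Proof.
have h : is_derive t (1 : R) sine (w * cos (w * t)).
  have hw : is_derive t (1 : R) ( *%R w) w.
    apply: (is_derive_eq (is_deriveM (is_derive_cst w t 1) (is_derive_id t 1))).
    by rewrite scaler0 addr0 /GRing.scale /= mulr1.
  rewrite mulrC; exact: (is_derive1_comp (is_derive_sin (w * t)) hw).
apply: (is_derive_eq h); rewrite /sine mulrBr mulr1 sinB.
by field; rewrite !gt_eqF.
Qed.

Definition sine_profile : profile (cos w) (sin w / w) :=
  Profile sine0 sine_gt0 sine_derive.

End SineProfile.

Lemma linear_derive (R : realType) (t : R) :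
  is_derive t (1 : R) id ((id (1 - t) + 1 * id t) / 1).
Proof. by apply: (is_derive_eq (is_derive_id t 1)) => /=; lra. Qed.

Definition linear_profile (R : realType) : profile (1 : R) 1 :=
  @Profile R 1 1 id erefl (fun t h => proj1 (andP h)) (@linear_derive R).

Section SpectralRadius.
Context {R : realType} {V : countType} (N : network R V).
Local Notation L := (op_norm (vertex_markov N)).

(* [superharmonic_exists] asks for cos v > |P|, which holds for v < w only;
   the bound at w follows by continuity. *)
Let sinc_bound (w m : R) : 0 < w -> (forall v, 0 < v < w -> m <= sin v / v) ->
  m <= sin w / w.
Proof.
move=> w0 H; rewrite ler_pdivlMr// -subr_ge0.
pose f (x : R) := sin x - m * x.
have cf : f x @[x --> w^'-] --> f w.
  apply: cvg_at_left_filter; apply: cvgB; first exact: continuous_sin.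
  by apply: cvgMr; exact: cvg_id.
rewrite -/(f w) -(cvg_lim _ cf)//; apply: limr_ge; first by apply/cvg_ex; exists (f w).
near=> v; have vw : 0 < v < w by apply/andP; split; near: v;
  [exact: nbhs_left_gt|exact: nbhs_left_lt].
by have := H v vw; have /andP[v0 _] := vw; rewrite ler_pdivlMr// -subr_ge0.
Unshelve. all: by end_near. Qed.

Lemma rhoA_profile (l : R) (phi : profile L l) : 0 < l ->
  (forall m, (forall K, op_bound (skeleton_markov N) K -> m <= K) -> m <= l) ->
  rhoA N = l.
Proof.
move=> l0 ub; have L0 := op_norm_transition_gt0 N.
have L20 : 0 < L / 2 by rewrite divr_gt0.
have [|b b0 Hb] := approximate_interpolate (N := N) phi (ltW L0) l0 L20.
  by move=> e e0; exact: approximate_eigenvector.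
exact: rhoA_eq (ltW l0) b0 Hb ub.
Qed.

(** Here the constant 1 is harmonic and gives the upper bound at l = 1 itself. *)
Lemma rhoA_critical : L = 1 -> rhoA N = 1.
Proof.
move=> L1; have := @rhoA_profile 1; rewrite L1 => /(_ (linear_profile R) ltr01); apply.
move=> m; apply.
apply: (@superharmonic_op_bound R V N 1 1 (linear_profile R) ler01 ltr01 (fun=> 1)).
  by move=> x; exact: ltr01.
by move=> x; rewrite mulr1; exact: (app_cst1 (vertex_markov N) (vertex_dom N x)).
Qed.

Lemma rhoA_subcritical : L < 1 -> rhoA N = Num.sqrt (1 - L ^+ 2) / acos L.
Proof.
move=> L1; have L0 := op_norm_transition_gt0 N.
have L11 : -1 <= L <= 1 by rewrite (ltW L1) andbT; lra.
have Li : L \in `[(-1), 1] by rewrite in_itv.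
rewrite -sin_acos//; set w := acos L.
have cosw : cos w = L by rewrite /w acosK.
have w0 : 0 < w by rewrite acos_gt0// L1 andbT; lra.
have pi0 := pi_gt0 R.
have wpi : w <= pi by rewrite acos_lepi.
have cos_lt v v' : 0 <= v <= pi -> 0 <= v' <= pi -> (cos v < cos v') = (v' < v).
  by move=> hv hv'; rewrite ltr_cos ?in_itv.
have wpi2 : w < pi / 2.
  rewrite -cos_lt ?cos_pihalf ?cosw//; first by apply/andP; lra.
  by rewrite (ltW w0).
have w01 : 0 < w <= pi / 2 by rewrite w0 ltW.
have sinw : 0 < sin w / w by rewrite divr_gt0// sin_gt0_pi// w0; lra.
have := @rhoA_profile (sin w / w); rewrite -{1}cosw.
move=> /(_ (sine_profile w01) sinw); apply=> m HK.
apply: sinc_bound => // v /andP[v0 vw].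
have v01 : 0 < v <= pi / 2 by rewrite v0; lra.
have Lv : L < cos v by rewrite -cosw cos_lt//; apply/andP; lra.
have [h [h0 hle]] := superharmonic_exists Lv.
apply: HK; apply: (superharmonic_op_bound (sine_profile v01) _ _ h0 hle).
  by rewrite (le_trans _ (ltW Lv))// ltW.
by rewrite divr_gt0// sin_gt0_pi// v0; lra.
Qed.

End SpectralRadius.

Theorem corollary1p4 (R : realType) (V : countType) (N : network R V) :
  (rhoP N = 1 -> rhoA N = 1) /\
  (rhoP N < 1 ->
     rhoA N = Num.sqrt (1 - rhoP N ^+ 2) / acos (rhoP N)).
Proof.
rewrite rhoP_op_norm; split; [exact: rhoA_critical|exact: rhoA_subcritical].
Qed.
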